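(* Let $p,q$ be positive integers. The following conditions are equivalent for $\Lambda\in SYD(q,p)$: (1) $\Lambda$ is admissible, i.e. $\mathrm{sh}(\Lambda)=\Lambda^++\Lambda^-$. (2) $2\dim\mathcal O(\Lambda)=2|\Lambda^+||\Lambda^-|+\dim\mathcal M(\Lambda^+,\Lambda^-)$. (3) $\Lambda$ is maximal (with respect to $\preceq$) in $\{\Upsilon\in SYD(q,p)\mid(\Upsilon^+,\Upsilon^-)=(\Lambda^+,\Lambda^-)\}$. (4) $\overline{\mathcal O(\Lambda)}$ is an irreducible component of $\overline{\mu_H^{-1}(\mathcal M(\Lambda^+,\Lambda^-))}$.
   Context: Everything is over $\mathbb C$. A partition $\lambda$ is a weakly decreasing sequence $(\lambda(1),\lambda(2),\dots)$ of positive integers (zero beyond its length), identified with its Young diagram; $|\lambda|$ is its size and $(\nu+\lambda)(i)=\nu(i)+\lambda(i)$. Signed Young diagrams. A $\pm$-filling of a Young diagram assigns $+$ or $-$ to each box so that adjacent boxes in the same row have opposite signs. Two $\pm$-fillings are equivalent if they differ by a permutation of rows of equal size; a signed Young diagram is an equivalence class. $SYD(q,p)$ is the set of those with $q$ boxes $+$ and $p$ boxes $-$; $\mathrm{sh}(\Lambda)$ is the underlying partition of $q+p$. $\Lambda^+$ (resp. $\Lambda^-$) is the partition of $q$ (resp. $p$) obtained by removing all $-$ (resp. $+$) boxes and rearranging rows into weakly decreasing order. Geometry. Let $\dim V_q=q$, $\dim V_p=p$, $H=\mathrm{Hom}(V_q,V_p)$, $H^\vee=\mathrm{Hom}(V_p,V_q)$,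 $K=GL(V_q)\times GL(V_p)$ acting on $H\times H^\vee$ by $(g,h)\bullet(x,y)=(hxg^{-1},gyh^{-1})$, and $\mathcal O=\{(x,y)\in H\times H^\vee:xy\text{ nilpotent}\}$. For $(x,y)\in\mathcal O$, give $V_q$ degree $+$ and $V_p$ degree $-$; $V_q\oplus V_p$ is a direct sum of strings, i.e. subspaces with basis of homogeneous vectors $v_1,\dots,v_k$, where $v_{j+1}$ is the image of $v_j$ under $x$ (if $v_j\in V_q$) or $y$ (if $v_j\in V_p$) and $v_k$ is sent to $0$; each string contributes a row of $k$ boxes whose signs read from right to left are the degrees of $v_1,\dots,v_k$. This attaches a signed Young diagram in $SYD(q,p)$ to $(x,y)$; $\mathcal O(\Lambda)$ is the set of pairs with diagram $\Lambda$. The $\mathcal O(\Lambda)$ are exactly the $K$-orbits in $\mathcal O$. The order on $SYD(q,p)$ is $\Lambda\preceq\Upsilon\iff\overline{\mathcal O(\Lambda)}\subset\overline{\mathcal O(\Upsilon)}$. The map $\mu_H:H\times H^\vee\to\mathfrak{gl}(V_q)\times\mathfrak{gl}(V_p)$ is $\mu_H(x,y)=(yx,xy)$. For partitions $\nu$ of $q$ and $\lambda$ of $p$, $\mathcal M(\nu,\lambda)=\mathcal N(\nu)\times\mathcal N(\lambda)\subset\mathfrak{gl}(V_q)\times\mathfrak{gl}(V_p)$, where $\mathcal N(\nu)$ is the set of nilpotent endomorphisms whose Jordan block sizes form the partition $\nu$. *)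

(* Defs.v *)
From HB Require Import structures.
From mathcomp Require Import all_boot all_order all_algebra generic_quotient.
From mathcomp Require Import boolp classical_sets reals.
From mathcomp Require Import complex.
From mathcomp Require mpoly.

Set Implicit Arguments.
Unset Strict Implicit.
Unset Printing Implicit Defensive.

Import GRing.Theory.
Local Open Scope ring_scope.

(* Partitions are weakly decreasing sequences of positive integers; their
   parts are indexed from 0, and [nth 0] gives the convention that parts are
   zero beyond the length. *)

Definition is_partition (n : nat) (nu : seq nat) : bool :=
  [&& sorted geq nu, 0%N \notin nu & sumn nu == n].

Definition part_add (nu la : seq nat) : seq nat :=
  mkseq (fun i => nth 0 nu i + nth 0 la i)%N (maxn (size nu) (size la)).

(* The sign + is [true] and the sign - is [false]. *)

Definition alternating (r : seq bool) : bool :=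
  sorted (fun a b : bool => a != b) r.

(* A filling is given by its rows, from top to bottom. *)
Definition is_filling (q p : nat) (rows : seq (seq bool)) : bool :=
  [&& is_partition (q + p) (map size rows), all alternating rows,
      count_mem true (flatten rows) == q &
      count_mem false (flatten rows) == p].

Record filling (q p : nat) := Filling {
  rows :> seq (seq bool);
  fillingP : is_filling q p rows }.

HB.instance Definition _ q p := [isSub for @rows q p].
HB.instance Definition _ q p := [Choice of filling q p by <:].

(* Rows are sorted by size, so two fillings whose lists of rows are
   permutations of each other have the same shape and differ by a permutation
   of rows of equal size. *)
Definition filling_equiv q p (L U : filling q p) : bool := perm_eq L U.

Lemma filling_equiv_rel q p : equiv_class_of (@filling_equiv q p).
Proof.
split; [exact: perm_refl|exact: perm_sym|].
by move=> L M U; apply: perm_trans.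
Qed.

Canonical filling_equiv_canonical q p := EquivRelPack (@filling_equiv_rel q p).

Definition SYD (q p : nat) : Type := {eq_quot (@filling_equiv q p)}%qT.

HB.instance Definition _ q p := Choice.on (SYD q p).
HB.instance Definition _ q p := EqQuotient.on (SYD q p).

Section SignedYoungDiagrams.
Variables q p : nat.
Implicit Types L : SYD q p.

(* The definitions below use a representative but do not depend on it. *)

Definition syd_rows L : seq (seq bool) := repr L.

Definition sh L : seq nat := map size (syd_rows L).

(* Rows with no box of sign [b] become empty and disappear. *)
Definition sign_part (b : bool) L : seq nat :=
  sort geq [seq k <- [seq count_mem b r | r <- syd_rows L] | (0 < k)%N].

Definition syd_plus := sign_part true.
Definition syd_minus := sign_part false.

Definition admissible L : Prop := sh L = part_add (syd_plus L) (syd_minus L).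

End SignedYoungDiagrams.

Local Open Scope classical_set_scope.

Section Zariski.
Variables (K : fieldType) (V : vectType K).
Implicit Types A F G X Z : set V.

(* Polynomial functions on V do not depend on the basis giving the
   coordinates. *)
Definition poly_eval (P : mpoly.mpoly (\dim {:V}) K) (v : V) : K :=
  mpoly.meval (fun i => coord (vbasis {:V}) i v) P.

Definition zariski_closed F : Prop :=
  exists S : set (mpoly.mpoly (\dim {:V}) K),
    F = [set v | forall P, S P -> poly_eval P v = 0].

Definition zariski_closure A : set V := smallest zariski_closed A.

Definition irreducible A : Prop :=
  A !=set0 /\
  forall F G, zariski_closed F -> zariski_closed G ->
    A `<=` F `|` G -> A `<=` F \/ A `<=` G.

Definition irreducible_component Z X : Prop :=
  [/\ irreducible Z, Z `<=` X &
      forall A, irreducible A -> Z `<=` A -> A `<=` X -> A = Z].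

Definition closed_in X Z : Prop :=
  exists2 F, zariski_closed F & Z = X `&` F.

Definition irreducible_chain X (d : nat) (c : nat -> set V) : Prop :=
  (forall i, (i <= d)%N -> closed_in X (c i) /\ irreducible (c i)) /\
  (forall i, (i < d)%N -> c i `<` c i.+1).

Definition is_dim X (d : nat) : Prop :=
  (exists c, irreducible_chain X d c) /\
  (forall e c, irreducible_chain X e c -> (e <= d)%N).

(* The Krull dimension of X in the subspace topology; the default value 0 is
   only reached for empty X, as V has finite dimension. *)
Definition zariski_dim X : nat := xget 0%N (is_dim X).

End Zariski.

Section Orbits.
Variables (K : fieldType) (q p : nat).

(* V_q and V_p are the spaces of column vectors, and matrices act on the
   left. *)
Definition pairs : vectType K := ('M[K]_(p, q) * 'M[K]_(q, p))%type.
Definition gl_pairs : vectType K := ('M[K]_q * 'M[K]_p)%type.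

Definition nilpotent_mx n (A : 'M[K]_n) : Prop := exists k, A ^+ k = 0.

(* A is nilpotent with a single Jordan block on the span of a linearly
   independent Jordan chain. *)
Definition jordan_chain n (A : 'M[K]_n) (s : seq 'cV[K]_n) : Prop :=
  if s is v :: t then
    path (fun u w => w == A *m u) v t /\ A *m last v t = 0
  else False.

Definition nilp_class n (nu : seq nat) : set 'M[K]_n :=
  [set A | nilpotent_mx A /\
     exists cs : seq (seq 'cV[K]_n),
       [/\ (forall s, s \in cs -> jordan_chain A s),
           basis_of fullv (flatten cs) & perm_eq (map size cs) nu]].

Definition M_class (nu la : seq nat) : set gl_pairs :=
  [set z | nilp_class nu z.1 /\ nilp_class la z.2].

Definition muH (z : pairs) : gl_pairs := (z.2 *m z.1, z.1 *m z.2).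

(* Homogeneous vectors of V_q (+) V_p: [inl] for degree +, [inr] for -. *)
Definition homog : Type := ('cV[K]_q + 'cV[K]_p)%type.

Definition degree (v : homog) : bool := if v is inl _ then true else false.

Definition homog_vec (v : homog) : 'cV[K]_(q + p) :=
  match v with inl a => col_mx a 0 | inr b => col_mx 0 b end.

Definition pair_act (z : pairs) (v : homog) : homog :=
  match v with inl a => inr (z.1 *m a) | inr b => inl (z.2 *m b) end.

Definition is_string (z : pairs) (s : seq homog) : Prop :=
  if s is v :: t then
    path (fun u w => w == pair_act z u) v t
    /\ homog_vec (pair_act z (last v t)) = 0
  else False.

Definition string_row (s : seq homog) : seq bool := rev (map degree s).

Definition has_diagram (z : pairs) (L : SYD q p) : Prop :=
  exists ss : seq (seq homog),
    [/\ (forall s, s \in ss -> is_string z s),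
        basis_of fullv (map homog_vec (flatten ss)) &
        perm_eq (map string_row ss) (syd_rows L)].

Definition nilp_pairs : set pairs := [set z | nilpotent_mx (z.1 *m z.2)].

Definition nilp_orbit (L : SYD q p) : set pairs :=
  nilp_pairs `&` [set z | has_diagram z L].

Definition syd_le (L U : SYD q p) : Prop :=
  zariski_closure (nilp_orbit L) `<=` zariski_closure (nilp_orbit U).

Definition syd_maximal (S : set (SYD q p)) (L : SYD q p) : Prop :=
  S L /\ forall U, S U -> syd_le L U -> U = L.

End Orbits.

Arguments nilp_class K n nu _ : clear implicits.
Arguments M_class K q p nu la _ : clear implicits.
Arguments muH K q p z : clear implicits.
Arguments nilp_orbit K {q p} L.
Arguments syd_le K {q p} L U.
Arguments syd_maximal K {q p} S L.

(* Main.v *)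
(* A pair (x, y) is viewed as the odd operator on V_q (+) V_p, and mu_H(x, y) as
   its square; all orbits are then orbits of the invertible even matrices acting
   by conjugation, and they are classified by string decompositions.

   The orbit of x is modelled on a linear complement C of the centralizer Z of x
   in the even matrices: for generic even g some gz with z in Z lies in 1 + C, and
   c is a rational function of v = (1 + c) x (1 + c)^-1, because it solves the
   linear system c x - v c = v - x.  So the Krull dimension of the orbit is dim C.
   The dimension of Z is counted on pairs of strings.  Writing a_i and b_i for the
   numbers of + and - in row i, condition (2) becomes

     sum_(i,j) min(a_i + b_i, a_j + b_j)
       = sum_(i,j) min(a_i, a_j) + sum_(i,j) min(b_i, b_j).

   Here >= holds termwise, strictly exactly for two rows of the same odd length
   with ends of opposite signs.  The absence of such rows is admissibility.  When
   they are present, of length 2m+1, sending the last vector of one string to t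
   times the last vector of the other one gives, for t <> 0, strings of lengths
   2m+2 and 2m, hence a strictly larger orbit in the same fibre of mu_H.  Finally,
   the ranks of the restrictions of the powers of the operator to V_q and V_p are
   lower semicontinuous and determine the diagram, and each fibre is a finite
   union of orbits by the graded Jordan decomposition. *)

Require Import Defs.
From HB Require Import structures.
From mathcomp Require Import all_boot all_order all_algebra.
From mathcomp Require Import boolp classical_sets reals.
From mathcomp Require Import complex.
From mathcomp Require Import (canonicals, coercions) mpoly.
From mathcomp Require Import zify ring.

Set Implicit Arguments.
Unset Strict Implicit.
Unset Printing Implicit Defensive.

Import GRing.Theory.
Local Open Scope ring_scope.
Local Open Scope classical_set_scope.

(** * Polynomial functions and the Zariski topology *)

(** Krull dimension is defined by chains of closed sets, so both bounds on it must be made by hand.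
    A chain of length d yields d algebraically independent polynomial functions, one for each strict
    inclusion. On the image of a rational map from a space of dimension D there are at most D such
    functions: the m^s monomials in s functions with exponents below m are pulled back into a space
    of dimension (dm+1)^D. Parametrizing an orbit by all even matrices would make D too large, hence
    the slice 1 + C. The reverse bound is an explicit chain, the images of the coordinate subspaces
    of C, separated by the rational functions giving c. Appending an equation of a smaller orbit to
    an independent family also shows that the boundary of an orbit has smaller dimension. The
    inequality between the sums of minima bounds the dimensions of all orbits in one fibre by the
    same number. Condition (2) says that this bound is attained, whence maximality; finiteness of
    the set of diagrams then gives (4), and the deformation closes the cycle. Statements about
    generic points are reduced to lines, where a nonzero polynomial has a non-root. *)

Definition infinite_field (K : fieldType) : Prop :=
  forall p : {poly K}, p != 0 -> exists t, p.[t] != 0.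

Section PolynomialFunctions.
Variables (K : fieldType) (V : vectType K).
Implicit Types (f g : V -> K).

Definition polyfun f : Prop := exists P, forall v, f v = poly_eval P v.

Lemma polyfun_ext f g : f =1 g -> polyfun g -> polyfun f.
Proof. by move=> fg [P gP]; exists P => v; rewrite fg gP. Qed.

Lemma polyfun_cst c : polyfun (fun=> c).
Proof. by exists (mpoly.mpolyC _ c) => v; rewrite /poly_eval mpoly.mevalC. Qed.

Lemma polyfunD f g : polyfun f -> polyfun g -> polyfun (fun v => f v + g v).
Proof.
by move=> [P fP] [Q gQ]; exists (P + Q) => v; rewrite fP gQ /poly_eval mpoly.mevalD.
Qed.

Lemma polyfunM f g : polyfun f -> polyfun g -> polyfun (fun v => f v * g v).
Proof.
by move=> [P fP] [Q gQ]; exists (P * Q) => v; rewrite fP gQ /poly_eval mpoly.mevalM.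
Qed.

Lemma polyfun_coord i : polyfun (coord (vbasis {:V}) i).
Proof.
by exists (mpoly.mpolyX K (mpoly.mnm1 i)) => v; rewrite /poly_eval mpoly.mevalXU.
Qed.

Lemma polyfun_sum I (r : seq I) (F : I -> V -> K) :
  (forall i, polyfun (F i)) -> polyfun (fun v => \sum_(i <- r) F i v).
Proof.
move=> HF; elim: r => [|i r IH].
  by apply: (polyfun_ext _ (polyfun_cst 0)) => v; rewrite big_nil.
by apply: (polyfun_ext _ (polyfunD (HF i) IH)) => v; rewrite big_cons.
Qed.

Lemma polyfun_prod I (r : seq I) (F : I -> V -> K) :
  (forall i, polyfun (F i)) -> polyfun (fun v => \prod_(i <- r) F i v).
Proof.
move=> HF; elim: r => [|i r IH].
  by apply: (polyfun_ext _ (polyfun_cst 1)) => v; rewrite big_nil.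
by apply: (polyfun_ext _ (polyfunM (HF i) IH)) => v; rewrite big_cons.
Qed.

Lemma polyfunX f n : polyfun f -> polyfun (fun v => f v ^+ n).
Proof.
move=> Hf; apply: (polyfun_ext _ (polyfun_prod (iota 0 n) (fun _ : nat => Hf))) => v.
by rewrite big_const_seq count_predT size_iota; elim: n => [|k IH] //=; rewrite exprS IH.
Qed.

Lemma polyfun_lin f : (forall a u v, f (a *: u + v) = a * f u + f v) -> polyfun f.
Proof.
move=> fL.
have f0 : f 0 = 0.
  have := fL 1 0 0; rewrite scaler0 addr0 mul1r => /eqP.
  by rewrite -subr_eq0 opprD addrA subrr add0r oppr_eq0 => /eqP.
have fsum I (r : seq I) (c : I -> K) (F : I -> V) :
    f (\sum_(i <- r) c i *: F i) = \sum_(i <- r) c i * f (F i).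
  by elim: r => [|i r IH]; rewrite ?big_nil // !big_cons fL IH.
have H i := polyfunM (polyfun_coord i) (polyfun_cst (f (vbasis {:V})`_i)).
apply: (polyfun_ext _ (polyfun_sum (index_enum _) H)) => v.
by rewrite [in LHS](coord_vbasis (memvf v)) fsum.
Qed.

(** Pull-backs along lines and along rational maps respect sums and products, so their properties
    need checking only on constants and coordinates. *)
Lemma polyfun_ind (S : (V -> K) -> Prop) :
  (forall f g, f =1 g -> S g -> S f) -> (forall c, S (fun=> c)) ->
  (forall i, S (coord (vbasis {:V}) i)) ->
  (forall f g, S f -> S g -> S (fun v => f v + g v)) ->
  (forall f g, S f -> S g -> S (fun v => f v * g v)) ->
  forall f, polyfun f -> S f.
Proof.
move=> Sext Scst Scoord SD SM f [P fP].
have Ssum I (r : seq I) (F : I -> V -> K) :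
    (forall i, S (F i)) -> S (fun v => \sum_(i <- r) F i v).
  move=> HF; elim: r => [|i r IH].
    by apply: (Sext _ _ _ (Scst 0)) => v; rewrite big_nil.
  by apply: (Sext _ _ _ (SD _ _ (HF i) IH)) => v; rewrite big_cons.
have Sprod I (r : seq I) (F : I -> V -> K) :
    (forall i, S (F i)) -> S (fun v => \prod_(i <- r) F i v).
  move=> HF; elim: r => [|i r IH].
    by apply: (Sext _ _ _ (Scst 1)) => v; rewrite big_nil.
  by apply: (Sext _ _ _ (SM _ _ (HF i) IH)) => v; rewrite big_cons.
have SX g n : S g -> S (fun v => g v ^+ n).
  move=> Sg; apply: (Sext _ _ _ (Sprod _ (iota 0 n) _ (fun _ => Sg))) => v.
  by rewrite big_const_seq count_predT size_iota; elim: n => [|k IH] //=; rewrite exprS IH.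
apply: (Sext _ _ fP); rewrite /poly_eval.
apply: Sext => [v|]; first exact: mpoly.mevalE.
by apply: Ssum => m; apply: SM; [exact: Scst | apply: Sprod => i; exact: SX].
Qed.

Lemma polyfun_line f u w : polyfun f ->
  exists p : {poly K}, forall t, f (u + t *: w) = p.[t].
Proof.
move: f; apply: (@polyfun_ind (fun f => exists p : {poly K}, forall t, f (u + t *: w) = p.[t]));
  [move=> f g fg [p gp]|move=> c|move=> i|move=> f g [p fp] [q gq]|move=> f g [p fp] [q gq]].
- by exists p => t; rewrite fg.
- by exists c%:P => t; rewrite hornerC.
- exists ((coord (vbasis {:V}) i u)%:P + 'X * (coord (vbasis {:V}) i w)%:P) => t.
  by rewrite linearD linearZ /= !hornerE.
- by exists (p + q) => t; rewrite hornerD fp gq.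
- by exists (p * q) => t; rewrite hornerM fp gq.
Qed.

Definition mxpolyfun m n (M : V -> 'M[K]_(m, n)) : Prop :=
  forall i j, polyfun (fun v => M v i j).

Lemma mxpolyfun_cst m n (M : 'M[K]_(m, n)) : mxpolyfun (fun=> M).
Proof. by move=> i j; exact: polyfun_cst. Qed.

Lemma mxpolyfun_mul m n r (M : V -> 'M[K]_(m, n)) (N : V -> 'M[K]_(n, r)) :
  mxpolyfun M -> mxpolyfun N -> mxpolyfun (fun v => M v *m N v).
Proof.
move=> HM HN i j; apply: polyfun_ext => [v|]; first exact: mxE.
by apply: polyfun_sum => k; apply: polyfunM.
Qed.

Lemma mxpolyfunX n (M : V -> 'M[K]_n) k :
  mxpolyfun M -> mxpolyfun (fun v => M v ^+ k).
Proof.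
move=> HM; elim: k => [|k IH]; first exact: mxpolyfun_cst.
move=> i j; apply: polyfun_ext => [v|]; first by rewrite exprS -mulmxE.
exact: mxpolyfun_mul.
Qed.

Lemma polyfun_det n (M : V -> 'M[K]_n) : mxpolyfun M -> polyfun (fun v => \det (M v)).
Proof.
move=> HM; apply: polyfun_sum => s; apply: polyfunM; first exact: polyfun_cst.
by apply: polyfun_prod => i; exact: HM.
Qed.

Lemma mxpolyfun_adj n (M : V -> 'M[K]_n) :
  mxpolyfun M -> mxpolyfun (fun v => \adj (M v)).
Proof.
move=> HM i j; apply: polyfun_ext => [v|]; first exact: mxE.
apply: polyfunM; first exact: polyfun_cst.
by apply: polyfun_det => k l; apply: polyfun_ext (HM (lift j k) (lift i l)) => v; rewrite !mxE.
Qed.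

Lemma mxpolyfun_lin m n (M : V -> 'M[K]_(m, n)) :
  (forall a u v, M (a *: u + v) = a *: M u + M v) -> mxpolyfun M.
Proof. by move=> ML i j; apply: polyfun_lin => a u v; rewrite ML !mxE. Qed.

(** On the line through [u] and [w] both functions are nonzero one-variable polynomials, and so is
    their product. In other words, two nonempty principal open sets meet. *)
Lemma polyfun_domain (Kinf : infinite_field K) f g u w :
  polyfun f -> polyfun g -> f u != 0 -> g w != 0 ->
  exists v, f v * g v != 0.
Proof.
move=> /(polyfun_line u (w - u))[p fp] /(polyfun_line u (w - u))[r gr] fu gw.
have p0 : p != 0.
  by apply: contra_neq fu => p0; rewrite -[u]addr0 -(scale0r (w - u)) fp p0 horner0.
have r0 : r != 0.
  apply: contra_neq gw => r0.
  by have := gr 1; rewrite scale1r addrC subrK => ->; rewrite r0 horner0.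
have [|t] := Kinf (p * r); first by rewrite mulf_neq0.
by rewrite hornerM -fp -gr; exists (u + t *: (w - u)).
Qed.

End PolynomialFunctions.

Section ZariskiTopology.
Variables (K : fieldType) (V : vectType K).
Implicit Types (f g : V -> K) (X Y A B F G : set V).

Lemma zariski_closed_zeros f : polyfun f -> zariski_closed [set v | f v = 0].
Proof.
move=> [P fP]; exists [set P]; apply/seteqP; split => v /=.
  by move=> fv Q ->; rewrite -fP.
by move=> /(_ P erefl); rewrite -fP.
Qed.

Lemma zariski_closureE A : zariski_closure A =
  [set v | forall f, polyfun f -> (forall u, A u -> f u = 0) -> f v = 0].
Proof.
apply/seteqP; split => v /=.
  by move=> Av f pf Af; apply: (Av _ (conj (zariski_closed_zeros pf) Af)).
move=> H F [[S ->] AF] P SP.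
by apply: H => [|u Au]; [exists P | exact: AF].
Qed.

Lemma zariski_closed_closure A : zariski_closed (zariski_closure A).
Proof.
exists [set P | forall u, A u -> poly_eval P u = 0].
rewrite zariski_closureE; apply/seteqP; split => v /= H.
  by move=> P HP; apply: H HP; exists P.
by move=> f [P fP] Af; rewrite fP; apply: H => u Au; rewrite -fP Af.
Qed.

Lemma sub_zariski_closure A : A `<=` zariski_closure A.
Proof. exact: sub_gen_smallest. Qed.

Lemma zariski_closure_sub A F : zariski_closed F -> A `<=` F -> zariski_closure A `<=` F.
Proof. exact: smallest_sub. Qed.

Lemma zariski_closureS A B : A `<=` B -> zariski_closure A `<=` zariski_closure B.
Proof.
move=> AB; apply: zariski_closure_sub; first exact: zariski_closed_closure.
exact: subset_trans AB (@sub_zariski_closure B).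
Qed.

Lemma zariski_closedU F G : zariski_closed F -> zariski_closed G -> zariski_closed (F `|` G).
Proof.
move=> [S ->] [T ->].
exists [set R | exists P Q, [/\ S P, T Q & R = P * Q]]; apply/seteqP; split => v /=.
  by case=> H R [P [Q [SP TQ ->]]]; rewrite /poly_eval mpoly.mevalM;
     [rewrite [X in X * _]H ?mul0r | rewrite [X in _ * X]H ?mulr0].
move=> H; have [|/existsNP[P /not_implyP[SP Pv]]] := pselect (forall P, S P -> poly_eval P v = 0).
  by left.
right => Q TQ; have /eqP : poly_eval (P * Q) v = 0 by apply: H; exists P, Q.
by rewrite /poly_eval mpoly.mevalM mulf_eq0 => /orP[/eqP//|/eqP].
Qed.

Lemma irreducible_closure A : irreducible A -> irreducible (zariski_closure A).
Proof.
move=> [[a Aa] HA]; split; first by exists a; exact: sub_zariski_closure.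
move=> F G cF cG /(subset_trans (@sub_zariski_closure A)) /(HA _ _ cF cG)[H|H];
  [left|right]; exact: zariski_closure_sub.
Qed.

Lemma irreducible_between A B :
  irreducible A -> A `<=` B -> B `<=` zariski_closure A -> irreducible B.
Proof.
move=> [[a Aa] HA] AB BA; split; first by exists a; exact: AB.
move=> F G cF cG /(subset_trans AB) /(HA _ _ cF cG)[H|H];
  [left|right]; exact: (subset_trans BA (zariski_closure_sub _ H)).
Qed.

Lemma irreducible_polyfunM A f g : irreducible A -> polyfun f -> polyfun g ->
  (forall v, A v -> f v * g v = 0) ->
  (forall v, A v -> f v = 0) \/ (forall v, A v -> g v = 0).
Proof.
move=> [_ HA] pf pg H; apply: (HA _ _ (zariski_closed_zeros pf) (zariski_closed_zeros pg)).
by move=> v /H /eqP; rewrite mulf_eq0 => /orP[] /eqP; [left|right].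
Qed.

Lemma zariski_closed_cover (I : eqType) (r : seq I) (F : I -> set V) :
  (forall i, zariski_closed (F i)) -> zariski_closed [set v | exists2 i, i \in r & F i v].
Proof.
move=> cF; elim: r => [|j r IH].
  (* The empty union is the zero set of the constant function 1. *)
  suff -> : [set v | exists2 i, i \in [::] & F i v] = [set v : V | (1 : K) = 0].
    by apply: zariski_closed_zeros; exact: polyfun_cst.
  by apply/seteqP; split => v [] // /eqP; rewrite oner_eq0.
suff -> : [set v | exists2 i, i \in j :: r & F i v] =
          F j `|` [set v | exists2 i, i \in r & F i v] by apply: zariski_closedU.
apply/seteqP; split => v /=.
  by move=> [k]; rewrite inE => /orP[/eqP->|kr Fk]; [left|right; exists k].
by move=> [Fj|[k kr Fk]]; [exists j; rewrite ?mem_head|exists k; rewrite // inE kr orbT].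
Qed.

Lemma irreducible_cover (I : eqType) (r : seq I) (F : I -> set V) A : irreducible A ->
  (forall i, zariski_closed (F i)) ->
  (forall v, A v -> exists2 i, i \in r & F i v) -> exists2 i, i \in r & A `<=` F i.
Proof.
move=> [[a Aa] HA] cF; elim: r => [|i r IH] H; first by have [] := H a Aa.
have [|H1|H2] := HA _ _ (cF i) (zariski_closed_cover r cF).
- move=> v /H [k]; rewrite inE => /orP[/eqP->|kr Fk]; first by left.
  by right; exists k.
- by exists i; rewrite ?mem_head.
- by have [k kr Ak] := IH H2; exists k; rewrite // inE kr orbT.
Qed.

End ZariskiTopology.

(** * Algebraic independence and the Krull dimension of parametrized sets *)

Section AlgebraicIndependence.
Variables (K : fieldType) (V : vectType K).
Implicit Types (f g : V -> K) (fs : seq (V -> K)) (X Y : set V) (c : seq nat -> K).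

(** The value at [fs] of a polynomial with all exponents below [m]; [c] gives the coefficient of
    each exponent list. The nesting, one variable at a time, singles out the powers of the first
    function. *)
Fixpoint comb m fs c (v : V) : K :=
  if fs is f :: fs' then \sum_(j < m) f v ^+ j * comb m fs' (fun l => c (val j :: l)) v
  else c [::].

Definition algindep X fs : Prop := forall m c,
  (forall v, X v -> comb m fs c v = 0) ->
  forall l, size l = size fs -> all (fun j => (j < m)%N) l -> c l = 0.

Fixpoint polyfuns fs : Prop := if fs is f :: fs' then polyfun f /\ polyfuns fs' else True.

Lemma polyfun_comb m fs c : polyfuns fs -> polyfun (comb m fs c).
Proof.
elim: fs c => [|f fs IH] c /=; first by move=> _; exact: polyfun_cst.
move=> [pf pfs]; apply: polyfun_sum => j; apply: polyfunM; first exact: polyfunX.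
exact: IH.
Qed.

Lemma comb_eq0 m fs c v :
  (forall l, size l = size fs -> all (fun j => (j < m)%N) l -> c l = 0) ->
  comb m fs c v = 0.
Proof.
elim: fs c => [|f fs IH] c H /=; first exact: H.
rewrite big1 // => j _; rewrite IH ?mulr0 // => l sl al.
by apply: H; rewrite /= ?sl ?ltn_ord.
Qed.

Lemma comb_sum (I : finType) m fs (a : I -> K) (c : I -> seq nat -> K) v :
  comb m fs (fun l => \sum_i a i * c i l) v = \sum_i a i * comb m fs (c i) v.
Proof.
elim: fs c => [|f fs IH] c //=.
transitivity (\sum_(j < m) \sum_i a i * (f v ^+ j * comb m fs (fun l => c i (val j :: l)) v)).
  by apply: eq_bigr => j _; rewrite IH mulr_sumr; apply: eq_bigr => i _; rewrite mulrCA.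
by rewrite exchange_big; apply: eq_bigr => i _; rewrite mulr_sumr.
Qed.

Lemma algindep_nil X : X !=set0 -> algindep X [::].
Proof. by move=> [x Xx] m c H [|//] _ _; exact: (H x Xx). Qed.

Lemma algindepS X Y fs : X `<=` Y -> algindep X fs -> algindep Y fs.
Proof. by move=> XY HX m c H; apply: HX => v /XY; exact: H. Qed.

(* A relation that involves f, divided by the largest possible power of f,
   becomes on the zero set of f a relation among the other functions. *)
Lemma algindep_cons X Y f fs : irreducible Y -> X `<=` zariski_closure Y ->
  polyfuns fs -> polyfun f -> (forall v, X v -> f v = 0) ->
  (exists2 v, Y v & f v != 0) -> algindep X fs -> algindep Y (f :: fs).
Proof.
move=> irrY XY pfs pf fX [w Yw fw] HX m c H [//|j l] /= [sl] /andP[jm al].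
(* Induction on the exponent of f: the coefficients of lower powers are already zero, so f^j factors
   out of the relation. *)
elim/ltn_ind: j jm l sl al => j IH jm l sl al.
pose e i := comb m fs (fun l => c (i :: l)).
have pe i : polyfun (e i) by exact: polyfun_comb.
pose G v := \sum_(k < m - j) f v ^+ k * e (j + k)%N v.
have pG : polyfun G by apply: polyfun_sum => k; apply: polyfunM; [exact: polyfunX|].
have HG v : Y v -> f v ^+ j * G v = 0.
  move=> /H /= Hv; rewrite /G mulr_sumr -[RHS]Hv.
  rewrite -(big_mkord xpredT (fun i => f v ^+ i * e i v)).
  rewrite (big_cat_nat _ (n := j)) //= 1?ltnW // [X in _ = X + _]big1_seq ?add0r; last first.
    move=> i /=; rewrite mem_index_iota /= => ij; rewrite [e _ _]comb_eq0 ?mulr0 // => l' sl' al'.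
    by apply: IH => //; exact: ltn_trans jm.
  rewrite -[X in index_iota X]add0n big_addn big_mkord; apply: eq_bigr => k _.
  by rewrite mulrA -exprD addnC.
have G0 : forall v, Y v -> G v = 0.
  have [fj0|] := irreducible_polyfunM irrY (polyfunX j pf) pG HG; last by [].
  by have := fj0 w Yw => /eqP; rewrite expf_eq0 (negPf fw) andbF.
have G0X v : X v -> e j v = 0.
  move=> Xv; have := XY v Xv; rewrite zariski_closureE => /(_ _ pG G0).
  rewrite /G -(subnSK jm) big_ord_recl expr0 mul1r addn0 big1 ?addr0 //.
  by move=> k _; rewrite fX // exprS !mul0r.
exact: (HX _ _ G0X l sl al).
Qed.

(** Each strict inclusion contributes an equation of the smaller member that does not vanish on the
    larger, irreducible one. *)
Lemma chain_algindep X d s : irreducible_chain X d s ->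
  exists fs, [/\ size fs = d, polyfuns fs & algindep (s d) fs].
Proof.
move=> [H1 H2]; suff H i : (i <= d)%N ->
  exists fs, [/\ size fs = i, polyfuns fs & algindep (s i) fs] by exact: H.
elim: i => [_|i IH id].
  by exists [::]; split=> //; apply: algindep_nil; have [_ []] := H1 0%N (leq0n d).
have [fs [sfs pfs ifs]] := IH (ltnW id).
have [[F [S FE] siE] _] := H1 i (ltnW id).
have [[G _ sSiE] irr] := H1 i.+1 id.
have [sub nsub] := H2 i id.
have [w sw nw] : exists2 w, s i.+1 w & ~ s i w.
  by apply: contrapT => H; apply: nsub => w sw; apply: contrapT => nw; apply: H; exists w.
have Xw : X w by move: sw; rewrite sSiE => -[].
have [P SP Pw] : exists2 P, S P & poly_eval P w != 0.
  apply: contrapT => H; apply: nw; rewrite siE FE; split => // P SP.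
  by apply/eqP/negPn/negP => Pw; apply: H; exists P.
exists (poly_eval P :: fs); split; rewrite /= ?sfs //; first by split => //; exists P.
apply: (algindep_cons irr) ifs => //.
- exact: subset_trans sub (@sub_zariski_closure _ _ _).
- by exists P.
- by move=> v; rewrite siE FE => -[_]; exact.
- by exists w.
Qed.

Lemma chain_sub X d s : irreducible_chain X d s -> s d `<=` X.
Proof. by move=> [/(_ d (leqnn d))[[F _ ->] _] _]; exact: subIsetl. Qed.

End AlgebraicIndependence.

(** * Polynomial functions with bounded exponents *)

Section MonomialDegree.
Variables (K : fieldType) (W : vectType K).
Implicit Types (f g : W -> K).
Notation D := (\dim {:W}).
Notation xi := (coord (vbasis {:W})).

(* Exponents are bounded variable by variable, so that there are (d+1)^D
   monomials available. *)
Definition mondeg d f : Prop := exists2 l : seq (K * {ffun 'I_D -> nat}),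
  forall x i, x \in l -> (x.2 i <= d)%N &
  forall u, f u = \sum_(x <- l) x.1 * \prod_i xi i u ^+ x.2 i.

Lemma mondegW d d' f : (d <= d')%N -> mondeg d f -> mondeg d' f.
Proof.
by move=> dd' [l al fl]; exists l => // x i xl; exact: leq_trans (al x i xl) dd'.
Qed.

Lemma mondeg_ext d f g : f =1 g -> mondeg d g -> mondeg d f.
Proof. by move=> fg [l al gl]; exists l => // u; rewrite fg gl. Qed.

Lemma mondeg_cst d c : mondeg d (fun=> c).
Proof.
exists [:: (c, [ffun=> 0%N])] => [x i|u]; first by rewrite inE => /eqP-> /=; rewrite ffunE.
by rewrite big_seq1 big1 ?mulr1 // => i _; rewrite ffunE expr0.
Qed.

Lemma mondegD d f g : mondeg d f -> mondeg d g -> mondeg d (fun u => f u + g u).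
Proof.
move=> [l al fl] [l' al' gl]; exists (l ++ l') => [x i|u]; last by rewrite big_cat fl gl.
by rewrite mem_cat => /orP[]; [exact: al|exact: al'].
Qed.

Lemma mondegM d d' f g : mondeg d f -> mondeg d' g -> mondeg (d + d') (fun u => f u * g u).
Proof.
move=> [l al fl] [l' al' gl].
exists [seq (x.1 * y.1, [ffun i => (x.2 i + y.2 i)%N]) |
         x : K * {ffun 'I_D -> nat} <- l, y : K * {ffun 'I_D -> nat} <- l'] => [z i|u].
  by move=> /allpairsP [[x y] /= [xl yl ->]] /=; rewrite ffunE leq_add ?al ?al'.
rewrite fl gl big_allpairs_dep mulr_suml; apply: eq_bigr => x _.
rewrite mulr_sumr; apply: eq_bigr => y _ /=; rewrite mulrACA -big_split.
by congr (_ * _); apply: eq_bigr => i _; rewrite ffunE exprD.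
Qed.

Lemma mondegX d f n : mondeg d f -> mondeg (d * n) (fun u => f u ^+ n).
Proof.
move=> Hf; elim: n => [|n IH]; first by rewrite muln0; exact: mondeg_cst.
rewrite mulnS; apply: mondeg_ext (mondegM Hf IH) => u; exact: exprS.
Qed.

Lemma mondeg_sum I (r : seq I) d (F : I -> W -> K) :
  (forall i, mondeg d (F i)) -> mondeg d (fun u => \sum_(i <- r) F i u).
Proof.
move=> HF; elim: r => [|i r IH].
  by apply: mondeg_ext (mondeg_cst d 0) => u; rewrite big_nil.
by apply: mondeg_ext (mondegD (HF i) IH) => u; rewrite big_cons.
Qed.

Lemma polyfun_mondeg f : polyfun f -> exists d, mondeg d f.
Proof.
move: f; apply: polyfun_ind => [f g fg [d dg]|c|i|f g [d df] [d' dg]|f g [d df] [d' dg]].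
- by exists d; exact: mondeg_ext dg.
- by exists 0%N; exact: mondeg_cst.
- exists 1%N; exists [:: (1, [ffun j => (j == i : nat)])] => [x j|u].
    by rewrite inE => /eqP-> /=; rewrite ffunE leq_b1.
  rewrite big_seq1 mul1r (bigD1 i) //= ffunE eqxx expr1 big1 ?mulr1 // => j ji.
  by rewrite ffunE (negPf ji) expr0.
- by exists (maxn d d'); apply: mondegD; [apply: mondegW df|apply: mondegW dg];
    rewrite ?leq_maxl ?leq_maxr.
- by exists (d + d')%N; exact: mondegM.
Qed.

(** Terms with equal exponents are collected, so that coefficient vectors are indexed by a finite
    type whose cardinal can be compared with a number of monomials. *)
Lemma mondeg_coef d f : mondeg d f -> exists a : {ffun 'I_D -> 'I_d.+1} -> K,
  forall u, f u = \sum_b a b * \prod_i xi i u ^+ b i.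
Proof.
move=> [l al fl]; exists (fun b : {ffun 'I_D -> 'I_d.+1} => \sum_(x <- l) x.1 * [forall i, x.2 i == b i :> nat]%:R).
move=> u; under eq_bigr do rewrite mulr_suml.
rewrite exchange_big fl /= [LHS]big_seq [RHS]big_seq; apply: eq_bigr => x xl.
set bx : {ffun 'I_D -> 'I_d.+1} := [ffun i => inord (x.2 i)].
rewrite (bigD1 bx) //=.
have E i : bx i = x.2 i :> nat by rewrite ffunE inordK // ltnS al.
have -> : [forall i, x.2 i == bx i :> nat] by apply/forallP => i; rewrite E.
rewrite mulr1.
rewrite [X in _ = _ + X]big1 ?addr0 => [|b bbx].
  by congr (_ * _); apply: eq_bigr => i _; rewrite E.
suff -> : [forall i, x.2 i == b i :> nat] = false by rewrite mulr0 mul0r.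
apply/negbTE; apply: contra bbx => /forallP H; apply/eqP/ffunP => i.
by apply/val_inj; rewrite /= E; apply/esym/eqP.
Qed.

End MonomialDegree.

(** * Independent functions on rationally parametrized sets *)

Section DimensionBound.
Variables (K : fieldType) (V W : vectType K) (delta : W -> K) (phi : W -> V).
Hypothesis pdelta : polyfun delta.

(** [phi] is a morphism on the principal open set where [delta] does not vanish; its values
    elsewhere are irrelevant. *)
Definition regular_on : Prop := forall f, polyfun f ->
  exists n A, polyfun A /\ forall u, delta u != 0 -> f (phi u) * delta u ^+ n = A u.

Lemma regular_on_coord n (A : 'I_(\dim {:V}) -> W -> K) : (forall i, polyfun (A i)) ->
  (forall i u, delta u != 0 -> coord (vbasis {:V}) i (phi u) * delta u ^+ n = A i u) ->
  regular_on.
Proof.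
move=> pA HA; apply: polyfun_ind => [f g fg [d [B [pB HB]]]|c|i|f g [d [B [pB HB]]] [d' [C [pC HC]]]
    |f g [d [B [pB HB]]] [d' [C [pC HC]]]].
- by exists d, B; split => // u du; rewrite fg HB.
- by exists 0%N, (fun=> c); split => [|u _]; [exact: polyfun_cst | rewrite mulr1].
- by exists n, (A i); split => // u du; exact: HA.
- exists (d + d')%N, (fun u => B u * delta u ^+ d' + C u * delta u ^+ d); split => [|u du].
    by apply: polyfunD; apply: polyfunM => //; exact: polyfunX.
  by rewrite -HB // -HC // exprD mulrDl mulrA -!mulrA [delta u ^+ d * _]mulrC.
- exists (d + d')%N, (fun u => B u * C u); split => [|u du]; first exact: polyfunM.
  by rewrite -HB // -HC // exprD mulrACA.
Qed.

Hypothesis Hreg : regular_on.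

(** The point is uniformity: [n] and [d] are chosen before [m] and [c], so the exponents grow only
    linearly in [m]. *)
Lemma comb_mondeg fs : polyfuns fs -> exists n d, forall m c, exists2 A,
  mondeg (d * m) A &
  forall u, delta u != 0 -> comb m fs c (phi u) * delta u ^+ (n * m) = A u.
Proof.
have [e de] := polyfun_mondeg pdelta.
elim: fs => [_|f fs IH /= [/Hreg[n0 [A0 [/polyfun_mondeg[d0 dA0] HA0]]] /IH[n [d H]]]].
  exists 0%N, 0%N => m c; exists (fun=> c [::]); first exact: mondeg_cst.
  by move=> u _; rewrite mulr1.
(* Over the common denominator, the three summands account for the powers of [A0], for the powers of
   [delta] that complete the denominator, and for the coefficients. *)
exists (n0 + n)%N, (d0 + e * n0 + d)%N => m c.
have /choice[A HA] : forall j : 'I_m, exists A, mondeg (d * m) A /\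
  forall u, delta u != 0 ->
    comb m fs (fun l => c (val j :: l)) (phi u) * delta u ^+ (n * m) = A u.
  by move=> j; have [A dA HA] := H m (fun l => c (val j :: l)); exists A.
exists (fun u => \sum_(j < m) A0 u ^+ j * delta u ^+ (n0 * (m - j)) * A j u) => [|u du].
  apply: mondeg_sum => j; rewrite mulnDl; apply: mondegM; last by have [] := HA j.
  rewrite mulnDl; apply: mondegM.
    by apply: mondegW (mondegX j dA0); rewrite leq_mul2l ltnW ?orbT.
  by apply: mondegW (mondegX _ de); rewrite mulnA leq_mul2l leq_subr orbT.
rewrite mulr_suml; apply: eq_bigr => j _; have [_ HAj] := HA j.
rewrite -HA0 // -HAj // exprMn -exprM mulnDl exprD.
have -> : delta u ^+ (n0 * m) = delta u ^+ (n0 * j) * delta u ^+ (n0 * (m - j)).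
  by rewrite -exprD -mulnDr subnKC // ltnW.
by ring.
Qed.

Lemma algindep_size fs : polyfuns fs -> algindep [set phi u | u in [set u | delta u != 0]] fs ->
  (size fs <= \dim {:W})%N.
Proof.
move=> /comb_mondeg[n [d H]] ind; pose D := \dim {:W}.
have count m : (m ^ size fs <= (d * m).+1 ^ D)%N.
  pose T1 : finType := (size fs).-tuple 'I_m; pose T2 : finType := {ffun 'I_D -> 'I_(d * m).+1}.
  have <- : #|{: T1}| = (m ^ size fs)%N by rewrite card_tuple card_ord.
  have <- : #|{: T2}| = ((d * m).+1 ^ D)%N by rewrite card_ffun !card_ord.
  pose c (t : T1) l : K := (l == map val t)%:R.
  have /choice[a Ha] : forall t, exists a : T2 -> K, forall u, delta u != 0 ->
      comb m fs (c t) (phi u) * delta u ^+ (n * m) =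
      \sum_b a b * \prod_i coord (vbasis {:W}) i u ^+ b i.
    move=> t; have [A /mondeg_coef[a Ha] HA] := H m (c t).
    by exists a => u du; rewrite HA.
  pose M := \matrix_(i < #|{: T1}|, j < #|{: T2}|) a (enum_val i) (enum_val j).
  (* The rows are the coefficient vectors of the pulled-back monomials in [fs]; a linear relation
     between rows is an algebraic relation among [fs]. *)
  suff : row_free M by rewrite -row_leq_rank => /leq_trans; apply; exact: rank_leq_col.
  rewrite -kermx_eq0; apply/eqP/row_matrixP => k; rewrite row0.
  have: row k (kermx M) *m M = 0 by apply/sub_kermxP; exact: row_sub.
  move: (row k (kermx M)) => v vM.
  pose cc l := \sum_(t : T1) v 0 (enum_rank t) * c t l.
  have cc0 : forall l, size l = size fs -> all (fun j => (j < m)%N) l -> cc l = 0.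
    apply: ind => _ [u du <-]; rewrite /cc comb_sum.
    apply/eqP; rewrite -(mulIr_eq0 _ (mulIf (expf_neq0 (n * m) du))) mulr_suml.
    under eq_bigr => t _ do rewrite -mulrA Ha // mulr_sumr.
    rewrite exchange_big big1 //= => b _.
    under eq_bigr => t _ do rewrite mulrA.
    rewrite -mulr_suml; have := congr1 (fun X : 'rV_ _ => X 0 (enum_rank b)) vM.
    rewrite !mxE (reindex_onto enum_rank enum_val) /=; last by move=> i _; exact: enum_valK.
    under eq_bigl do rewrite enum_rankK eqxx.
    under eq_bigr do rewrite mxE !enum_rankK.
    by move=> ->; rewrite mul0r.
  apply/rowP => i; rewrite [RHS]mxE; have <- : cc (map val (enum_val i : T1)) = 0.
    by apply: cc0; [rewrite size_map size_tuple | apply/allP => _ /mapP[j _ ->]; exact: ltn_ord].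
  rewrite /cc (bigD1 (enum_val i)) //= enum_valK /c eqxx mulr1 big1 ?addr0 // => t ti.
  case: eqP => [/(inj_map val_inj) /val_inj E|_]; last by rewrite mulr0.
  by rewrite E eqxx in ti.
(* With too many functions, m^(D+1) <= (dm+1)^D <= (d+1)^D m^D, which fails once m exceeds
   (d+1)^D. *)
rewrite leqNgt; apply/negP => Dfs; set m := (d.+1 ^ D).+1.
have := leq_trans (leq_pexp2l (ltn0Sn _ : 0 < m)%N Dfs) (count m).
have dm : ((d * m).+1 <= d.+1 * m)%N by rewrite mulSn -addn1 addnC leq_add2r.
have {}dm : ((d * m).+1 ^ D <= (d.+1 * m) ^ D)%N by case: (D) => // D'; rewrite leq_exp2r.
move=> /leq_trans /(_ dm).
by rewrite expnS expnMn leq_pmul2r ?expn_gt0 // ltnn.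
Qed.

Hypothesis Kinf : infinite_field K.

(** Equations of two closed sets that both fail to contain the image pull back to nonzero
    polynomials on [W], which have a common non-zero. *)
Lemma irreducible_image : (exists u, delta u != 0) ->
  irreducible [set phi u | u in [set u | delta u != 0]].
Proof.
move=> [u0 du0]; split; first by exists (phi u0), u0.
move=> F G [S ->] [T ->] H; apply: contrapT => /not_orP[nF nG].
have [u du [P SP Pu]] : exists2 u, delta u != 0 & exists2 P, S P & poly_eval P (phi u) != 0.
  apply: contrapT => N; apply: nF => _ [u du <-] P SP; apply/eqP/negPn/negP => Pu.
  by apply: N; exists u => //; exists P.
have [w dw [Q TQ Qw]] : exists2 u, delta u != 0 & exists2 P, T P & poly_eval P (phi u) != 0.
  apply: contrapT => N; apply: nG => _ [w dw <-] Q TQ; apply/eqP/negPn/negP => Qw.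
  by apply: N; exists w => //; exists Q.
have [n [A [pA HA]]] := Hreg (ex_intro _ P (fun=> erefl)).
have [n' [B [pB HB]]] := Hreg (ex_intro _ Q (fun=> erefl)).
have Au : A u * delta u != 0 by rewrite -HA // !mulf_neq0 ?expf_neq0.
have Bw : B w * delta w != 0 by rewrite -HB // !mulf_neq0 ?expf_neq0.
have [x] := polyfun_domain Kinf (polyfunM pA pdelta) (polyfunM pB pdelta) Au Bw.
rewrite !mulf_eq0 !negb_or => /andP[/andP[Ax dx] /andP[Bx _]].
have [|/(_ P SP) E|/(_ Q TQ) E] := H (phi x); first by exists x.
  by move: Ax; rewrite -HA // E mul0r eqxx.
by move: Bx; rewrite -HB // E mul0r eqxx.
Qed.

End DimensionBound.

(** * The dimension of a conjugation orbit *)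

Section ConjugationOrbit.
Variables (K : fieldType) (Kinf : infinite_field K) (V : vectType K) (n : nat).
Variables (iota : 'Hom(V, 'M[K]_n)) (A : {vspace 'M[K]_n}).
Hypothesis iota_inj : lker iota == 0%VS.
Hypothesis A1 : 1%:M \in A.
Hypothesis AM : forall a b, a \in A -> b \in A -> a *m b \in A.
Hypothesis AV : forall a, a \in A -> invmx a \in A.
Hypothesis AL : forall a v, a \in A -> a *m iota v \in limg iota.
Hypothesis AR : forall a v, a \in A -> iota v *m a \in limg iota.
Variable x : V.

(** Conjugacy is written without the inverse of g, hence linearly in g. *)
Definition conj_orbit : set V :=
  [set v | exists g, [/\ g \in A, g \in unitmx & g *m iota x = iota v *m g]].

Definition centralizer : {vspace 'M[K]_n} :=
  (A :&: lker (linfun (mulmxr (iota x) \- mulmx (iota x))))%VS.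

Notation Z := centralizer.

Lemma mem_centralizer g : (g \in Z) = (g \in A) && (g *m iota x == iota x *m g).
Proof. by rewrite memv_cap memv_ker lfunE /= subr_eq0. Qed.

Section Parametrization.
Variables (W : vectType K) (kap : W -> 'M[K]_n).
Hypothesis pkap : mxpolyfun kap.
Hypothesis kapA : forall u, kap u \in A.

Definition conj_map (u : W) : V := (iota^-1)%VF (kap u *m iota x *m invmx (kap u)).
Notation delta := (fun u => \det (kap u)).

(** Stability of the image of [iota] under [A] on both sides puts the conjugate in that image, where
    [iota^-1] is a genuine inverse. *)
Lemma conj_mapP u : delta u != 0 -> iota (conj_map u) *m kap u = kap u *m iota x.
Proof.
rewrite -unitfE => du; rewrite limg_lfunVK ?mulmxKV //.
have := AR ((iota^-1)%VF (kap u *m iota x)) (AV (kapA u)).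
by rewrite limg_lfunVK // AL.
Qed.

Lemma conj_map_uniq u v :
  delta u != 0 -> iota v *m kap u = kap u *m iota x -> v = conj_map u.
Proof.
move=> du E; apply: (can_inj (lker0_lfunK iota_inj)).
by move: du; rewrite -unitfE => du; apply: (can_inj (mulmxK du)); rewrite E conj_mapP // -unitfE.
Qed.

Lemma polyfun_conj_det : polyfun delta.
Proof. exact: polyfun_det. Qed.

(** The inverse is the adjugate divided by the determinant, so a single factor [delta] clears the
    denominators of the coordinates. *)
Lemma conj_map_regular : regular_on delta conj_map.
Proof.
apply: (@regular_on_coord _ _ _ _ _ polyfun_conj_det 1 (fun i u =>
  coord (vbasis {:V}) i ((iota^-1)%VF (kap u *m iota x *m \adj (kap u))))) => [i|i u du].
  have pM : mxpolyfun (fun u => kap u *m iota x *m \adj (kap u)).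
    by do 2?apply: mxpolyfun_mul; [|exact: mxpolyfun_cst|exact: mxpolyfun_adj].
  pose f M := coord (vbasis {:V}) i ((iota^-1)%VF M).
  apply: (polyfun_ext (g := fun u => \sum_k \sum_l
     (kap u *m iota x *m \adj (kap u)) k l * f (delta_mx k l))) => [u|].
    rewrite -/(f _) [in LHS](matrix_sum_delta (kap u *m iota x *m \adj (kap u))) /f.
    rewrite !linear_sum; apply: eq_bigr => k _; rewrite !linear_sum.
    by apply: eq_bigr => l _; rewrite !linearZ.
  apply: polyfun_sum => k; apply: polyfun_sum => l; apply: polyfunM => //.
  exact: polyfun_cst.
have -> : conj_map u = (\det (kap u))^-1 *: (iota^-1)%VF (kap u *m iota x *m \adj (kap u)).
  by rewrite /conj_map /invmx unitmxE unitfE du -scalemxAr linearZ.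
by rewrite linearZ /= expr1 mulrC mulrA divff // mul1r.
Qed.

Lemma conj_map_orbit : [set conj_map u | u in [set u | delta u != 0]] `<=` conj_orbit.
Proof.
move=> _ [u du <-]; exists (kap u); split => //; first by rewrite unitmxE unitfE.
by rewrite conj_mapP.
Qed.

End Parametrization.

Lemma subvs_poly (U : {vspace 'M[K]_n}) (M : 'M[K]_n) :
  mxpolyfun (fun u : subvs_of U => M + vsval u).
Proof.
move=> i j; apply: (polyfun_ext (g := fun u : subvs_of U => M i j + vsval u i j)) => [u|]; first by rewrite mxE.
apply: polyfunD; first exact: polyfun_cst.
by apply: polyfun_lin => a u v; rewrite linearP !mxE.
Qed.

(** The shape [0 + vsval u] lets [subvs_poly] serve both this parametrization and the slice, where 0
    is replaced by 1. *)
Lemma conj_orbitE : conj_orbit =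
  [set conj_map (fun u : subvs_of A => 0 + vsval u) u | u in [set u | \det (0 + vsval u) != 0]].
Proof.
have kA (u : subvs_of A) : 0 + vsval u \in A by rewrite add0r subvsP.
apply/seteqP; split; last exact: (conj_map_orbit kA).
move=> v [g [gA gu E]]; have Eg : vsval (vsproj A g) = g by rewrite vsprojK.
exists (vsproj A g); first by rewrite /= add0r Eg -unitfE.
apply/esym/conj_map_uniq => //=; rewrite add0r Eg // -unitfE; exact: gu.
Qed.

Lemma irreducible_conj_orbit : irreducible conj_orbit.
Proof.
have kA (u : subvs_of A) : 0 + vsval u \in A by rewrite add0r subvsP.
rewrite conj_orbitE; apply: irreducible_image => //.
- by apply: polyfun_conj_det; exact: subvs_poly.
- by apply: conj_map_regular => //; exact: subvs_poly.
by exists (vsproj A 1%:M); rewrite add0r vsprojK // det1 oner_eq0.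
Qed.

Let C : {vspace 'M[K]_n} := (A :\: Z)%VS.

Lemma dim_centralizer_compl : \dim C = (\dim A - \dim Z)%N.
Proof.
have := dimv_cap_compl A Z; have -> : (A :&: Z)%VS = Z.
  by apply/capv_idPr; exact: capvSl.
by move=> <-; rewrite addKn.
Qed.

Let CA : (C <= A)%VS. Proof. exact: diffvSl. Qed.
Let ZA : (Z <= A)%VS. Proof. exact: capvSl. Qed.
Let ZC : (Z :&: C)%VS = 0%VS. Proof. by rewrite capvC capv_diff. Qed.
Let ZCA : (Z + C)%VS = A.
Proof.
have := addv_diff_cap A Z; have -> : (A :&: Z)%VS = Z by apply/capv_idPr.
by rewrite addvC.
Qed.

Let kap2 (u : subvs_of C) : 'M[K]_n := 1%:M + vsval u.
Let kap2A u : kap2 u \in A.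
Proof. by rewrite memvD // (subvP CA) // subvsP. Qed.

(* For generic g there is z in the centralizer of x with gz in 1 + C, found by
   solving a linear system whose determinant is nonzero at g = 1. *)
Lemma conj_orbit_sub_slice : conj_orbit `<=`
  zariski_closure [set conj_map kap2 u | u in [set u | \det (kap2 u) != 0]].
Proof.
rewrite zariski_closureE conj_orbitE => _ [u0 du0 <-] f pf f0; apply/eqP/negPn/negP => fu0.
pose kap (u : subvs_of A) : 'M[K]_n := 0 + vsval u.
have kapE u : kap u = vsval u by rewrite /kap add0r.
have kapA u : kap u \in A by rewrite kapE subvsP.
have pk : mxpolyfun kap by exact: subvs_poly.
have [N [B [pB HB]]] := conj_map_regular pk pf.
pose r := \dim Z; pose zb : r.-tuple _ := vbasis Z.
have zbZ i : zb`_i \in Z by have [s|s] := ltnP i (size zb);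
  [apply: vbasis_mem; exact: mem_nth | rewrite nth_default ?mem0v].
pose prj := daddv_pi Z C.
(* With g = [kap u], this is the matrix of z |-> prj (g z) on the centralizer. Cramer's rule with
   the denominator cleared gives z' such that prj (g z') = det (T u) 1. *)
pose T u := \matrix_(i < r, j < r) coord zb i (prj (kap u *m zb`_j)).
pose one := \col_(i < r) coord zb i (1%:M : 'M[K]_n).
pose sol u := \adj (T u) *m one.
pose z' u := \sum_j sol u j 0 *: zb`_j.
have Z1 : 1%:M \in Z by rewrite mem_centralizer A1 mul1mx mulmx1 /=.
have pT : mxpolyfun T.
  apply: mxpolyfun_lin => a u v; apply/matrixP => i j; rewrite !mxE !kapE.
  by rewrite linearP /= mulmxDl -scalemxAl !linearP.
have psol : mxpolyfun sol.
  by apply: mxpolyfun_mul; [exact: mxpolyfun_adj | exact: mxpolyfun_cst].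
have pz' : mxpolyfun z'.
  move=> i j; apply: (polyfun_ext (g := fun u => \sum_k sol u k 0 * zb`_k i j)) => [u|].
    by rewrite summxE; apply: eq_bigr => k _; rewrite mxE.
  by apply: polyfun_sum => k; apply: polyfunM => //; exact: polyfun_cst.
pose u1 := vsproj A 1%:M.
have ku1 : kap u1 = 1%:M by rewrite kapE vsprojK.
have T1 : T u1 = 1%:M.
  apply/matrixP => i j; rewrite !mxE ku1 mul1mx daddv_pi_id // coord_free 1?eq_sym //.
  exact: (basis_free (vbasisP Z)).
have z1 : z' u1 = 1%:M.
  rewrite [RHS](coord_vbasis Z1) /z'; apply: eq_bigr => j _.
  by rewrite /sol T1 adj1 mul1mx mxE.
have p1 : polyfun (fun u => B u * \det (kap u)) by apply: polyfunM => //; exact: polyfun_det.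
have p2 : polyfun (fun u => \det (T u) * \det (z' u)) by apply: polyfunM; exact: polyfun_det.
(* A point satisfying all open conditions at once: f is nonzero at [u0], while [T] and [z'] are the
   identity at [u1], where g = 1. *)
have [||u] := polyfun_domain Kinf p1 p2 (u := u0) (w := u1).
- by rewrite -HB // !mulf_neq0 ?expf_neq0.
- by rewrite T1 z1 !det1 mulr1 oner_neq0.
rewrite !mulf_eq0 !negb_or -andbA => /and4P[Bu du Tu zu].
have z'Z : z' u \in Z by apply: memv_suml => j _; exact: memvZ.
have kzA : kap u *m z' u \in A by apply: AM => //; exact: (subvP ZA).
have pkz : prj (kap u *m z' u) = \det (T u) *: 1%:M.
  have pZ : prj (kap u *m z' u) \in Z by exact: memv_pi.
  rewrite (coord_vbasis pZ) [in RHS](coord_vbasis Z1) scaler_sumr; apply: eq_bigr => i _.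
  rewrite scalerA; congr (_ *: _).
  have : (T u *m sol u) i 0 = \det (T u) * one i 0.
    by rewrite /sol mulmxA mul_mx_adj mul_scalar_mx mxE.
  rewrite [one _ _]mxE => <-; rewrite mxE /z' mulmx_sumr !linear_sum.
  by apply: eq_bigr => j _; rewrite -scalemxAr !linearZ /= [T u _ _]mxE mulrC.
pose c := (\det (T u))^-1 *: (kap u *m z' u) - 1%:M.
have cC : c \in C.
  have := daddv_pi_add ZC (w := kap u *m z' u); rewrite ZCA => /(_ kzA).
  rewrite -/prj pkz => E; rewrite /c -E scalerDr scalerA mulVf // scale1r addrAC subrr add0r.
  by apply: memvZ; exact: memv_pi.
have k2 : kap2 (vsproj C c) = (\det (T u))^-1 *: (kap u *m z' u).
  by rewrite /kap2 vsprojK // addrC subrK.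
have dk2 : \det (kap2 (vsproj C c)) != 0.
  by rewrite k2 detZ det_mulmx !mulf_neq0 ?expf_neq0 ?invr_neq0.
(* As z' commutes with x, the element 1 + c = g z' / det (T u) conjugates x to the same point as g,
   a point of the slice, where f vanishes. *)
suff E : conj_map kap u = conj_map kap2 (vsproj C c).
  have := f0 (conj_map kap u); rewrite {1}E => /(_ _) f0'.
  move: Bu; rewrite -HB // f0' ?mul0r ?eqxx //.
  by exists (vsproj C c).
apply: (conj_map_uniq kap2A dk2); rewrite k2 -scalemxAr -scalemxAl; congr (_ *: _).
rewrite mulmxA conj_mapP // -!mulmxA; congr (_ *m _).
by move: z'Z; rewrite mem_centralizer => /andP[_ /eqP ->].
Qed.

(** A relation valid on the slice extends to the orbit, which lies in its closure; hence
    independence on the orbit passes to the slice, parametrized by C. *)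
Lemma conj_orbit_algindep_size fs : polyfuns fs -> algindep conj_orbit fs ->
  (size fs <= \dim A - \dim Z)%N.
Proof.
move=> pfs ifs; rewrite -dim_centralizer_compl.
have -> : \dim C = \dim {: subvs_of C} by rewrite dimvf.
have pk : mxpolyfun kap2 by exact: subvs_poly.
apply: (algindep_size (polyfun_conj_det pk) (conj_map_regular pk)) => //.
move=> m c H; apply: ifs => v /conj_orbit_sub_slice; rewrite zariski_closureE.
by apply => //; exact: polyfun_comb.
Qed.

Let D := \dim C.
Let cb : D.-tuple 'M[K]_n := vbasis C.

Let cbC (i : 'I_D) : cb`_i \in C.
Proof. by apply: vbasis_mem; rewrite mem_nth // size_tuple. Qed.

(** The kernel of c |-> c x - x c on [A] is [Z], which meets C only in 0. *)
Let free_bracket : free (map_tuple (fun c => c *m iota x - iota x *m c) cb).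
Proof.
apply/freeP => k; under eq_bigr => i _ do rewrite (nth_map 0) ?size_tuple //.
move=> E; have zC : \sum_i k i *: cb`_i \in C by apply: memv_suml => i _; apply: memvZ.
have zZ : \sum_i k i *: cb`_i \in Z.
  rewrite mem_centralizer (subvP CA) //= -subr_eq0 mulmx_suml mulmx_sumr -sumrB.
  rewrite -[X in _ == X]E; apply/eqP/eq_bigr => i _.
  by rewrite scalerBr scalemxAl scalemxAr.
have : \sum_i k i *: cb`_i \in (Z :&: C)%VS by rewrite memv_cap zZ.
by rewrite ZC memv0 => /eqP; move/freeP: (basis_free (vbasisP C)); apply.
Qed.

Let rho (i : 'I_D) := coord (map_tuple (fun c => c *m iota x - iota x *m c) cb) i.

(** Only the first i basis vectors of C are used, so the images increase with i. All coordinates are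
    kept in [u] to have one parameter space. *)
Let kap3 (i : nat) (u : 'rV[K]_D) : 'M[K]_n :=
  1%:M + \sum_(j < D | (j < i)%N) u 0 j *: cb`_j.

Let kap3A i u : kap3 i u \in A.
Proof.
apply: memvD => //; apply: memv_suml => j _; apply: memvZ.
exact: (subvP CA).
Qed.

Let kap3_poly i : mxpolyfun (kap3 i).
Proof.
move=> k l; apply: (polyfun_ext (g := fun u : 'rV[K]_D =>
    1%:M k l + \sum_(j < D) u 0 j * ((j < i)%N%:R * cb`_j k l))) => [u|].
  rewrite mxE summxE big_mkcond; congr (_ + _); apply: eq_bigr => j _.
  by case: ifP => _; rewrite ?mxE ?mul1r // mul0r mulr0.
apply: polyfunD; first exact: polyfun_cst.
apply: polyfun_sum => j; apply: polyfunM; last exact: polyfun_cst.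
by apply: polyfun_lin => a u v; rewrite !mxE.
Qed.

Let slice i : set V :=
  [set conj_map (kap3 i) u | u in [set u | \det (kap3 i u) != 0]].

(** Matrix of c |-> c x - v c from the basis of C to the forms [rho] dual to the brackets with x. It
    is the identity at v = x, hence invertible generically. *)
Let S (v : V) : 'M[K]_D := \matrix_(i, j) rho i (cb`_j *m iota x - iota v *m cb`_j).

Let S_poly : mxpolyfun S.
Proof.
move=> i j; apply: (polyfun_ext (g := fun v =>
   rho i (cb`_j *m iota x) + - rho i (iota v *m cb`_j))) => [v|]; first by rewrite mxE /rho linearB.
apply: polyfunD; first exact: polyfun_cst.
apply: polyfun_lin => a u v; rewrite /rho linearP mulmxDl -scalemxAl linearP /=.
by rewrite opprD mulrN.
Qed.

Let Sx : S x = 1%:M.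
Proof.
apply/matrixP => i j; rewrite !mxE.
rewrite -(nth_map 0 0 (fun c => c *m iota x - iota x *m c)) ?size_tuple //.
by rewrite /rho (coord_free _ _ free_bracket) eq_sym.
Qed.

(* The numerators of the coordinates of c as rational functions of
   v = (1 + c) x (1 + c)^-1, obtained from c x - v c = v - x. *)
Let num v := \adj (S v) *m \col_i rho i (iota v - iota x).

Let num_poly : mxpolyfun num.
Proof.
apply: mxpolyfun_mul; first exact: mxpolyfun_adj.
move=> i j; apply: (polyfun_ext (g := fun v =>
   rho i (iota v) + - rho i (iota x))) => [v|]; first by rewrite mxE /rho linearB.
apply: polyfunD; last exact: polyfun_cst.
by apply: polyfun_lin => a u v; rewrite /rho !linearP.
Qed.

(** The numerators of index at least i vanish on the i-th slice; this separates consecutive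
    slices. *)
Let numE i u (j : 'I_D) : \det (kap3 i u) != 0 ->
  num (conj_map (kap3 i) u) j 0 = \det (S (conj_map (kap3 i) u)) * ((j < i)%N%:R * u 0 j).
Proof.
move=> du; set v := conj_map _ _.
have E : iota v - iota x = \sum_(k < D) ((k < i)%N%:R * u 0 k) *: (cb`_k *m iota x - iota v *m cb`_k).
  have := conj_mapP (kap3A i) du; rewrite -/v /kap3 mulmxDr mulmxDl mul1mx mulmx1.
  move=> /eqP; rewrite -subr_eq0 opprD addrACA addr_eq0 => /eqP ->.
  rewrite opprB mulmx_suml mulmx_sumr -sumrB big_mkcond; apply: eq_bigr => k _.
  case: ifP => _; last by rewrite mul0r scale0r.
  by rewrite mul1r scalerBr scalemxAl scalemxAr.
have -> : num v = \adj (S v) *m (S v *m \col_k ((k < i)%N%:R * u 0 k)).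
  congr (_ *m _); apply/colP => k; rewrite !mxE E /rho linear_sum; apply: eq_bigr => l _.
  by rewrite linearZ /= !mxE mulrC.
by rewrite mulmxA mul_adj_mx mul_scalar_mx !mxE.
Qed.

(** The members are the traces on the orbit of the closures of the slices. The numerator of index i
    vanishes on the i-th one but not on the next. *)
Lemma conj_orbit_chain :
  exists s, irreducible_chain conj_orbit (\dim A - \dim Z) s.
Proof.
rewrite -dim_centralizer_compl.
exists (fun i => conj_orbit `&` zariski_closure (slice i)).
have k0 i : kap3 i 0 = 1%:M.
  by rewrite /kap3 big1 ?addr0 // => j _; rewrite mxE scale0r.
have slice_orb i : slice i `<=` conj_orbit by apply: conj_map_orbit; exact: kap3A.
have slice_irr i : irreducible (slice i).
  apply: (irreducible_image (polyfun_conj_det (kap3_poly i)) (conj_map_regular (kap3_poly i)) Kinf).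
  by exists 0; rewrite k0 det1 oner_neq0.
split=> [i _|i iD].
  split; first by exists (zariski_closure (slice i)) => //; exact: zariski_closed_closure.
  apply: irreducible_between (slice_irr i) _ _; last exact: subIsetr.
  by move=> v sv; exact: (conj (slice_orb _ _ sv) (sub_zariski_closure sv)).
split=> [v [ov]|].
  suff /zariski_closureS H : slice i `<=` slice i.+1 by move=> /H; split.
  move=> _ [u du <-]; pose u' := \row_j ((j < i)%N%:R * u 0 j).
  have Ek : kap3 i.+1 u' = kap3 i u.
    congr (_ + _); rewrite big_mkcond [RHS]big_mkcond; apply: eq_bigr => j _.
    rewrite mxE ltnS leq_eqVlt; have [ji|_] := boolP (j < i)%N; first by rewrite orbT mul1r.
    by rewrite orbF mul0r scale0r if_same.
  by exists u' => /=; rewrite ?Ek // /conj_map Ek.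
(* The separating point is sought on the i-th coordinate axis. At its origin [p] and [q] take the
   value 1, so for some nonzero t both det S and the determinant of [kap3] are nonzero. *)
pose io := Ordinal iD; pose e : 'rV[K]_D := delta_mx 0 io.
have [N [B [pB HB]]] := conj_map_regular (kap3_poly i.+1) (polyfun_det S_poly).
have [p Hp] := polyfun_line 0 e pB.
have [q Hq] := polyfun_line 0 e (polyfun_conj_det (kap3_poly i.+1)).
have q0 : q.[0] = 1 by rewrite -Hq scale0r addr0 k0 det1.
have p0 : p.[0] = 1.
  have d0 : \det (kap3 i.+1 0) != 0 by rewrite k0 det1 oner_neq0.
  rewrite -Hp scale0r addr0 -HB // k0 det1 expr1n mulr1.
  have <- : x = conj_map (kap3 i.+1) 0.
    by apply: (conj_map_uniq (kap3A i.+1)) => //; rewrite k0 mul1mx mulmx1.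
  by rewrite Sx det1.
have [|t] := @Kinf ('X * p * q).
  rewrite !mulf_neq0 ?polyX_eq0 //.
    by apply/eqP => E; move/eqP: p0; rewrite E horner0 eq_sym oner_eq0.
  by apply/eqP => E; move/eqP: q0; rewrite E horner0 eq_sym oner_eq0.
rewrite !hornerM hornerX !mulf_eq0 !negb_or -andbA => /and3P[t0].
rewrite -Hp -Hq !add0r => pt qt.
have st : slice i.+1 (conj_map (kap3 i.+1) (t *: e)) by exists (t *: e).
move=> /(_ _ (conj (slice_orb _ _ st) (@sub_zariski_closure _ _ _ _ st)))[_].
rewrite zariski_closureE => /(_ (fun v => num v io 0) (num_poly io 0)).
have -> : num (conj_map (kap3 i.+1) (t *: e)) io 0 =
          \det (S (conj_map (kap3 i.+1) (t *: e))) * t.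
  by rewrite numE // ltnSn mul1r !mxE !eqxx mulr1.
move=> H; have /eqP : \det (S (conj_map (kap3 i.+1) (t *: e))) * t = 0.
  by apply: H => _ [u du <-]; rewrite numE // ltnn mul0r mulr0.
rewrite mulf_eq0 (negPf t0) orbF => /eqP E.
by move: pt; rewrite -HB // E mul0r eqxx.
Qed.

Lemma conj_orbit_is_dim : is_dim conj_orbit (\dim A - \dim Z).
Proof.
split; first exact: conj_orbit_chain.
move=> e s cs; have [fs [sfs pfs ifs]] := chain_algindep cs.
rewrite -sfs; apply: conj_orbit_algindep_size => //.
exact: algindepS (chain_sub cs) ifs.
Qed.

End ConjugationOrbit.

Lemma zariski_dimE (K : fieldType) (V : vectType K) (X : set V) d :
  is_dim X d -> zariski_dim X = d.
Proof.
move=> Hd; rewrite /zariski_dim; case: xgetP => [e _ He|/(_ d) //].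
apply/eqP; rewrite eqn_leq; case: Hd He => [[s Hs] Hd] [[s' Hs'] He].
by rewrite (Hd _ _ Hs') (He _ _ Hs).
Qed.

(** * String decompositions of homogeneous nilpotent matrices *)

Lemma span_mx_eq (K : fieldType) m n (X : seq 'cV[K]_n) (M M' : 'M[K]_(m, n)) :
  (fullv <= <<X>>)%VS -> (forall v, v \in X -> M *m v = M' *m v) -> M = M'.
Proof.
move=> fX H; apply/matrixP => i j.
have : (<<X>> <= lker (linfun (mulmx (M - M'))))%VS.
  by apply/span_subvP => v /H E; rewrite memv_ker lfunE /= mulmxBl E subrr.
move=> /(subv_trans fX) /subvP /(_ (delta_mx j 0) (memvf _)).
rewrite memv_ker lfunE /= mulmxBl subr_eq0 => /eqP /colP /(_ i).
have D (A : 'M[K]_(m, n)) : (A *m (delta_mx j 0 : 'cV_n)) i 0 = A i j.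
  by rewrite -colE mxE.
by rewrite !D.
Qed.

(** With row vectors as dual basis, a linear map prescribed on the basis is a sum of rank one
    matrices. *)
Lemma dual_basis (K : fieldType) n (I : eqType) (P : seq I) (b : I -> 'cV[K]_n) :
  basis_of fullv (map b P) ->
  exists xi : I -> 'rV[K]_n,
    (forall i j, i \in P -> j \in P -> xi i *m b j = (i == j)%:R%:M) /\
    1%:M = \sum_(i <- P) b i *m xi i.
Proof.
move=> bP; pose X := in_tuple (map b P).
have fX : free X := basis_free bP.
have uP : uniq P := map_uniq (free_uniq fX).
have ltX i : i \in P -> (index i P < size (map b P))%N by rewrite size_map index_mem.
pose xi i : 'rV[K]_n := if insub (index i P) is Some j
  then \row_k coord X j (delta_mx k 0 : 'cV_n) else 0.
have xiE i v (iP : i \in P) : xi i *m v = (coord X (Ordinal (ltX i iP)) v)%:M.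
  rewrite /xi; case: insubP => [j _ Ej|]; last by rewrite ltX.
  have {Ej}-> : j = Ordinal (ltX i iP) by exact: val_inj.
  apply/matrixP => r c; rewrite !ord1 !mxE eqxx mulr1n.
  have {2}-> : v = \sum_k v k 0 *: delta_mx k 0.
    by apply/colP => k; rewrite summxE (bigD1 k) //= big1 ?addr0 => [|l lk];
       rewrite !mxE ?eqxx ?mulr1 // eq_sym (negPf lk) mulr0.
  by rewrite linear_sum; apply: eq_bigr => k _; rewrite linearZ mxE mulrC.
have Xnth j : j \in P -> X`_(index j P) = b j.
  by move=> jP; rewrite (nth_map j) ?index_mem // nth_index.
have H i j : i \in P -> j \in P -> xi i *m b j = (i == j)%:R%:M.
  move=> iP jP; rewrite (xiE i _ iP) -(Xnth j jP).
  rewrite (coord_free (Ordinal (ltX j jP)) _ fX); congr (_%:R%:M).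
  rewrite eq_sym -val_eqE /=; congr nat_of_bool.
  by apply/eqP/eqP => [E|-> //]; rewrite -(nth_index i iP) E nth_index.
exists xi; split => //.
apply: (span_mx_eq (X := map b P)) => [|_ /mapP[j jP ->]].
  by rewrite (span_basis bP).
rewrite mul1mx mulmx_suml (bigD1_seq j) //= -mulmxA H // eqxx mulmx1.
rewrite big_seq_cond big1 ?addr0 // => i /andP[iP ij].
by rewrite -mulmxA H // (negPf ij) -scalemx1 scale0r mulmx0.
Qed.

Lemma dual_basis_sum (K : fieldType) m n (I : eqType) (P : seq I) (b : I -> 'cV[K]_n)
    (xi : I -> 'rV[K]_n) (G : I -> 'M[K]_(m, 1)) j : uniq P ->
  (forall i j, i \in P -> j \in P -> xi i *m b j = (i == j)%:R%:M) ->
  j \in P -> (\sum_(i <- P) G i *m xi i) *m b j = G j.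
Proof.
move=> uP H jP; rewrite mulmx_suml (bigD1_seq j) //= -mulmxA H // eqxx mulmx1.
rewrite big_seq_cond big1 ?addr0 // => i /andP[iP ij].
by rewrite -mulmxA H // (negPf ij) -scalemx1 scale0r mulmx0.
Qed.

Lemma perm_map_lift (S T : eqType) (f : T -> S) (s : seq S) (t : seq T) :
  perm_eq s (map f t) -> exists2 t', perm_eq t' t & s = map f t'.
Proof.
case: t => [|x0 t] /=; first by move=> /perm_nilP ->; exists [::].
rewrite -[_ :: _]/(map f (x0 :: t)); move: (x0 :: t) => {}t.
move=> /(perm_iotaP (f x0)) [Is]; rewrite size_map => pI ->.
exists [seq nth x0 t i | i <- Is].
  by rewrite -[X in perm_eq _ X](mkseq_nth x0) /mkseq; exact: perm_map.
rewrite -map_comp; apply/eq_in_map => i; rewrite (perm_mem pI) mem_iota /= => it.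
by rewrite (nth_map x0).
Qed.

Lemma free_extension (K : fieldType) (vT : vectType K) (I : eqType) (f : I -> vT)
    (X : seq vT) (L : seq I) : free X ->
  exists Y : seq I, [/\ {subset Y <= L}, free (map f Y ++ X) &
    forall i, i \in L -> f i \in <<map f Y ++ X>>%VS].
Proof.
move=> fX; elim: L => [|i L [Y [YL fY LY]]]; first by exists [::].
have [iY|iY] := boolP (f i \in <<map f Y ++ X>>%VS).
  exists Y; split=> // j; first by move=> /YL; rewrite inE orbC => ->.
  by rewrite inE => /orP[/eqP->|/LY].
exists (i :: Y); split=> [j||j].
- by rewrite !inE => /orP[->|/YL ->] //; rewrite orbT.
- by rewrite /= free_cons iY.
- rewrite inE /= span_cons => /orP[/eqP->|/LY H]; first by rewrite (subvP (addvSl _ _)) ?memv_line.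
  exact: (subvP (addvSr _ _)).
Qed.

(* A string is recorded by its first vector together with its degree and the
   length; the degrees along a string are iterates of [nx]. *)
Definition string (K : fieldType) (n : nat) : Type := ('cV[K]_n * (bool * nat))%type.
HB.instance Definition _ K n := Choice.on (string K n).

Section Strings.
Variables (K : fieldType) (n : nat) (E : bool -> 'M[K]_n).
Hypothesis EE : forall b c, E b *m E c = if b == c then E b else 0.
Hypothesis E1 : E true + E false = 1%:M.
Variable nx : bool -> bool.
Hypothesis nxK : involutive nx.
Implicit Types (N : 'M[K]_n) (F : seq (string K n)).

(** For [nx = negb] these are the odd operators, i.e. pairs (x, y); for [nx = id] the even ones,
    where the moment map takes its values. One theory covers both. *)
Definition homogeneous N := forall b, N *m E b = E (nx b) *m N.

Definition idx F : seq (string K n * nat) := [seq (x, j) | x <- F, j <- iota 0 x.2.2].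
Definition bv N (i : string K n * nat) : 'cV[K]_n := N ^+ i.2 *m i.1.1.
Definition deg (i : string K n * nat) : bool := iter i.2 nx i.1.2.1.

(** A string of length 0 is allowed, its first vector being 0 by the second condition: squaring and
    deforming produce such strings. *)
Definition strings N F : Prop :=
  [/\ forall x, x \in F -> E x.2.1 *m x.1 = x.1,
      forall x, x \in F -> N ^+ x.2.2 *m x.1 = 0 &
      basis_of fullv (map (bv N) (idx F))].

Definition positive F := all (fun x : string K n => 0 < x.2.2)%N F.

Lemma mem_idx F x j : ((x, j) \in idx F) = (x \in F) && (j < x.2.2)%N.
Proof.
apply/allpairsPdep/andP => [[y [k [yF kI [-> ->]]]]|[xF jx]].
  by rewrite mem_iota in kI.
by exists x, j; rewrite mem_iota.
Qed.

Lemma idx_uniq_pos F : positive F -> uniq (idx F) -> uniq F.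
Proof.
move=> pF /(filter_uniq (fun i => i.2 == 0%N)).
suff -> : [seq i <- idx F | i.2 == 0%N] = map (fun x => (x, 0%N)) F by move/map_uniq.
elim: F pF => //= x F IH /andP[px pF]; rewrite filter_cat IH //.
rewrite -cat1s; congr (_ ++ _); case: x.2.2 px => //= k _; congr (_ :: _).
apply/eqP; rewrite -size_eq0 size_filter -leqn0 leqNgt -has_count.
by apply/hasPn => _ /mapP[j + ->] /=; rewrite mem_iota; case: j.
Qed.

Lemma homogX N k b : homogeneous N -> N ^+ k *m E b = E (iter k nx b) *m N ^+ k.
Proof.
move=> hN; elim: k => [|k IH]; first by rewrite mul1mx mulmx1.
by rewrite exprS -mulmxE -mulmxA IH mulmxA hN mulmxA.
Qed.

Lemma bvS N x j : N *m bv N (x, j) = bv N (x, j.+1).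
Proof. by rewrite /bv /= exprS -mulmxE mulmxA. Qed.

Lemma bvX N k x j : N ^+ k *m bv N (x, j) = bv N (x, (k + j)%N).
Proof. by rewrite /bv /= exprD -mulmxE mulmxA. Qed.

Lemma string_end N F x j : strings N F -> x \in F -> (x.2.2 <= j)%N -> bv N (x, j) = 0.
Proof.
move=> [_ H _] xF xj; rewrite /bv /= -(subnK xj) exprD -mulmxE -mulmxA H //.
by rewrite mulmx0.
Qed.

Lemma bv_deg N F i c : homogeneous N -> strings N F -> i \in idx F ->
  E c *m bv N i = if c == deg i then bv N i else 0.
Proof.
case: i => x j hN [H _ _]; rewrite mem_idx => /andP[xF _].
have Ex := H x xF; rewrite /bv /deg /=; set d := iter j nx x.2.1.
have Ed : E d *m (N ^+ j *m x.1) = N ^+ j *m x.1 by rewrite mulmxA -homogX // -mulmxA Ex.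
by rewrite -Ed mulmxA EE; case: eqP => [->|_]; rewrite ?mul0mx // Ed.
Qed.

Lemma strings_basis N F : strings N F -> basis_of fullv (map (bv N) (idx F)).
Proof. by case. Qed.

Lemma strings_ext N F m (M M' : 'M[K]_(m, n)) : strings N F ->
  (forall i, i \in idx F -> M *m bv N i = M' *m bv N i) -> M = M'.
Proof.
move=> /strings_basis bF H; apply: (span_mx_eq (X := map (bv N) (idx F))).
  by rewrite (span_basis bF).
by move=> _ /mapP[i iF ->]; exact: H.
Qed.

Lemma strings_uniq N F : strings N F -> uniq (idx F).
Proof. by move=> /strings_basis /basis_free /free_uniq /map_uniq. Qed.

Section Dual.
Variables (N : 'M[K]_n) (F : seq (string K n)) (xi : string K n * nat -> 'rV[K]_n).
Hypotheses (hN : homogeneous N) (sF : strings N F).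
Hypothesis xib : forall i j, i \in idx F -> j \in idx F ->
  xi i *m bv N j = (i == j)%:R%:M.

Lemma dual_sum m (G : string K n * nat -> 'M[K]_(m, 1)) j : j \in idx F ->
  (\sum_(i <- idx F) G i *m xi i) *m bv N j = G j.
Proof. by move=> jF; apply: dual_basis_sum => //; exact: strings_uniq sF. Qed.

Lemma dual_deg i c : i \in idx F -> xi i *m E c = if c == deg i then xi i else 0.
Proof.
move=> iF; apply: (strings_ext sF) => j jF; rewrite -mulmxA (bv_deg _ hN sF) //.
have [-> | ij] := eqVneq i j.
  by case: ifP => _; rewrite ?mulmx0 ?mul0mx.
by case: ifP => _; case: ifP => _; rewrite ?mulmx0 ?mul0mx // xib // (negPf ij) raddf0.
Qed.

(** Right multiplication by N moves dual vectors backwards along their string. *)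
Lemma dual_shift x j k : (x, (k + j)%N) \in idx F -> xi (x, (k + j)%N) *m N ^+ k = xi (x, j).
Proof.
move=> kF; have jF : (x, j) \in idx F.
  by move: kF; rewrite !mem_idx => /andP[-> /=]; apply: leq_ltn_trans; exact: leq_addl.
apply: (strings_ext sF) => -[y l] lF; rewrite -mulmxA bvX (xib jF lF).
have [yl|yl] := boolP ((y, (k + l)%N) \in idx F).
  rewrite xib //; congr (_%:R%:M); rewrite !xpair_eqE eqn_add2l //.
move: lF yl; rewrite !mem_idx => /andP[yF _]; rewrite yF /= -leqNgt => yl.
rewrite (string_end sF yF yl) mulmx0; case: eqP => [[xy jl]|_]; last by rewrite raddf0.
by move: kF yl; rewrite mem_idx -xy -jl => /andP[_]; rewrite ltnNge => /negPf ->.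
Qed.

End Dual.

Definition rk_count (T : seq (bool * nat)) k c : nat :=
  (\sum_(t <- T) \sum_(0 <= j < t.2 - k) (iter j nx t.1 == c))%N.

(** N^k kills the basis vectors among the last k of their string and sends the others to distinct
    basis vectors; [Q] lists the latter in degree c. *)
Lemma rank_strings N F k c : homogeneous N -> strings N F ->
  \rank (N ^+ k *m E c) = rk_count (map snd F) k c.
Proof.
move=> hN sF; have [xi [xib xi1]] := dual_basis (strings_basis sF).
pose Q := [seq i <- idx F | (deg i == c) && (i.2 + k < i.1.2.2)%N].
have -> : rk_count (map snd F) k c = size Q.
  rewrite /Q size_filter /idx -sum1_count big_mkcond big_allpairs_dep /rk_count big_map.
  apply: eq_bigr => x _.
  have -> : iota 0 x.2.2 = index_iota 0 x.2.2 by rewrite /index_iota subn0.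
  rewrite (big_cat_nat (n := x.2.2 - k)) ?leq_subr //= [X in _ = (_ + X)%N]big1_seq ?addn0.
    rewrite !big_seq; apply: eq_bigr => j; rewrite mem_index_iota /= => jk.
    by rewrite /deg /= ltn_subRL addnC in jk *; rewrite jk andbT; case: eqP.
  move=> j /=; rewrite mem_index_iota => /andP[jk _].
  by rewrite [(_ < x.2.2)%N]ltnNge addnC -leq_subLR jk andbF.
have QF i : i \in Q -> [/\ i \in idx F, deg i = c & (i.1, (k + i.2)%N) \in idx F].
  case: i => x j; rewrite mem_filter mem_idx /= => /andP[/andP[/eqP dc jk] /andP[xF jx]].
  by rewrite !mem_idx xF jx addnC.
have uQ : uniq Q by apply: filter_uniq; exact: strings_uniq sF.
pose i0 : string K n * nat := ((0, (true, 0%N)), 0%N).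
pose r := size Q; pose ii (a : 'I_r) := nth i0 Q a.
have iiQ a : ii a \in Q by exact: mem_nth.
pose U := \matrix_(l < n, a < r) bv N ((ii a).1, (k + (ii a).2)%N) l 0.
pose X := \matrix_(a < r) xi (ii a).
(* Factoring through a space of dimension [size Q] bounds the rank from above. *)
have ME : N ^+ k *m E c = U *m X.
  apply: (strings_ext sF) => -[x j] jF; rewrite -mulmxA (bv_deg _ hN sF) //.
  have Xcol : X *m bv N (x, j) = \col_a (ii a == (x, j))%:R.
    apply/colP => a; have -> : (X *m bv N (x, j)) a 0 = (row a X *m bv N (x, j)) 0 0.
      by rewrite -row_mul [RHS]mxE.
    by rewrite rowK xib //; [rewrite !mxE eqxx mulr1n | have [] := QF _ (iiQ a)].
  rewrite -mulmxA Xcol; have [jQ|jQ] := boolP ((x, j) \in Q).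
    have [_ dc _] := QF _ jQ; rewrite dc eqxx bvX.
    have ltj : (index (x, j) Q < r)%N by rewrite index_mem.
    have E0 : ii (Ordinal ltj) = (x, j) by rewrite /ii nth_index.
    apply/colP => l; rewrite [RHS]mxE (bigD1 (Ordinal ltj)) //=.
    rewrite [U _ _]mxE [X in _ * X + _]mxE E0 eqxx mulr1.
    rewrite big1 ?addr0 // => a al; rewrite [X in _ * X]mxE; case: eqP => [Ea|]; last by rewrite mulr0.
    case/eqP: al; apply: val_inj; apply/eqP.
    by rewrite -(nth_uniq i0 _ _ uQ) //= -/(ii a) Ea nth_index.
  have -> : \col_a (ii a == (x, j))%:R = 0 :> 'cV[K]_r.
    apply/colP => a; rewrite !mxE; case: eqP => // Ea.
    by rewrite -Ea iiQ in jQ.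
  rewrite mulmx0; case: eqP => [dc|_]; last by rewrite mulmx0.
  rewrite bvX; move: (jF) jQ; rewrite mem_idx mem_filter -dc eqxx jF andbT /= => /andP[xF jx].
  by rewrite -leqNgt addnC => /(string_end sF xF).
apply/eqP; rewrite eqn_leq {1}ME mulmx_max_rank /=.
(* Compressing between basis and dual vectors leaves an identity matrix of size [r], which bounds
   the rank from below. *)
pose Y := \matrix_(a < r) xi ((ii a).1, (k + (ii a).2)%N).
pose B := \matrix_(l < n, a < r) bv N (ii a) l 0.
have YB : Y *m (N ^+ k *m E c) *m B = 1%:M.
  apply/matrixP => a b.
  have -> : (Y *m (N ^+ k *m E c) *m B) a b = (row a Y *m (N ^+ k *m E c *m col b B)) 0 0.
    by rewrite rowE colE !mulmxA -colE -!mulmxA -rowE [RHS]mxE [RHS]mxE.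
  have [bF db bk] := QF _ (iiQ b); have [aF da ak] := QF _ (iiQ a).
  rewrite rowK; have -> : col b B = bv N (ii b) by apply/colP => l; rewrite !mxE.
  rewrite -mulmxA (bv_deg _ hN sF) // db eqxx.
  have -> : N ^+ k *m bv N (ii b) = bv N ((ii b).1, (k + (ii b).2)%N) by rewrite -bvX; case: (ii b).
  rewrite xib // !mxE eqxx mulr1n; congr (_%:R).
  rewrite xpair_eqE eqn_add2l -xpair_eqE -!surjective_pairing.
  by rewrite /ii nth_uniq.
rewrite -[r in (r <= _)%N](mxrank1 K) -YB.
by apply: leq_trans (mxrankM_maxl _ _) _; exact: mxrankM_maxr.
Qed.

Lemma perm_strings N F F' : perm_eq F F' -> strings N F -> strings N F'.
Proof.
move=> FF' [H1 H2 H3]; split=> [x|x|]; rewrite -?(perm_mem FF').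
- exact: H1.
- exact: H2.
rewrite -(perm_basis _ (perm_map _ (perm_flatten (perm_map _ FF')))); exact: H3.
Qed.

(** The conjugating matrix sends each basis vector to the one at the same position of the matching
    string. Positivity makes the strings of [F] distinct, so that the matching by index is well
    defined. *)
Lemma strings_conj N N' F F' : homogeneous N -> homogeneous N' ->
  strings N F -> strings N' F' -> positive F ->
  perm_eq (map snd F) (map snd F') ->
  exists g, [/\ g \in unitmx, forall c, E c *m g = g *m E c & g *m N = N' *m g].
Proof.
move=> hN hN' sF sF'0 pF /perm_map_lift[F'' pF'' TF].
have {F' sF'0 pF''} sF' : strings N' F'' by apply: perm_strings sF'0; rewrite perm_sym.
have uF : uniq F := idx_uniq_pos pF (strings_uniq sF).
have szF : size F = size F'' by rewrite -(size_map snd F) TF size_map.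
pose x0 : string K n := (0, (true, 0%N)).
pose tr (x : string K n) := nth x0 F'' (index x F).
pose tri (i : string K n * nat) := (tr i.1, i.2).
have trF : F'' = map tr F.
  apply: (eq_from_nth (x0 := x0)); rewrite ?size_map // => k kF''.
  by rewrite (nth_map x0) ?szF // /tr index_uniq // szF.
have trT x : x \in F -> (tr x).2 = x.2.
  move=> xF; rewrite /tr -(nth_map _ (true, 0%N)) -?szF ?index_mem // -TF.
  by rewrite (nth_map x0) ?index_mem // nth_index.
have idxF : idx F'' = map tri (idx F).
  rewrite /idx trF map_allpairs allpairs_mapl; congr flatten; apply/eq_in_map => x xF.
  by rewrite trT.
have triF i : i \in idx F -> tri i \in idx F'' by rewrite idxF; exact: map_f.
have [xi [xib xi1]] := dual_basis (strings_basis sF).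
have [xi' [xib' xi1']] := dual_basis (strings_basis sF').
pose g := \sum_(i <- idx F) bv N' (tri i) *m xi i.
have gb i : i \in idx F -> g *m bv N i = bv N' (tri i).
  exact: (dual_sum sF xib (fun i => bv N' (tri i))).
have degtr i : i \in idx F -> deg (tri i) = deg i.
  by case: i => x j; rewrite mem_idx => /andP[xF _]; rewrite /deg /= trT.
exists g; split.
- have H : g *m (\sum_(i <- idx F) bv N i *m xi' (tri i)) = 1%:M.
    rewrite mulmx_sumr xi1' idxF big_map big_seq [RHS]big_seq.
    by apply: eq_bigr => i iF; rewrite mulmxA gb.
  by have [] := mulmx1_unit H.
- move=> c; apply: (strings_ext sF) => i iF.
  rewrite -!mulmxA gb // (bv_deg _ hN sF) // (bv_deg _ hN' sF') ?triF // degtr //.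
  by case: ifP => _; rewrite ?gb ?mulmx0.
- apply: (strings_ext sF) => -[x j] jF; rewrite -!mulmxA gb // !bvS.
  move: (jF); rewrite mem_idx => /andP[xF jx].
  have trx : tr x \in F'' by rewrite trF map_f.
  have [jx1|jx1] := boolP (j.+1 < x.2.2)%N; first by rewrite gb // mem_idx xF.
  rewrite -leqNgt in jx1; rewrite (string_end sF xF jx1) mulmx0.
  by rewrite (string_end sF' trx) // trT.
Qed.

(** Counts the possible images of the first vector of s among the vectors of t: the degree must be
    that of s, and the vector must be killed after [s.2] steps. *)
Definition cent_count (T : seq (bool * nat)) : nat :=
  (\sum_(s <- T) \sum_(t <- T) \sum_(0 <= j < t.2)
     ((iter j nx t.1 == s.1) && (t.2 <= j + s.2)))%N.

(** A commuting even map is determined by the images of the first vectors of the strings. The maps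
    [G y] sending one first vector to one allowed basis vector, and the other first vectors to 0,
    form a basis. *)
Lemma dim_centralizer_strings N F (Z : {vspace 'M[K]_n}) : homogeneous N -> strings N F ->
  positive F ->
  (forall g, reflect ((forall c, E c *m g = g *m E c) /\ g *m N = N *m g) (g \in Z)) ->
  \dim Z = cent_count (map snd F).
Proof.
move=> hN sF pF memZ; have [xi [xib xi1]] := dual_basis (strings_basis sF).
have uF : uniq F := idx_uniq_pos pF (strings_uniq sF).
pose cond (y : string K n * (string K n * nat)) :=
  (deg y.2 == y.1.2.1) && (y.2.1.2.2 <= y.2.2 + y.1.2.2)%N.
pose Q := [seq y <- [seq (x, i) | x <- F, i <- idx F] | cond y].
have uQ : uniq Q.
  apply/filter_uniq/allpairs_uniq => //; first exact: strings_uniq sF.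
  by move=> [a b] [c d].
have memQ x i : ((x, i) \in Q) = [&& cond (x, i), x \in F & i \in idx F].
  rewrite mem_filter; congr (_ && _); apply/allpairsP/andP => [[[a b] /= [aF bF [-> ->]]] //|[xF iF]].
  by exists (x, i).
have -> : cent_count (map snd F) = size Q.
  rewrite /Q size_filter -sum1_count big_mkcond big_allpairs_dep /cent_count big_map.
  apply: eq_bigr => x _; rewrite big_allpairs_dep big_map; apply: eq_bigr => z _.
  have -> : iota 0 z.2.2 = index_iota 0 z.2.2 by rewrite /index_iota subn0.
  by apply: eq_bigr => j _; rewrite /cond /=; case: (_ && _).
pose G (y : string K n * (string K n * nat)) :=
  \sum_(i <- idx F) (if i.1 == y.1 then bv N (y.2.1, (i.2 + y.2.2)%N) else 0) *m xi i.
have Gb y i : i \in idx F ->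
    G y *m bv N i = if i.1 == y.1 then bv N (y.2.1, (i.2 + y.2.2)%N) else 0.
  exact: (dual_sum sF xib (fun i => if i.1 == y.1 then bv N (y.2.1, (i.2 + y.2.2)%N) else 0)).
have GZ y : y \in Q -> G y \in Z.
  case: y => x [t l]; rewrite memQ => /and3P[/andP[/= /eqP dl tl] xF].
  move=> lF; move: (lF); rewrite mem_idx => /andP[tF lt]; apply/memZ; split.
    move=> c; apply: (strings_ext sF) => -[z j] jF; rewrite -!mulmxA Gb //=.
    rewrite (bv_deg _ hN sF) //; case: eqP => [zx|zx]; last first.
      rewrite mulmx0; case: ifP => _; rewrite ?mulmx0 // Gb //=.
      by case: eqP zx.
    have -> : (c == deg (z, j)) = (c == iter j nx (deg (t, l))) by rewrite /deg /= -/(deg (t, l)) dl zx.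
    have [jlt|jlt] := boolP ((t, (j + l)%N) \in idx F).
      rewrite (bv_deg _ hN sF) // /deg /= iterD; case: ifP => _; rewrite ?mulmx0 // Gb //=.
      by rewrite zx eqxx.
    have -> : bv N (t, (j + l)%N) = 0.
      by apply: (string_end sF tF); move: jlt; rewrite mem_idx tF /= -leqNgt.
    rewrite mulmx0; case: ifP => _; rewrite ?mulmx0 // Gb //= zx eqxx.
    by apply/esym/(string_end sF tF); move: jlt; rewrite mem_idx tF /= -leqNgt.
  apply: (strings_ext sF) => -[z j] jF; rewrite -!mulmxA Gb // !bvS.
  move: (jF); rewrite mem_idx => /andP[zF jz].
  have [jz1|] := boolP ((z, j.+1) \in idx F).
    by rewrite Gb //=; case: ifP => _; rewrite ?mulmx0 // bvS addSn.
  rewrite mem_idx zF /= -leqNgt => jz1; rewrite (string_end sF zF jz1) mulmx0 /=.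
  case: eqP => [zx|]; last by rewrite mulmx0.
  rewrite bvS (string_end sF tF) // -addSn addnC; apply: leq_trans tl _.
  by rewrite leq_add2l -zx.
have x0F x : x \in F -> (x, 0%N) \in idx F.
  by move=> xF; rewrite mem_idx xF /=; exact: (allP pF).
have fQ : free (map G Q).
  have sz : size (map G Q) == size Q by rewrite size_map.
  apply/(freeP (X := Tuple sz)) => k; pose y0 := head ((0,(true,0%N)),((0,(true,0%N)),0%N)) Q.
  rewrite /= => H a; pose y := nth y0 Q a.
  have aQ : (a < size Q)%N by [].
  have yQ : y \in Q by exact: mem_nth.
  case Ey: y yQ => [x i]; rewrite memQ => /and3P[cy xF iF].
  (* [G (x, i)] is the only member of the family whose value at the first vector of x has a
     component along i. *)
  have := congr1 (fun M => xi i *m (M *m bv N (x, 0%N))) H.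
  rewrite mul0mx mulmx0 mulmx_suml mulmx_sumr (bigD1 a) //=.
  rewrite (nth_map y0) // -/y Ey -scalemxAl Gb ?x0F //= eqxx add0n -surjective_pairing.
  rewrite -scalemxAr xib // eqxx big1 ?addr0 => [|b ba].
    by rewrite scalemx1 => /matrixP/(_ 0 0); rewrite !mxE eqxx mulr1n.
  have bQ : (b < size Q)%N by [].
  rewrite (nth_map y0) // -scalemxAl Gb ?x0F //=.
  case: eqP => [xb|_]; last by rewrite scaler0 mulmx0.
  have /[!memQ] : ((nth y0 Q b).1, (nth y0 Q b).2) \in Q by rewrite -surjective_pairing mem_nth.
  move=> /and3P[_ _ bF]; rewrite add0n -surjective_pairing -scalemxAr xib //.
  case: eqP => [ib|_]; last by rewrite raddf0 scaler0.
  case/negP: ba; apply/eqP/val_inj/eqP; rewrite -(nth_uniq y0 _ _ uQ) //= -/y Ey.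
  by rewrite [nth _ _ b]surjective_pairing -xb -ib.
suff sQ : (Z <= <<map G Q>>)%VS.
  have <- : <<map G Q>>%VS = Z.
    apply/eqP; rewrite eqEsubv sQ andbT.
    by apply/span_subvP => _ /mapP[y yQ ->]; exact: GZ.
  by rewrite (eqP fQ) size_map.
apply/subvP => g /memZ[gE gN].
have gNX k : g *m N ^+ k = N ^+ k *m g.
  elim: k => [|k IH]; first by rewrite mul1mx mulmx1.
  by rewrite exprS -mulmxE mulmxA gN -!mulmxA IH.
(* The coordinate of [g *m x.1] along i. It vanishes if the degrees differ, or if the power of N
   that kills [x.1] does not kill the basis vector i. *)
pose c (x : string K n) i := (xi i *m g *m x.1) 0 0.
have gx x : g *m x.1 = \sum_(i <- idx F) c x i *: bv N i.
  rewrite -[LHS]mul1mx xi1 mulmx_suml; apply: eq_bigr => i _.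
  by rewrite -mulmxA [xi i *m _]mx11_scalar mul_mx_scalar mulmxA.
have c0 x i : x \in F -> i \in idx F -> ~~ cond (x, i) -> c x i = 0.
  case: i => t l xF lF; have [sF1 sF2 _] := sF; move: (lF); rewrite mem_idx => /andP[tF lt].
  rewrite /cond /= negb_and => /orP[dl|tl].
    rewrite /c -(sF1 _ xF) -mulmxA [g *m _]mulmxA -gE !mulmxA (dual_deg hN sF xib) //.
    by rewrite eq_sym (negPf dl) !mul0mx mxE.
  have lxF : (t, (x.2.2 + l)%N) \in idx F by rewrite mem_idx tF addnC ltnNge.
  rewrite /c -(dual_shift sF xib lxF) -[_ *m _ *m g]mulmxA -gNX -!mulmxA sF2 //.
  by rewrite !mulmx0 mxE.
have -> : g = \sum_(y <- Q) c y.1 y.2 *: G y.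
  apply: (strings_ext sF) => -[x j] xjF; move: (xjF); rewrite mem_idx => /andP[xF jx].
  rewrite {1}/bv /= mulmxA gNX -mulmxA gx mulmx_sumr mulmx_suml big_filter [RHS]big_mkcond.
  rewrite big_allpairs_dep /= (bigD1_seq x) //= [X in _ = _ + X]big1 ?addr0.
    rewrite big_seq [RHS]big_seq; apply: eq_bigr => i iF.
    case: ifP => [_|/negbT ci]; last by rewrite c0 // scale0r mulmx0.
    by rewrite -scalemxAr -scalemxAl Gb //= eqxx -bvX -surjective_pairing.
  move=> z /negPf zx; rewrite big1 // => i _; case: ifP => // _.
  by rewrite -scalemxAl Gb //= eq_sym zx scaler0.
rewrite big_seq; apply: memv_suml => y yQ; apply: memvZ; apply: memv_span; exact: map_f.
Qed.

(** A second difference in k: [d] counts the strings longer than k with given end degree, and its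
    own difference counts those of one exact length, whose first degree is recovered because [nx] is
    an involution. *)
Lemma rk_count_inj (T T' : seq (bool * nat)) :
  all (fun t => 0 < t.2)%N T -> all (fun t => 0 < t.2)%N T' ->
  (forall k c, rk_count T k c = rk_count T' k c) -> perm_eq T T'.
Proof.
pose d (S : seq (bool * nat)) k e : nat :=
  (\sum_(t <- S) ((k < t.2) && (iter t.2.-1 nx t.1 == e)))%N.
have nxX k b : iter (k + k) nx b = b.
  by elim: k => //= k IH; rewrite addnS /= nxK.
have itI k : injective (iter k nx) by move=> b c /(congr1 (iter k nx)); rewrite -!iterD !nxX.
have rkE S k e : rk_count S k (iter k nx e) = (rk_count S k.+1 (iter k nx e) + d S k e)%N.
  rewrite /rk_count /d -big_split; apply: eq_bigr => -[b l] _ /=.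
  have [kl|lk] := ltnP k l; last first.
    have [-> ->] : (l - k = 0)%N /\ (l - k.+1 = 0)%N by lia.
    by rewrite addn0.
  rewrite subnS -(prednK (_ : 0 < l - k)%N) ?subn_gt0 // big_nat_recr //=; congr (_ + nat_of_bool _)%N.
  rewrite -(inj_eq (@itI k)) -iterD -iterD nxX.
  by have -> : (k + (l - k).-1 = l.-1)%N by lia.
have cE S b m : (count_mem (b, m.+1) S + d S m.+1 (iter m nx b))%N = d S m (iter m nx b).
  rewrite -sum1_count big_mkcond /d -big_split; apply: eq_bigr => -[c l] _ /=.
  rewrite xpair_eqE; case: (ltngtP l m.+1) => [|ml|->].
  - by rewrite andbF.
  - by rewrite andbF.
  - by rewrite andbT addn0 (inj_eq (@itI m)); case: eqP.
move=> /allP pT /allP pT' H; apply/allP => -[b [|m]] _ /=.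
  have -> : count_mem (b, 0%N) T = 0%N by apply/count_memPn/negP => /pT.
  by apply/eqP/esym/count_memPn/negP => /pT'.
have dE k e : d T k e = d T' k e.
  by apply/eqP; rewrite -(eqn_add2l (rk_count T k.+1 (iter k nx e))) -rkE !H -rkE.
by rewrite -(eqn_add2r (d T m.+1 (iter m nx b))) cE [X in (_ == _ + X)%N]dE cE dE.
Qed.

Lemma filter_strings N F : strings N F -> strings N [seq x <- F | (0 < x.2.2)%N].
Proof.
move=> [H1 H2 H3]; split=> [x|x|].
- by rewrite mem_filter => /andP[_]; exact: H1.
- by rewrite mem_filter => /andP[_]; exact: H2.
suff -> : idx [seq x <- F | (0 < x.2.2)%N] = idx F by [].
by rewrite /idx; elim: F {H1 H2 H3} => //= x F IH; case: ltngtP => //= [_|<-]; rewrite IH.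
Qed.

Lemma strings_nilpotent N F : strings N F -> exists k, N ^+ k = 0.
Proof.
move=> sF; exists (\max_(x <- F) x.2.2)%N; apply: (strings_ext sF) => -[x j].
rewrite mem_idx => /andP[xF _]; rewrite mul0mx bvX; apply: (string_end sF xF).
by apply: leq_trans (leq_addr _ _); rewrite (big_rem x) //= leq_maxl.
Qed.

(** Under the square, a string falls apart into its even positions, starting at the same vector, and
    its odd positions, starting at the image of that vector. *)
Lemma square_strings N F : homogeneous N -> strings N F ->
  strings (N ^+ 2) (flatten [seq [:: (x.1, (x.2.1, uphalf x.2.2));
                                   (N *m x.1, (nx x.2.1, x.2.2./2))] | x <- F]).
Proof.
move=> hN [H1 H2 H3].
have Hmem x : x \in flatten [seq [:: (x.1, (x.2.1, uphalf x.2.2));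
      (N *m x.1, (nx x.2.1, x.2.2./2))] | x <- F] ->
    exists2 y, y \in F & x = (y.1, (y.2.1, uphalf y.2.2)) \/
      x = (N *m y.1, (nx y.2.1, y.2.2./2)).
  by move=> /flatten_mapP[y yF]; rewrite !inE => /orP[] /eqP ->; exists y; auto.
have N0 y k : y \in F -> (y.2.2 <= k)%N -> N ^+ k *m y.1 = 0.
  by move=> yF yk; rewrite -(subnK yk) exprD -mulmxE -mulmxA H2 // mulmx0.
split=> [x /Hmem [y yF [] ->]|x /Hmem [y yF [] ->]|] /=.
- exact: H1.
- by rewrite mulmxA -hN -mulmxA H1.
- by rewrite -exprM N0 //; lia.
- by rewrite -exprM mulmxA mulmxE -exprSr N0 //; lia.
rewrite -(perm_basis _ (_ : perm_eq (map (bv N) (idx F)) _)) //.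
elim: F {H1 H2 H3 Hmem N0} => //= x F IH; rewrite /idx /= !map_cat catA perm_cat //.
rewrite -!map_comp; pose f j := N ^+ j *m x.1.
have -> : [seq (bv N \o pair x) i | i <- iota 0 x.2.2] = map f (iota 0 x.2.2) by [].
have -> : [seq (bv (N ^+ 2) \o pair (x.1, (x.2.1, uphalf x.2.2))) i | i <- iota 0 (uphalf x.2.2)] =
   map f [seq (2 * i)%N | i <- iota 0 (uphalf x.2.2)].
  by rewrite -map_comp; apply: eq_map => j; rewrite /bv /f /= exprM.
have -> : [seq (bv (N ^+ 2) \o pair (N *m x.1, (nx x.2.1, x.2.2./2))) i | i <- iota 0 x.2.2./2] =
   map f [seq (2 * i).+1 | i <- iota 0 x.2.2./2].
  rewrite -map_comp; apply: eq_map => j; rewrite /bv /f /= -exprM mulmxA mulmxE.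
  by rewrite -exprSr.
rewrite -map_cat; apply: perm_map; apply: uniq_perm; first exact: iota_uniq.
  rewrite cat_uniq !map_inj_uniq ?iota_uniq /= ?andbT; [|by move=> a b; lia|by move=> a b; lia].
  by apply/hasPn => _ /mapP[j _ ->]; apply/negP => /mapP[k _]; lia.
move=> j; rewrite mem_cat mem_iota /=; apply/idP/orP => [jx|[] /mapP[k]].
- have [oj|oj] := boolP (odd j).
    right; apply/mapP; exists j./2; rewrite ?mem_iota /=; last by lia.
    by move: jx oj; lia.
  left; apply/mapP; exists j./2; rewrite ?mem_iota /=; last by lia.
  by move: jx oj; lia.
- by rewrite mem_iota /= => + ->; lia.
- by rewrite mem_iota /= => + ->; lia.
Qed.

Lemma size_idx F : size (idx F) = sumn [seq x.2.2 | x <- F].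
Proof. by elim: F => //= x F IH; rewrite size_cat size_map size_iota IH. Qed.

(* The string decomposition of the image of N is lifted along N and completed by
   homogeneous vectors of the kernel. *)
Lemma strings_exist_in N (W : {vspace 'cV[K]_n}) : homogeneous N -> (exists k, N ^+ k = 0) ->
  (forall v, v \in W -> N *m v \in W) -> (forall v c, v \in W -> E c *m v \in W) ->
  exists F, [/\ positive F, forall x, x \in F -> E x.2.1 *m x.1 = x.1,
    forall x, x \in F -> N ^+ x.2.2 *m x.1 = 0 & basis_of W (map (bv N) (idx F))].
Proof.
move=> hN [k Nk]; have [d] := ubnP (\dim W); elim: d => // d IH in W *.
rewrite ltnS => Wd WN WE.
have [W0|W0] := eqVneq W 0%VS.
  by exists [::]; split=> //; rewrite W0 /= nil_basis.
pose fN := linfun (mulmx N : 'cV_n -> 'cV_n); pose W' := (fN @: W)%VS.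
have fNE v : fN v = N *m v by rewrite lfunE.
have W'W : (W' <= W)%VS by apply/subvP => _ /memv_imgP[v vW ->]; rewrite fNE WN.
have ltW' : (\dim W' < \dim W)%N.
  rewrite ltn_neqAle dimvS // andbT; apply: contra_neq W0 => dE.
  have {dE} W'E : W' = W by apply/eqP; rewrite eqEdim W'W dE leqnn.
  (* If N mapped W onto itself, so would all its powers, and nilpotency would make W zero. *)
  have : forall j v, v \in W -> exists2 u, u \in W & v = N ^+ j *m u.
    elim=> [|j IHj] v vW; first by exists v; rewrite // mul1mx.
    have [u uW ->] := IHj v vW; move: uW; rewrite -{1}W'E => /memv_imgP[w wW ->].
    by exists w; rewrite // fNE mulmxA mulmxE -exprSr.
  move=> /(_ k) H; apply/eqP; rewrite -subv0; apply/subvP => v /H[u _ ->].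
  by rewrite Nk mul0mx mem0v.
have WE' v c : v \in W' -> E c *m v \in W'.
  move=> /memv_imgP[u uW ->]; rewrite fNE mulmxA -[c]nxK -hN -mulmxA -fNE.
  by rewrite memv_img // WE.
have [v /memv_imgP[u uW ->]|//|F' [pF' F'E F'N bF']] := IH W' (leq_trans ltW' Wd).
  by rewrite -fNE memv_img // fNE WN.
have W'b x j : x \in F' -> (j < x.2.2)%N -> N ^+ j *m x.1 \in W'.
  by move=> xF jx; rewrite -/(bv N (x, j)) (basis_mem bF') // map_f // mem_idx xF.
(* A preimage of a first vector, projected to one degree. Since [nx] is an involution, the degree
   [nx x.2.1] is the one that N sends to that of x. *)
have /choice[up upP] : forall x : string K n, exists u, x \in F' ->
    [/\ u \in W, N *m u = x.1 & E (nx x.2.1) *m u = u].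
  move=> x; have [xF|] := boolP (x \in F'); last by exists 0.
  have := W'b x 0%N xF (allP pF' x xF); rewrite mul1mx => /memv_imgP[u uW xu].
  exists (E (nx x.2.1) *m u) => _; split; first exact: WE.
    by rewrite mulmxA hN nxK -mulmxA -fNE -xu F'E.
  by rewrite mulmxA EE eqxx.
pose Ker := (W :&: lker fN)%VS.
have KerP v : (v \in Ker) = (v \in W) && (N *m v == 0) by rewrite memv_cap memv_ker fNE.
pose X := [seq bv N (x, x.2.2.-1) | x <- F'].
have fX : free X.
  have : free [seq bv N i | i <- [seq i <- idx F' | i.2.+1 == i.1.2.2]].
    apply: (@catl_free _ _ [seq bv N i | i <- [seq i <- idx F' | i.2.+1 != i.1.2.2]]).
    rewrite -map_cat -(perm_free (_ : perm_eq (map (bv N) (idx F')) _)) ?(basis_free bF') //.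
    by apply: perm_map; rewrite perm_sym perm_filterC.
  suff -> : [seq i <- idx F' | i.2.+1 == i.1.2.2] = [seq (x, x.2.2.-1) | x <- F'].
    by rewrite -map_comp.
  elim: (F') pF' => //= -[h [b l]] F IHF /andP[/= px pF]; rewrite filter_cat IHF // -cat1s.
  congr (_ ++ _); case: l px => // l _.
  rewrite filter_map -[[:: _]]/(map (pair (h, (b, l.+1))) [:: l]); congr map.
  have -> : iota 0 (h, (b, l.+1)).2.2 = iota 0 l ++ [:: l] by rewrite -(iotaD 0 l 1) addn1.
  rewrite filter_cat /= eqxx -[RHS]cat0s; congr (_ ++ _).
  apply/eqP; rewrite -size_eq0 size_filter -leqn0 leqNgt -has_count.
  by apply/hasPn => j; rewrite mem_iota /=; lia.
(* The homogeneous components of a basis of the kernel are candidates for strings of length 1; those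
   selected in [Y] complete the last vectors [X] of the old strings to a basis of the kernel. *)
pose L : seq (string K n) :=
  flatten [seq [seq (E c *m v, (c, 1%N)) | c <- [:: true; false]] | v <- vbasis Ker].
have LE y : y \in L -> exists v c, v \in Ker /\ y = (E c *m v, (c, 1%N)).
  move=> /flatten_mapP[v vK] /mapP[c _ ->]; exists v, c; split=> //; exact: vbasis_mem.
have LKer y : y \in L -> [/\ y.1 \in W, N *m y.1 = 0 & y.2.2 = 1%N].
  move=> /LE[v [c [+ ->]]]; rewrite KerP /= => /andP[vW /eqP Nv]; split=> //; first exact: WE.
  by rewrite mulmxA hN -mulmxA Nv mulmx0.
have [Y [YL fY LY]] := free_extension (fun y : string K n => y.1) L fX.
pose lift (x : string K n) : string K n := (up x, (nx x.2.1, x.2.2.+1)).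
pose F := map lift F' ++ Y.
have pF : positive F.
  rewrite /positive all_cat all_map; apply/andP; split; first by apply/allP => x _.
  by apply/allP => y /YL /LKer[_ _ ->].
have FE x : x \in F -> E x.2.1 *m x.1 = x.1.
  rewrite mem_cat => /orP[/mapP[y yF ->] /=|/YL /LE[v [c [_ ->]]] /=].
    by have [] := upP y yF.
  by rewrite mulmxA EE eqxx.
have upS x k' : x \in F' -> N ^+ k'.+1 *m up x = N ^+ k' *m x.1.
  by move=> xF; have [_ <- _] := upP x xF; rewrite exprSr -mulmxE mulmxA.
have FN x : x \in F -> N ^+ x.2.2 *m x.1 = 0.
  rewrite mem_cat => /orP[/mapP[y yF ->] /=|/YL /LKer[_ Nx ->]]; last exact: Nx.
  by rewrite upS // F'N.
have FW x : x \in F -> x.1 \in W.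
  rewrite mem_cat => /orP[/mapP[y yF ->] /=|/YL /LKer[]//].
  by have [] := upP y yF.
exists F; split=> //; set S := map _ _.
have SW : (<<S>> <= W)%VS.
  apply/span_subvP => _ /mapP[[x j] + ->]; rewrite mem_idx => /andP[/FW xW _].
  by rewrite /bv /=; elim: j => [|j IHj]; rewrite ?mul1mx // exprS -mulmxE -mulmxA WN.
have memS x j : x \in F -> (j < x.2.2)%N -> N ^+ j *m x.1 \in <<S>>%VS.
  by move=> xF jx; apply: memv_span; apply/mapP; exists (x, j); rewrite // mem_idx xF.
have liftF x : x \in F' -> lift x \in F by move=> xF; rewrite mem_cat map_f.
have XS : (<<map (fun y : string K n => y.1) Y ++ X>> <= <<S>>)%VS.
  apply/span_subvP => v; rewrite mem_cat => /orP[/mapP[y yY ->]|/mapP[x xF ->]].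
    rewrite -[y.1]mul1mx; apply: (memS y 0%N); first by rewrite mem_cat yY orbT.
    by have [_ _ ->] := LKer y (YL y yY).
  rewrite /bv /= -upS // (ltn_predK (allP pF' x xF)).
  by apply: (memS (lift x) x.2.2) => //; exact: liftF.
have KS : (Ker <= <<S>>)%VS.
  apply: subv_trans XS; apply/subvP => v vK; rewrite (coord_vbasis vK).
  apply: memv_suml => i _; apply: memvZ; set w := _`_i.
  have wK : w \in vbasis Ker by rewrite mem_nth ?size_tuple.
  rewrite -[w]mul1mx -E1 mulmxDl; apply: memvD.
    by apply: (LY (E true *m w, (true, 1%N))); apply/flatten_mapP; exists w; rewrite // !inE eqxx.
  apply: (LY (E false *m w, (false, 1%N))); apply/flatten_mapP; exists w; rewrite // !inE eqxx.
  by rewrite orbT.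
have W'S : (W' <= fN @: <<S>>)%VS.
  rewrite -(span_basis bF'); apply/span_subvP => _ /mapP[[x j] + ->].
  rewrite mem_idx => /andP[xF jx]; rewrite /bv /= -upS // exprS -mulmxE -mulmxA -fNE.
  by apply: memv_img; apply: (memS (lift x) j); rewrite ?liftF //= ltnW.
(* The span contains the kernel and maps onto N W, so it is W. Lifting adds one vector to each
   string of N W, which keeps the number of vectors within dim Ker + dim N W. *)
rewrite basisEdim; apply/andP; split.
  apply/subvP => w wW; have /(subvP W'S)/memv_imgP[s sS ws] : fN w \in W' by exact: memv_img.
  rewrite -[w](subrK s); apply: memvD => //; apply: (subvP KS).
  rewrite KerP; apply/andP; split; first by apply: memvB => //; exact: (subvP SW).
  by apply/eqP; rewrite mulmxBr -!fNE ws subrr.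
have <- : (\dim Ker + \dim W')%N = \dim W := limg_ker_dim fN W.
have -> : \dim W' = size (idx F') by rewrite -(span_basis bF') (eqP (basis_free bF')) size_map.
have /dimvS : (<<map (fun y : string K n => y.1) Y ++ X>> <= Ker)%VS.
  apply/span_subvP => v; rewrite mem_cat => /orP[/mapP[y yY ->]|/mapP[x xF ->]].
    by have [yW Ny _] := LKer y (YL y yY); rewrite KerP yW Ny eqxx.
  have x0 := allP pF' x xF; rewrite KerP bvS /bv /= (ltn_predK x0) F'N // eqxx andbT.
  by rewrite (subvP W'W) // W'b // prednK.
rewrite (eqP fY) size_cat !size_map => dK.
apply: leq_trans (leq_add dK (leqnn _)); rewrite ?size_map !size_idx.
rewrite /F map_cat sumn_cat -map_comp addnC -addnA; apply: leq_add.
  rewrite (_ : [seq x.2.2 | x <- Y] = nseq (size Y) 1%N) ?sumn_nseq ?mul1n //.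
  elim: (Y) YL => //= y Y' IHY YL; have [_ _ ->] := LKer y (YL y (mem_head _ _)).
  by rewrite -IHY // => z zY; apply: YL; rewrite inE zY orbT.
by elim: (F') => //= x F0 IHF; rewrite -/(size _) /= in IHF *; lia.
Qed.

Lemma strings_exist N : homogeneous N -> (exists k, N ^+ k = 0) ->
  exists2 F, strings N F & positive F.
Proof.
move=> hN nN.
have [v _|v c _|F [pF H1 H2 H3]] := strings_exist_in hN nN (W := fullv); rewrite ?memvf //.
by exists F.
Qed.

(** A homogeneous basis is laid out along strings of the wanted types and N shifts each vector to
    its successor; only the numbers of vectors in each degree have to match. *)
Lemma strings_rep (T : seq (bool * nat)) (std : seq (bool * 'cV[K]_n)) :
  basis_of fullv (map snd std) -> (forall y, y \in std -> E y.1 *m y.2 = y.2) ->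
  perm_eq (flatten [seq [seq iter j nx t.1 | j <- iota 0 t.2] | t <- T]) (map fst std) ->
  exists N F, [/\ homogeneous N, strings N F & map snd F = T].
Proof.
move=> bstd Estd /perm_map_lift[std' pstd' Tstd'].
have {bstd} bstd' : basis_of fullv (map snd std') by rewrite (perm_basis _ (perm_map snd pstd')).
have {Estd pstd'} Estd' y : y \in std' -> E y.1 *m y.2 = y.2.
  by rewrite (perm_mem pstd'); exact: Estd.
pose t0 : bool * nat := (true, 0%N).
(* Strings are labelled by their place in [T], since types may be repeated. *)
pose I := [seq (i, j) | i <- iota 0 (size T), j <- iota 0 (nth t0 T i).2].
pose degI (y : nat * nat) := iter y.2 nx (nth t0 T y.1).1.
have memI i j : ((i, j) \in I) = (i < size T)%N && (j < (nth t0 T i).2)%N.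
  apply/allpairsPdep/andP => [[k [l [+ + [-> ->]]]]|[iT jT]]; first by rewrite !mem_iota.
  by exists i, j; rewrite !mem_iota.
have uI : uniq I.
  apply: allpairs_uniq_dep => [|i _|[i j] [k l] _ _ [-> ->] //]; exact: iota_uniq.
have degIE : map degI I = map fst std'.
  rewrite -Tstd' /I map_allpairs; congr flatten.
  by rewrite -[T in RHS](mkseq_nth t0) /mkseq -map_comp.
have szI : size I = size std' by rewrite -(size_map degI) degIE size_map.
pose d0 : bool * 'cV[K]_n := (true, 0).
pose be (y : nat * nat) := (nth d0 std' (index y I)).2.
have beI : map be I = map snd std'.
  apply: (eq_from_nth (x0 := 0)); rewrite ?size_map // => k kI.
  rewrite (nth_map (0%N, 0%N)) // (nth_map d0) -?szI // /be index_uniq //.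
have beE y : y \in I -> E (degI y) *m be y = be y.
  move=> yI; have ltI : (index y I < size I)%N by rewrite index_mem.
  have -> : degI y = (nth d0 std' (index y I)).1.
    by rewrite -(nth_map _ true) -?szI // -degIE (nth_map y) // nth_index.
  by apply: Estd'; rewrite mem_nth // -szI.
have bbe : basis_of fullv (map be I) by rewrite beI.
have [xi [xib xi1]] := dual_basis bbe.
pose nxt (y : nat * nat) := if (y.1, y.2.+1) \in I then be (y.1, y.2.+1) else 0.
pose N := \sum_(y <- I) nxt y *m xi y.
have Nbe y : y \in I -> N *m be y = nxt y by exact: dual_basis_sum.
have spI (M M' : 'M[K]_n) : (forall y, y \in I -> M *m be y = M' *m be y) -> M = M'.
  move=> H; apply: (span_mx_eq (X := map be I)); first by rewrite (span_basis bbe).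
  by move=> _ /mapP[y yI ->]; exact: H.
have Edeg y c : y \in I -> E c *m be y = if c == degI y then be y else 0.
  by move=> yI; rewrite -(beE y yI) mulmxA EE; case: eqP => [->|_]; rewrite ?mul0mx // beE.
exists N, [seq (be (i, 0%N), nth t0 T i) | i <- iota 0 (size T)].
have hN : homogeneous N.
  move=> b; apply: spI => -[i j] yI; rewrite -!mulmxA Edeg // Nbe // /nxt /=.
  have [sI|sI] := boolP ((i, j.+1) \in I).
    rewrite Edeg // (inj_eq (inv_inj nxK)).
    by case: ifP => _; rewrite ?mulmx0 // Nbe // /nxt /= sI.
  by rewrite mulmx0; case: ifP => _; rewrite ?mulmx0 // Nbe // /nxt /= (negPf sI).
have NX i j : (i, j) \in I -> N ^+ j *m be (i, 0%N) = be (i, j).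
  elim: j => [|j IHj] jI; first by rewrite mul1mx.
  have jI' : (i, j) \in I by move: jI; rewrite !memI => /andP[-> /ltnW].
  by rewrite exprS -mulmxE -mulmxA IHj // Nbe // /nxt jI.
(* A string of length 0 receives the vector 0 through the default of [nth]. *)
have be0 i : (i, 0%N) \notin I -> be (i, 0%N) = 0.
  by move=> iI; rewrite /be nth_default // memNindex // szI.
split=> //; last by rewrite -map_comp -[RHS](mkseq_nth t0).
split=> [_ /mapP[i _ ->] /=|_ /mapP[i iT ->] /=|].
- have [iI|iI] := boolP ((i, 0%N) \in I); first exact: (beE _ iI).
  by rewrite be0 // mulmx0.
- have [iI|iI] := boolP ((i, 0%N) \in I); last by rewrite be0 // mulmx0.
  move: (iI); rewrite memI => /andP[iT' /prednK <-].
  rewrite exprS -mulmxE -mulmxA NX; last first.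
    by rewrite memI iT' /=; move: iI; rewrite memI => /andP[_]; case: (nth _ _ _).2.
  rewrite Nbe /nxt /=; last first.
    by rewrite memI iT' /=; move: iI; rewrite memI => /andP[_]; case: (nth _ _ _).2.
  rewrite memI prednK ?ltnn ?andbF //.
  by move: iI; rewrite memI => /andP[].
suff -> : map (bv N) (idx [seq (be (i, 0%N), nth t0 T i) | i <- iota 0 (size T)]) = map be I by [].
rewrite /idx /I !map_allpairs allpairs_mapl; congr flatten; apply/eq_in_map => i iT.
apply/eq_in_map => j jT; rewrite /bv /= NX // memI.
by move: iT jT; rewrite !mem_iota /= !add0n => -> ->.
Qed.

End Strings.

(** * Deformation of two strings of the same odd length *)

Section Deformation.
Variables (K : fieldType) (n : nat) (E : bool -> 'M[K]_n).
Hypothesis EE : forall b c, E b *m E c = if b == c then E b else 0.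
Notation homogeneous := (homogeneous E negb).
Notation strings := (strings E).

(* The last vector of the first string is sent to t times the last vector of the
   second one. *)
Lemma strings_deform (N : 'M[K]_n) h h' m (F0 : seq (string K n)) : homogeneous N ->
  strings N ((h, (true, m.*2.+1)) :: (h', (false, m.*2.+1)) :: F0) -> positive F0 ->
  exists D, homogeneous D /\ forall t, t != 0 ->
    exists2 F, strings (N + t *: D) F &
      map snd F = (true, m.*2.+2) :: (false, m.*2) :: map snd F0.
Proof.
set x := (h, _); set x' := (h', _); set F := x :: x' :: F0.
move=> hN sF pF0; have pF : positive F by [].
have uF : uniq F := idx_uniq_pos pF (strings_uniq sF).
have [xi [xib xi1]] := dual_basis (strings_basis sF).
have xF : x \in F by rewrite mem_head.
have x'F : x' \in F by rewrite !inE eqxx orbT.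
have zF z : z \in F0 -> z \in F by rewrite !inE => ->; rewrite !orbT.
have mF : (x, m.*2) \in idx F by rewrite mem_idx xF /=.
have m'F : (x', m.*2) \in idx F by rewrite mem_idx x'F /=.
have itn b : iter m.*2 negb b = b by elim: (m) => //= k ->; rewrite negbK.
(* The lengths being odd, each string ends in its starting degree, so this rank one map goes from
   degree + to degree - and is odd. *)
pose w := bv N (x', m.*2); pose D := w *m xi (x, m.*2).
have hD : homogeneous D.
  move=> b; rewrite /D -mulmxA (dual_deg EE hN sF xib) // mulmxA (bv_deg EE _ hN sF) //.
  by rewrite /deg /= !itn; case: b; rewrite /= ?mulmx0 ?mul0mx.
exists D; split=> // t t0; set Nt := N + t *: D.
have hNt : homogeneous Nt.
  by move=> b; rewrite mulmxDl mulmxDr -scalemxAl -scalemxAr hN hD.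
have Nt_bv i : i \in idx F ->
    Nt *m bv N i = N *m bv N i + (if i == (x, m.*2) then t *: w else 0).
  move=> iF; rewrite mulmxDl -scalemxAl /D -mulmxA xib // eq_sym; case: eqP => _.
    by rewrite mulmx1.
  by rewrite raddf0 mulmx0 scaler0.
have NtX z j : z \in F -> (j < z.2.2)%N -> Nt ^+ j *m z.1 = N ^+ j *m z.1.
  move=> zF'; elim: j => [//|j IHj] jz; rewrite exprS -mulmxE -mulmxA IHj 1?ltnW //.
  rewrite -/(bv N (z, j)) Nt_bv ?mem_idx ?zF' 1?ltnW // bvS.
  by case: eqP => [[zx jm]|_]; [move: jz; rewrite zx jm ltnn | rewrite addr0].
have NtS z j : Nt ^+ j.+1 *m z = Nt *m (Nt ^+ j *m z) by rewrite exprS -mulmxE mulmxA.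
have Nth : Nt ^+ m.*2.+1 *m h = t *: w.
  rewrite NtS (NtX x) // -/(bv N (x, m.*2)) Nt_bv // eqxx bvS (string_end sF xF) ?add0r //.
have Ntw : Nt *m w = 0.
  rewrite Nt_bv // bvS (string_end sF x'F) // add0r; case: eqP => // -[_ _]; done.
have Nth' : Nt ^+ m.*2 *m h' = w by rewrite (NtX x').
(* The correction has the degree of h', and Nt^(2m) g = w - t^-1 t w = 0: the second string now has
   length 2m. *)
pose g := h' - t^-1 *: (Nt *m h).
have NtXg j : Nt ^+ j *m g = Nt ^+ j *m h' - t^-1 *: (Nt ^+ j.+1 *m h).
  by rewrite mulmxBr -scalemxAr mulmxA mulmxE -exprSr.
have [sF1 sF2 sF3] := sF.
exists ((h, (true, m.*2.+2)) :: (g, (false, m.*2)) :: F0) => //.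
split=> [z|z|].
- rewrite !inE => /or3P[/eqP->|/eqP->|/zF /sF1 //]; first exact: (sF1 x).
  rewrite /= /g mulmxBr -scalemxAr (sF1 x') // mulmxA -(hNt true) -mulmxA.
  by rewrite (sF1 x).
- rewrite !inE => /or3P[/eqP->|/eqP->|zF0] /=.
  + by rewrite NtS Nth -scalemxAr Ntw scaler0.
  + by rewrite NtXg Nth Nth' scalerA mulVf // scale1r subrr.
  + have /prednK zp := allP pF0 z zF0; rewrite -zp NtS NtX ?zp ?zF //.
    rewrite -/(bv N (z, z.2.2.-1)) Nt_bv ?mem_idx ?zF ?zp //= bvS (string_end sF (zF _ zF0)) ?zp //.
    case: eqP => [[zx _]|]; last by rewrite add0r.
    by move: uF; rewrite /= -zx !inE zF0 !orbT.
(* The number of vectors is unchanged, so it suffices to recover the old basis; the vectors of the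
   string of h' come from those of g and h. *)
rewrite basisEdim; set S := map _ _; apply/andP; split; last first.
  rewrite -(span_basis sF3) (eqP (basis_free sF3)) !size_map !size_idx /=.
  by rewrite addSn addnS.
rewrite -(span_basis sF3); apply/span_subvP => _ /mapP[[z j] + ->].
have memS u k : u \in (h, (true, m.*2.+2)) :: (g, (false, m.*2)) :: F0 -> (k < u.2.2)%N ->
    Nt ^+ k *m u.1 \in <<S>>%VS.
  by move=> uS ku; apply: memv_span; apply/mapP; exists (u, k); rewrite // mem_idx uS.
have memh k : (k < m.*2.+2)%N -> Nt ^+ k *m h \in <<S>>%VS.
  by move=> km; apply: (memS (h, (true, m.*2.+2))); rewrite ?mem_head.
rewrite mem_idx => /andP[zF' jz]; rewrite /bv /= -NtX //.
move: zF' jz; rewrite !inE => /or3P[/eqP->|/eqP->|zF0] /= jz.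
- by apply: memh; rewrite ltnW.
- move: jz; rewrite ltnS leq_eqVlt => /orP[/eqP->|jm].
    rewrite Nth'; have -> : w = t^-1 *: (Nt ^+ m.*2.+1 *m h) by rewrite Nth scalerA mulVf // scale1r.
    by apply: memvZ; exact: memh.
  have -> : Nt ^+ j *m h' = Nt ^+ j *m g + t^-1 *: (Nt ^+ j.+1 *m h) by rewrite NtXg subrK.
  apply: memvD; first by apply: (memS (g, (false, m.*2))); rewrite // !inE eqxx orbT.
  by apply: memvZ; apply: memh; rewrite ltnS; exact: leq_trans jm _.
- by apply: memS; rewrite // !inE zF0 !orbT.
Qed.

End Deformation.

(** * Orbits as sets of given string types *)

Section GradedOrbits.
Variables (K : fieldType) (q p : nat).

Definition gproj (b : bool) : 'M[K]_(q + p) :=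
  if b then block_mx 1%:M 0 0 0 else block_mx 0 0 0 1%:M.

Arguments gproj : simpl never.

Lemma gprojM b c : gproj b *m gproj c = if b == c then gproj b else 0.
Proof.
by case: b; case: c; rewrite /gproj /= mulmx_block ?(mulmx1, mulmx0, mul0mx, addr0, add0r) // block_mx0.
Qed.

Lemma gprojD : gproj true + gproj false = 1%:M.
Proof. by rewrite /gproj add_block_mx !addr0 !add0r -scalar_mx_block. Qed.

Definition degree0_mx : {vspace 'M[K]_(q + p)} :=
  lker (linfun (mulmxr (gproj true) \- mulmx (gproj true))).

Lemma degree0_mxP g : reflect (forall c, gproj c *m g = g *m gproj c) (g \in degree0_mx).
Proof.
rewrite memv_ker lfunE /= subr_eq0; apply: (iffP eqP) => [E c|H]; last by rewrite H.
case: c => //; have -> : gproj false = 1%:M - gproj true by rewrite -gprojD addrAC subrr add0r.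
by rewrite mulmxBl mulmxBr mul1mx mulmx1 E.
Qed.

Lemma std_homogeneous : exists std : seq (bool * 'cV[K]_(q + p)),
  [/\ basis_of fullv (map snd std), forall y, y \in std -> gproj y.1 *m y.2 = y.2 &
      map fst std = nseq q true ++ nseq p false].
Proof.
pose v1 (i : 'I_q) := (true, col_mx (delta_mx i 0) 0 : 'cV[K]_(q + p)).
pose v2 (i : 'I_p) := (false, col_mx 0 (delta_mx i 0) : 'cV[K]_(q + p)).
exists (map v1 (enum 'I_q) ++ map v2 (enum 'I_p)); split.
- rewrite basisEdim; apply/andP; split; last first.
    by rewrite size_map size_cat (size_map v1) (size_map v2) !size_enum_ord dimvf dim_matrix mulr1.
  apply/subvP => v _; rewrite -[v]vsubmxK.
  have D m (u : 'cV[K]_m) : u = \sum_i u i 0 *: delta_mx i 0.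
    rewrite {1}[u]matrix_sum_delta; apply: eq_bigr => i _.
    by rewrite (big_ord1 _ (fun j => u i j *: delta_mx i j)).
  have -> : col_mx (usubmx v) (dsubmx v) =
      \sum_i (usubmx v i 0) *: (v1 i).2 + \sum_i (dsubmx v i 0) *: (v2 i).2.
    have -> : col_mx (usubmx v) (dsubmx v) =
        col_mx 1%:M 0 *m usubmx v + col_mx 0 1%:M *m dsubmx v.
      by rewrite !mul_col_mx !mul1mx !mul0mx add_col_mx addr0 add0r.
    rewrite [X in _ *m X + _]D [X in _ + _ *m X]D !mulmx_sumr.
    by congr (_ + _); apply: eq_bigr => i _; rewrite -scalemxAr mul_col_mx mul1mx mul0mx.
  apply: memvD; apply: memv_suml => i _; apply: memvZ; apply: memv_span.
    by apply: map_f; rewrite mem_cat map_f // mem_enum.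
  by apply: map_f; rewrite mem_cat orbC map_f // mem_enum.
- move=> y; rewrite mem_cat => /orP[] /mapP[i _ ->];
    by rewrite /gproj /= mul_block_col ?(mul1mx, mul0mx, mulmx0, addr0, add0r).
- have cst (I : Type) (r : seq I) (b : bool) : map (fun=> b) r = nseq (size r) b.
    by elim: r => //= i r ->.
  have := cst _ (enum 'I_q) true; have := cst _ (enum 'I_p) false.
  rewrite !size_enum_ord => <- <-.
  by rewrite map_cat -(map_comp fst v1) -(map_comp fst v2).
Qed.

Variables (V : vectType K) (iota : 'Hom(V, 'M[K]_(q + p))) (nx : bool -> bool).
Hypothesis iota_inj : lker iota == 0%VS.
Hypothesis nxK : involutive nx.
Hypothesis iotaP : forall M, reflect (homogeneous gproj nx M) (M \in limg iota).
Implicit Types (T : seq (bool * nat)).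

Let EE := gprojM.
Let E1 := gprojD.

Definition postype T := all (fun t => 0 < t.2)%N T.

(** For the embedding of pairs (x, y) these will be the sets O(Lambda); for that of pairs of
    endomorphisms, the products of nilpotent classes. *)
Definition stratum T : set V :=
  [set v | exists2 F, strings gproj (iota v) F & perm_eq (map snd F) T].

Lemma iota_homogeneous v : homogeneous gproj nx (iota v).
Proof. by apply/iotaP; exact: memv_img (memvf v). Qed.

Lemma perm_positive T (F : seq (string K (q + p))) :
  perm_eq (map snd F) T -> postype T -> positive F.
Proof. by move=> /perm_all pT; rewrite /postype -pT all_map. Qed.

Lemma stratum_perm T T' : perm_eq T T' -> stratum T = stratum T'.
Proof.
move=> TT'; apply/seteqP; split=> v [F sF pF]; exists F => //.
  exact: perm_trans TT'.
by apply: perm_trans pF _; rewrite perm_sym.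
Qed.

Lemma stratum_rank T v k c : stratum T v -> \rank (iota v ^+ k *m gproj c) = rk_count nx T k c.
Proof.
move=> [F sF pF]; rewrite (rank_strings EE _ _ (iota_homogeneous v) sF).
exact: perm_big.
Qed.

Lemma stratum_uniq T T' v : postype T -> postype T' -> stratum T v -> stratum T' v -> perm_eq T T'.
Proof.
by move=> pT pT' vT vT'; apply: (rk_count_inj nxK pT pT') => k c; rewrite -!(stratum_rank k c _ (v := v)).
Qed.

Lemma mxpolyfun_lfun : mxpolyfun (fun v => iota v).
Proof. by apply: mxpolyfun_lin => a u v; rewrite linearP. Qed.

Lemma stratum_closure_rank T v k c : zariski_closure (stratum T) v ->
  (\rank (iota v ^+ k *m gproj c) <= rk_count nx T k c)%N.
Proof.
rewrite zariski_closureE => Hv; rewrite leqNgt; apply/negP.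
set M := iota v ^+ k *m gproj c => rM.
(* Semicontinuity: B and C compress M to an identity matrix of size its rank. The determinant of
   this compression is polynomial in the point, is 1 at v, and vanishes on the stratum if the rank
   there is smaller. *)
have /row_fullP[B BM] := col_base_full M; have /row_freeP[C MC] := row_base_free M.
have BMC : B *m M *m C = 1%:M.
  transitivity (B *m (col_base M *m row_base M) *m C); first by rewrite mulmx_base.
  by rewrite mulmxA BM mul1mx MC.
have := Hv (fun u => \det (B *m (iota u ^+ k *m gproj c) *m C)).
rewrite -/M BMC det1 => H; suff /eqP : 1 = 0 :> K by rewrite oner_eq0.
apply: H => [|u uT].
  apply: polyfun_det; do 2?apply: mxpolyfun_mul; try exact: mxpolyfun_cst.
  apply: mxpolyfun_mul; last exact: mxpolyfun_cst.
  exact/mxpolyfunX/mxpolyfun_lfun.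
apply/eqP; rewrite -[_ == 0]negbK -unitfE -unitmxE -row_free_unit -row_leq_rank -ltnNge.
apply: leq_ltn_trans rM; rewrite -(stratum_rank _ _ uT).
by apply: leq_trans (mxrankM_maxl _ _) _; exact: mxrankM_maxr.
Qed.

Lemma stratum_closure_inj T T' : postype T -> postype T' -> stratum T !=set0 -> stratum T' !=set0 ->
  zariski_closure (stratum T) = zariski_closure (stratum T') -> perm_eq T T'.
Proof.
move=> pT pT' [v vT] [v' vT'] cTT'; apply: (rk_count_inj nxK pT pT') => k c.
apply/eqP; rewrite eqn_leq -{1}(stratum_rank k c vT) -{2}(stratum_rank k c vT').
by rewrite !stratum_closure_rank //; [rewrite cTT'|rewrite -cTT']; exact: sub_zariski_closure.
Qed.

Lemma stratum_nonempty T : 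
  perm_eq (flatten [seq [seq iter j nx t.1 | j <- seq.iota 0 t.2] | t <- T]) (nseq q true ++ nseq p false) ->
  stratum T !=set0.
Proof.
have [std [bstd Estd <-]] := std_homogeneous.
move=> /(strings_rep EE nxK bstd Estd)[N [F [/iotaP/memv_imgP[v _ ->] sF FT]]].
by exists v; exists F => //; rewrite FT.
Qed.

Lemma stratum_conj_orbit T v0 : postype T -> stratum T v0 -> stratum T = conj_orbit iota degree0_mx v0.
Proof.
move=> pT [F0 sF0 pF0]; apply/seteqP; split=> v.
  move=> [F sF pF]; have pF0' := perm_positive pF0 pT.
  have [|g [gu gE gN]] := strings_conj EE (iota_homogeneous v0) (iota_homogeneous v) sF0 sF pF0'.
    by apply: perm_trans pF0 _; rewrite perm_sym.
  by exists g; split=> //; exact/degree0_mxP.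
move=> [g [/degree0_mxP gE gu gN]].
pose F := [seq (g *m x.1, x.2) | x : string K (q + p) <- F0].
have gNX k : g *m iota v0 ^+ k = iota v ^+ k *m g.
  elim: k => [|k IH]; first by rewrite mul1mx mulmx1.
  by rewrite !exprS -!mulmxE mulmxA gN -!mulmxA IH.
have [H1 H2 H3] := sF0.
exists F; last by rewrite -map_comp.
split=> [_ /mapP[x xF ->] /=|_ /mapP[x xF ->] /=|].
- by rewrite mulmxA gE -mulmxA H1.
- by rewrite mulmxA -gNX -mulmxA H2 // mulmx0.
have -> : map (bv (iota v)) (idx F) = map (mulmx g) (map (bv (iota v0)) (idx F0)).
  have -> : idx F = [seq ((g *m i.1.1, i.1.2), i.2) | i : string K (q + p) * nat <- idx F0].
    rewrite /F /idx; elim: (F0) => //= x F1 ->; rewrite map_cat; congr (_ ++ _).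
    by rewrite -map_comp.
  rewrite -!map_comp; apply: eq_map => -[x j].
  by rewrite /bv /= mulmxA -gNX -mulmxA.
rewrite basisEdim -(span_basis H3); apply/andP; split; last first.
  by rewrite (eqP (basis_free H3)) !size_map.
apply/subvP => u _; rewrite -[u](mulKVmx gu) -(lfunE (mulmx g)).
rewrite (_ : <<_>>%VS = (linfun (mulmx g : 'cV_(q + p) -> 'cV_(q + p)) @: <<map (bv (iota v0)) (idx F0)>>)%VS).
  by apply: memv_img; rewrite (span_basis H3) memvf.
by rewrite limg_span; congr (<<_>>%VS); apply: eq_map => w /=; rewrite lfunE.
Qed.

Hypothesis Kinf : infinite_field K.

Let D1 : 1%:M \in degree0_mx.
Proof. by apply/degree0_mxP => c; rewrite mulmx1 mul1mx. Qed.

Let DM a b : a \in degree0_mx -> b \in degree0_mx -> a *m b \in degree0_mx.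
Proof.
move=> /degree0_mxP Ha /degree0_mxP Hb; apply/degree0_mxP => c.
by rewrite mulmxA Ha -mulmxA Hb mulmxA.
Qed.

Let DV a : a \in degree0_mx -> invmx a \in degree0_mx.
Proof.
move=> aD; have /degree0_mxP Ha := aD; have [ua|ua] := boolP (a \in unitmx); last by rewrite /invmx (negPf ua).
apply/degree0_mxP => c; apply: (can_inj (mulKmx ua)).
by rewrite mulmxA -Ha -mulmxA mulmxV // mulmx1 mulmxA mulmxV // mul1mx.
Qed.

Let DL a v : a \in degree0_mx -> a *m iota v \in limg iota.
Proof.
move=> /degree0_mxP Ha; apply/iotaP => b.
by rewrite -mulmxA (iota_homogeneous v) mulmxA -Ha mulmxA.
Qed.

Let DR a v : a \in degree0_mx -> iota v *m a \in limg iota.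
Proof.
move=> /degree0_mxP Ha; apply/iotaP => b.
by rewrite -mulmxA -Ha mulmxA (iota_homogeneous v) mulmxA.
Qed.

Lemma dim_stratum_centralizer T v0 : postype T -> stratum T v0 ->
  \dim (centralizer iota degree0_mx v0) = cent_count nx T.
Proof.
move=> pT [F sF pF]; rewrite (dim_centralizer_strings EE (iota_homogeneous v0) sF).
- rewrite /cent_count (perm_big _ pF); apply: eq_bigr => s _; exact: perm_big.
- exact: perm_positive pT.
move=> g; rewrite mem_centralizer; apply: (iffP andP) => [[/degree0_mxP H /eqP ->]|[H ->]] //.
by split=> //; exact/degree0_mxP.
Qed.

(** Makes the truncated subtraction in [stratum_is_dim] an exact one. *)
Lemma cent_count_le T : postype T -> stratum T !=set0 -> (cent_count nx T <= \dim degree0_mx)%N.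
Proof.
move=> pT [v vT]; rewrite -(dim_stratum_centralizer pT vT); apply: dimvS; exact: capvSl.
Qed.

Lemma stratum_irreducible T : postype T -> stratum T !=set0 -> irreducible (stratum T).
Proof.
by move=> pT [v vT]; rewrite (stratum_conj_orbit pT vT); exact: irreducible_conj_orbit.
Qed.

Lemma stratum_is_dim T : postype T -> stratum T !=set0 ->
  is_dim (stratum T) (\dim degree0_mx - cent_count nx T).
Proof.
move=> pT [v vT]; rewrite (stratum_conj_orbit pT vT) -(dim_stratum_centralizer pT vT).
exact: conj_orbit_is_dim.
Qed.

(** A polynomial vanishing on the smaller stratum but not on the larger one can be added to an
    independent family of maximal size on the smaller one. *)
Lemma stratum_dim_lt T T' : postype T -> postype T' -> stratum T !=set0 -> stratum T' !=set0 ->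
  stratum T `<=` zariski_closure (stratum T') -> ~ stratum T' `<=` zariski_closure (stratum T) ->
  (\dim degree0_mx - cent_count nx T < \dim degree0_mx - cent_count nx T')%N.
Proof.
move=> pT pT' nT nT' TT' nTT'; have [[s cs] _] := stratum_is_dim pT nT.
have [fs [sfs pfs ifs]] := chain_algindep cs; rewrite -[X in (X < _)%N]sfs.
have [w wT' nw] : exists2 w, stratum T' w & ~ zariski_closure (stratum T) w.
  by apply: contrapT => H; apply: nTT' => w wT'; apply: contrapT => nw; apply: H; exists w.
have [f pf [fT fw]] : exists2 f, polyfun f & (forall v, stratum T v -> f v = 0) /\ f w != 0.
  apply: contrapT => H; apply: nw; rewrite zariski_closureE => f pf fT.
  by apply/eqP/negPn/negP => fw; apply: H; exists f.
have [v vT'] := nT'; rewrite -(dim_stratum_centralizer pT' vT').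
apply: (conj_orbit_algindep_size Kinf iota_inj D1 DM DV DL DR (fs := f :: fs)) => //.
rewrite -(stratum_conj_orbit pT' vT').
apply: (@algindep_cons _ _ (stratum T)) => //; first exact: stratum_irreducible.
- by exists w.
- exact: algindepS (chain_sub cs) ifs.
Qed.

End GradedOrbits.

(** * Nilpotent pairs as homogeneous matrices *)

Section Embeddings.
Variables (K : fieldType) (q p : nat).
Notation gproj := (gproj K q p).

Definition emb1 (z : pairs K q p) : 'M[K]_(q + p) := block_mx 0 z.2 z.1 0.
Definition emb0 (z : gl_pairs K q p) : 'M[K]_(q + p) := block_mx z.1 0 0 z.2.

Lemma emb1_is_linear : linear emb1.
Proof.
by move=> a u v; rewrite /emb1 scale_block_mx add_block_mx !scaler0 !addr0.
Qed.
Lemma emb0_is_linear : linear emb0.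
Proof.
by move=> a u v; rewrite /emb0 scale_block_mx add_block_mx !scaler0 !addr0.
Qed.
HB.instance Definition _ := GRing.isLinear.Build K (pairs K q p) 'M[K]_(q + p) _ emb1 emb1_is_linear.
HB.instance Definition _ := GRing.isLinear.Build K (gl_pairs K q p) 'M[K]_(q + p) _ emb0 emb0_is_linear.

Definition emb1_lfun : 'Hom(pairs K q p, 'M[K]_(q + p)) := linfun emb1.
Definition emb0_lfun : 'Hom(gl_pairs K q p, 'M[K]_(q + p)) := linfun emb0.

Lemma emb1_lfunE z : emb1_lfun z = emb1 z. Proof. by rewrite lfunE. Qed.
Lemma emb0_lfunE z : emb0_lfun z = emb0 z. Proof. by rewrite lfunE. Qed.

Lemma emb1_lfun_inj : lker emb1_lfun == 0%VS.
Proof.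
apply/lker0P => -[x y] [x' y']; rewrite !emb1_lfunE /emb1 /= => /eq_block_mx [_ -> -> _] //.
Qed.
Lemma emb0_lfun_inj : lker emb0_lfun == 0%VS.
Proof.
apply/lker0P => -[x y] [x' y']; rewrite !emb0_lfunE /emb0 /= => /eq_block_mx [-> _ _ ->] //.
Qed.

Let simp := (mulmx1, mulmx0, mul1mx, mul0mx, addr0, add0r).

Lemma emb1_lfunP M : reflect (homogeneous gproj negb M) (M \in limg emb1_lfun).
Proof.
apply: (iffP memv_imgP) => [[z _ ->] b|H].
  by rewrite emb1_lfunE /emb1 /gproj; case: b; rewrite /= !mulmx_block !simp.
have := H true; rewrite -[M]submxK /gproj /= !mulmx_block !simp => /eq_block_mx[ul _ _ dr].
exists (dlsubmx M, ursubmx M); rewrite ?memvf // emb1_lfunE /emb1 /= ul -dr //.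
Qed.

Lemma emb0_lfunP M : reflect (homogeneous gproj id M) (M \in limg emb0_lfun).
Proof.
apply: (iffP memv_imgP) => [[z _ ->] b|H].
  by rewrite emb0_lfunE /emb0 /gproj; case: b; rewrite /= !mulmx_block !simp.
have := H true; rewrite -[M]submxK /gproj /= !mulmx_block !simp => /eq_block_mx[_ ur dl _].
exists (ulsubmx M, drsubmx M); rewrite ?memvf // emb0_lfunE /emb0 /= -ur dl //.
Qed.

Lemma dim_degree0_mx : \dim (degree0_mx K q p) = (q * q + p * p)%N.
Proof.
have -> : degree0_mx K q p = limg emb0_lfun.
  apply/vspaceP => g; apply/degree0_mxP/emb0_lfunP => H b; exact: esym (H b).
rewrite (limg_dim_eq (U := fullv)); last by rewrite (eqP emb0_lfun_inj) capv0.
by rewrite dimvf.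
Qed.

Lemma muH_square z : emb0 (muH K q p z) = emb1 z ^+ 2.
Proof. by rewrite expr2 -mulmxE /emb0 /emb1 mulmx_block !simp. Qed.

Lemma emb0X z k : emb0 z ^+ k = block_mx (z.1 ^+ k) 0 0 (z.2 ^+ k).
Proof.
elim: k => [|k IH]; first by rewrite !expr0 -scalar_mx_block.
by rewrite !exprS IH -!mulmxE mulmx_block !simp.
Qed.

(** Signs are read from right to left, hence [rev] here and [last] in [rowtype]: the last sign is
    the degree of the first vector. *)
Definition row_of (t : bool * nat) : seq bool := rev [seq iter j negb t.1 | j <- iota 0 t.2].
Definition rowtype (r : seq bool) : bool * nat := (last true r, size r).

Lemma traject_iota (T : Type) (f : T -> T) x n : traject f x n = [seq iter j f x | j <- iota 0 n].
Proof.
elim: n x => //= n IH x; rewrite IH -[1%N]addn0 iotaDl -map_comp; congr (_ :: _).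
by apply: eq_map => j; rewrite /= -iterSr.
Qed.

Lemma path_traject (T : eqType) (f : T -> T) x s :
  path (fun u w => w == f u) x s <-> x :: s = traject f x (size s).+1.
Proof.
rewrite (eq_path (e' := frel f)); last by move=> u w; rewrite /= eq_sym.
split=> [/fpathP[n ->]|[->]]; first by rewrite size_traject.
exact: fpath_traject.
Qed.

Lemma alternating_iter r : alternating r ->
  r = [seq iter j negb (head true r) | j <- iota 0 (size r)].
Proof.
case: r => // a s; rewrite /alternating /sorted => H; rewrite -traject_iota.
by apply/path_traject; rewrite (eq_path (e' := fun a b : bool => a != b)) // => -[] [].
Qed.

Lemma rowtypeK r : alternating r -> row_of (rowtype r) = r.
Proof.
move=> Hr; rewrite /row_of /rowtype /=.
have Hrev : alternating (rev r).
  by rewrite /alternating rev_sorted (eq_sorted (e' := fun a b : bool => a != b)) // => a b; rewrite eq_sym.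
have := alternating_iter Hrev; rewrite size_rev => E.
have -> : last true r = head true (rev r) by case/lastP: (r) => // s b; rewrite last_rcons rev_rcons.
by rewrite -E revK.
Qed.

Lemma homog_vec_act (z : pairs K q p) v : homog_vec (pair_act z v) = emb1 z *m homog_vec v.
Proof. by case: v => v /=; rewrite /emb1 mul_block_col !simp. Qed.

Lemma homog_vec_iter z j v : homog_vec (iter j (pair_act z) v) = emb1 z ^+ j *m homog_vec v.
Proof.
elim: j => [|j IH]; first by rewrite mul1mx.
by rewrite iterS homog_vec_act IH exprS -mulmxE mulmxA.
Qed.

Lemma degree_iter z j (v : homog K q p) : degree (iter j (pair_act z) v) = iter j negb (degree v).
Proof. by elim: j => //= j <-; case: (iter _ _ _). Qed.

Lemma is_stringE z (s : seq (homog K q p)) : is_string z s <->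
  exists v, [/\ (0 < size s)%N, s = [seq iter j (pair_act z) v | j <- iota 0 (size s)] &
    emb1 z ^+ size s *m homog_vec v = 0].
Proof.
have lastE v n : last v (traject (pair_act z) (pair_act z v) n) = iter n (pair_act z) v.
  by rewrite last_traject.
case: s => [|v s] /=; first by split => // -[v []].
split=> [[/path_traject E]|[w [_ E Nw]]].
  have := E; rewrite /= => -[{1}->]; rewrite lastE => Hl.
  exists v; split=> //; first by rewrite -[RHS](traject_iota _ _ (size s).+1).
  by rewrite -homog_vec_iter iterS.
have {}E : v :: s = traject (pair_act z) w (size s).+1 by rewrite traject_iota.
have vw : v = w by case: E.
have /path_traject H : v :: s = traject (pair_act z) v (size s).+1 by rewrite {2}vw.
split=> //; have Es : s = traject (pair_act z) (pair_act z w) (size s) by case: E.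
by rewrite Es vw lastE -iterS homog_vec_iter.
Qed.

Lemma nilp_orbitE (L : SYD q p) : nilp_orbit K L = stratum emb1_lfun [seq rowtype r | r <- syd_rows L].
Proof.
have /and4P[/and3P[_ nil0 _] /allP alt _ _] := fillingP (repr L).
apply/seteqP; split=> z.
  move=> [_ [ss [str bss pss]]].
  pose v0 : homog K q p := inl 0.
  pose F : seq (string K (q + p)) := [seq (homog_vec (head v0 s), (degree (head v0 s), size s)) | s <- ss].
  have strE s : s \in ss -> [/\ (0 < size s)%N,
      s = [seq iter j (pair_act z) (head v0 s) | j <- iota 0 (size s)] &
      emb1 z ^+ size s *m homog_vec (head v0 s) = 0].
    move=> /str/is_stringE[v [s0 E Nv]].
    suff <- : v = head v0 s by split.
    by move: s0 E; clear; case: s => //= w s _ [-> _].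
  exists F.
    rewrite emb1_lfunE; split=> [_ /mapP[s sS ->] /=|_ /mapP[s sS ->] /=|].
    - by rewrite /gproj; case: (head v0 s) => v /=; rewrite mul_block_col !simp.
    - by have [_ _] := strE s sS.
    suff -> : map (bv (emb1 z)) (idx F) = map (homog_vec (p := p)) (flatten ss) by [].
    rewrite /idx map_allpairs allpairs_mapl map_flatten; congr flatten.
    apply/eq_in_map => s sS; have [_ Es _] := strE s sS; rewrite [in RHS]Es -map_comp.
    by apply: eq_map => j; rewrite /bv /= homog_vec_iter.
  suff -> : map snd F = map rowtype (map (@string_row K q p) ss) by exact: perm_map.
  rewrite -!map_comp; apply/eq_in_map => s sS; have [s0 _ _] := strE s sS.
  rewrite /= /rowtype /string_row size_rev size_map; congr (_, _).
  by case: s s0 {sS} => //= v s _; rewrite rev_cons last_rcons.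
move=> [F]; rewrite emb1_lfunE => sF pF.
have posF : positive F.
  have : all (fun t => 0 < t.2)%N [seq rowtype r | r <- syd_rows L].
    rewrite all_map; apply/allP => r rL /=; rewrite lt0n; apply: contraNneq nil0 => r0.
    by apply/mapP; exists r.
  by rewrite -(perm_all _ pF) all_map.
split.
  (* The product xy is the lower right block of the square of the odd operator, and inherits
     nilpotency from it. *)
  have [k Nk] := strings_nilpotent sF; exists k.
  have {}Nk : emb0 (muH K q p z) ^+ k = 0.
    by rewrite muH_square -exprM mulnC exprM Nk expr2 mulr0.
  move: Nk; rewrite emb0X -(block_mx0 _ q p q p) => /eq_block_mx[_ _ _].
  exact.
have [H1 H2 H3] := sF.
pose hom (x : string K (q + p)) : homog K q p :=
  if x.2.1 then inl (usubmx x.1) else inr (dsubmx x.1).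
have homE x : x \in F -> homog_vec (hom x) = x.1.
  move=> /H1 Ex; rewrite /hom -[in RHS]Ex -[in RHS](vsubmxK x.1) /gproj.
  by case: x.2.1; rewrite /= mul_block_col !simp.
pose ss := [seq [seq iter j (pair_act z) (hom x) | j <- iota 0 x.2.2] | x <- F].
exists ss; split.
- move=> _ /mapP[x xF ->]; apply/is_stringE; exists (hom x).
  by rewrite size_map size_iota homE // H2 //; split=> //; exact: (allP posF).
- suff -> : map (homog_vec (p := p)) (flatten ss) = map (bv (emb1 z)) (idx F) by [].
  rewrite /ss /idx map_allpairs map_flatten -map_comp; congr flatten.
  apply/eq_in_map => x xF; rewrite /= -map_comp; apply: eq_map => j /=.
  by rewrite homog_vec_iter homE.
have -> : syd_rows L = map row_of [seq rowtype r | r <- syd_rows L].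
  by rewrite -map_comp -[LHS]map_id; apply/eq_in_map => r rL /=; rewrite rowtypeK ?alt.
suff -> : map (@string_row K q p) ss = map row_of (map snd F) by exact: perm_map.
rewrite -!map_comp; apply/eq_in_map => x xF /=.
rewrite /string_row /row_of -map_comp; congr rev; apply: eq_map => j /=.
by rewrite degree_iter /hom; case: x.2.1.
Qed.

Definition Mtype (nu la : seq nat) : seq (bool * nat) :=
  [seq (true, k) | k <- nu] ++ [seq (false, k) | k <- la].

Lemma jordan_chainE n (A : 'M[K]_n) s : jordan_chain A s <->
  exists v, [/\ (0 < size s)%N, s = [seq A ^+ j *m v | j <- iota 0 (size s)] &
    A ^+ size s *m v = 0].
Proof.
have itE j v : iter j (mulmx A) v = A ^+ j *m v :> 'cV_n.
  by elim: j => [|j IH]; rewrite ?mul1mx // iterS IH exprS -mulmxE mulmxA.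
have lastE v m : last v (traject (mulmx A) (A *m v) m) = A ^+ m *m v :> 'cV_n.
  by rewrite last_traject itE.
have trE v m : traject (mulmx A) v m = [seq A ^+ j *m v | j <- iota 0 m] :> seq 'cV_n.
  by rewrite traject_iota; apply: eq_map => j; rewrite itE.
case: s => [|v s] /=; first by split => // -[v []].
split=> [[/path_traject E]|[w [_ E Nw]]].
  have := E; rewrite /= => -[{1}->]; rewrite lastE => Hl.
  exists v; split=> //; first by rewrite -[RHS](trE _ (size s).+1).
  by rewrite exprS -mulmxE -mulmxA.
have {}E : v :: s = traject (mulmx A) w (size s).+1 by rewrite trE.
have vw : v = w by case: E.
have /path_traject H : v :: s = traject (mulmx A) v (size s).+1 by rewrite {2}vw.
split=> //; have Es : s = traject (mulmx A) (A *m w) (size s) by case: E.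
by rewrite Es vw lastE mulmxA mulmxE -exprS.
Qed.

Lemma M_classE (nu la : seq nat) : (0%N \notin nu) -> (0%N \notin la) ->
  M_class K q p nu la = stratum emb0_lfun (Mtype nu la).
Proof.
move=> nu0 la0; apply/seteqP; split=> -[A B].
  move=> [/= [_ [cs [Acs bcs pcs]]] [_ [ds [Bds bds pds]]]].
  pose F : seq (string K (q + p)) := [seq (col_mx (head 0 s) 0, (true, size s)) | s <- cs]
    ++ [seq (col_mx 0 (head 0 s), (false, size s)) | s <- ds].
  have HE n (C : 'M[K]_n) s : jordan_chain C s -> [/\ (0 < size s)%N,
      s = [seq C ^+ j *m head 0 s | j <- iota 0 (size s)] & C ^+ size s *m head 0 s = 0].
    move=> /jordan_chainE[v [s0 E Nv]]; suff <- : v = head 0 s by split.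
    by move: s0 E; clear; case: s => //= w s _ [-> _]; rewrite mul1mx.
  exists F.
    rewrite emb0_lfunE; split.
    - move=> x; rewrite mem_cat => /orP[] /mapP[s _ ->];
        by rewrite /gproj /= mul_block_col !simp.
    - move=> x; rewrite mem_cat => /orP[] /mapP[s sS ->];
        rewrite emb0X /= mul_block_col !simp.
        by have [_ _ ->] := HE _ _ _ (Acs s sS); rewrite col_mx0.
      by have [_ _ ->] := HE _ _ _ (Bds s sS); rewrite col_mx0.
    pose inq : 'Hom('cV[K]_q, 'cV[K]_(q + p)) := linfun (mulmx (col_mx 1%:M 0)).
    pose inp : 'Hom('cV[K]_p, 'cV[K]_(q + p)) := linfun (mulmx (col_mx 0 1%:M)).
    have inqE u : inq u = col_mx u 0 by rewrite lfunE /= mul_col_mx !simp.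
    have inpE u : inp u = col_mx 0 u by rewrite lfunE /= mul_col_mx !simp.
    have -> : map (bv (emb0 (A, B))) (idx F) = map inq (flatten cs) ++ map inp (flatten ds).
      rewrite /idx /F map_allpairs allpairs_cat !allpairs_mapl !map_flatten; congr (_ ++ _); congr flatten.
        apply/eq_in_map => s sS; have [_ Es _] := HE _ _ _ (Acs s sS); rewrite [in RHS]Es -map_comp.
        by apply: eq_map => j; rewrite /bv emb0X /= inqE mul_block_col !simp.
      apply/eq_in_map => s sS; have [_ Es _] := HE _ _ _ (Bds s sS); rewrite [in RHS]Es -map_comp.
      by apply: eq_map => j; rewrite /bv emb0X /= inpE mul_block_col !simp.
    rewrite basisEdim; apply/andP; split.
      apply/subvP => v _; rewrite span_cat -!limg_span (span_basis bcs) (span_basis bds).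
      have -> : v = inq (usubmx v) + inp (dsubmx v).
        by rewrite inqE inpE add_col_mx addr0 add0r vsubmxK.
      by apply: memv_add; apply: memv_img; exact: memvf.
    rewrite size_cat !size_map.
    have -> : size (flatten cs) = q.
      by rewrite -(eqP (basis_free bcs)) (span_basis bcs) dimvf dim_matrix mulr1.
    have -> : size (flatten ds) = p.
      by rewrite -(eqP (basis_free bds)) (span_basis bds) dimvf dim_matrix mulr1.
    by rewrite dimvf dim_matrix mulr1.
  rewrite /F /Mtype map_cat -!map_comp; apply: perm_cat.
    by rewrite (map_comp (pair true) size); exact: perm_map.
  by rewrite (map_comp (pair false) size); exact: perm_map.
move=> [F]; rewrite emb0_lfunE => sF pF.
have posF : positive F.
  have : all (fun t => 0 < t.2)%N (Mtype nu la).
    rewrite all_cat !all_map; apply/andP; split; apply/allP => k kn /=; rewrite lt0n.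
      by apply: contraNneq nu0 => <-.
    by apply: contraNneq la0 => <-.
  by rewrite -(perm_all _ pF) all_map.
have [k Nk] := strings_nilpotent sF.
move: Nk; rewrite emb0X -(block_mx0 _ q p q p) => /eq_block_mx[/= Ak _ _ Bk].
have [H1 H2 H3] := sF.
pose cs := [seq [seq usubmx (bv (emb0 (A, B)) (x, j)) | j <- iota 0 x.2.2] | x : string K (q + p) <- F & x.2.1].
pose ds := [seq [seq dsubmx (bv (emb0 (A, B)) (x, j)) | j <- iota 0 x.2.2] | x : string K (q + p) <- F & ~~ x.2.1].
have uE x j : usubmx (bv (emb0 (A, B)) (x, j)) = A ^+ j *m usubmx x.1.
  by rewrite /bv emb0X -{1}[x.1]vsubmxK /= mul_block_col !simp col_mxKu.
have dE x j : dsubmx (bv (emb0 (A, B)) (x, j)) = B ^+ j *m dsubmx x.1.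
  by rewrite /bv emb0X -{1}[x.1]vsubmxK /= mul_block_col !simp col_mxKd.
have deg0 x : x \in F -> if x.2.1 then dsubmx x.1 = 0 else usubmx x.1 = 0.
  move=> /H1 <-; rewrite -[x.1]vsubmxK /gproj.
  by case: x.2.1; rewrite /= mul_block_col !simp ?col_mxKu ?col_mxKd.
(* Each family will be shown to span its own space; since the sizes add up to q + p, both are then
   bases. *)
have szF : (size (flatten cs) + size (flatten ds))%N = (q + p)%N.
  have -> : (q + p)%N = size (idx F).
    by rewrite -(size_map (bv (emb0 (A, B)))) -(eqP (basis_free H3)) (span_basis H3) dimvf dim_matrix mulr1.
  rewrite size_idx !size_flatten /shape -!map_comp; elim: (F) => //= x F' IH.
  by case: x.2.1; rewrite /= size_map size_iota -IH; lia.
have spq : (fullv <= <<flatten cs>>)%VS.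
  apply/subvP => u _; have : col_mx u (0 : 'cV[K]_p) \in <<map (bv (emb0 (A, B))) (idx F)>>%VS.
    by rewrite (span_basis H3) memvf.
  move=> /(memv_img (linfun (@usubmx K q p 1))); rewrite lfunE /= col_mxKu limg_span.
  apply/subvP/span_subvP => _ /mapP[_ /mapP[[x j] + ->] ->]; rewrite lfunE mem_idx => /andP[xF jx].
  have := deg0 x xF; case E: x.2.1 => x0; last by rewrite /= uE x0 mulmx0 mem0v.
  apply: memv_span; apply/flattenP; exists [seq usubmx (bv (emb0 (A, B)) (x, j)) | j <- iota 0 x.2.2].
    by apply/mapP; exists x; rewrite // mem_filter E.
  by apply/mapP; exists j; rewrite // mem_iota.
have spp : (fullv <= <<flatten ds>>)%VS.
  apply/subvP => u _; have : col_mx (0 : 'cV[K]_q) u \in <<map (bv (emb0 (A, B))) (idx F)>>%VS.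
    by rewrite (span_basis H3) memvf.
  move=> /(memv_img (linfun (@dsubmx K q p 1))); rewrite lfunE /= col_mxKd limg_span.
  apply/subvP/span_subvP => _ /mapP[_ /mapP[[x j] + ->] ->]; rewrite lfunE mem_idx => /andP[xF jx].
  have := deg0 x xF; case E: x.2.1 => x0; first by rewrite /= dE x0 mulmx0 mem0v.
  apply: memv_span; apply/flattenP; exists [seq dsubmx (bv (emb0 (A, B)) (x, j)) | j <- iota 0 x.2.2].
    by apply/mapP; exists x; rewrite // mem_filter E.
  by apply/mapP; exists j; rewrite // mem_iota.
have dq : (q <= size (flatten cs))%N.
  by apply: leq_trans (dim_span _); apply: leq_trans (dimvS spq); rewrite dimvf dim_matrix mulr1.
have dp : (p <= size (flatten ds))%N.
  by apply: leq_trans (dim_span _); apply: leq_trans (dimvS spp); rewrite dimvf dim_matrix mulr1.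
have typ b : perm_eq [seq x.2.2 | x : string K (q + p) <- F & x.2.1 == b] (if b then nu else la).
  have -> : [seq x.2.2 | x : string K (q + p) <- F & x.2.1 == b] = map snd [seq t <- map snd F | t.1 == b].
    by rewrite filter_map -map_comp.
  have /(perm_map snd) := perm_filter (fun t => t.1 == b) pF => /perm_trans; apply.
  rewrite /Mtype filter_cat !filter_map map_cat -!map_comp /=.
  by case: b; rewrite /= ?filter_predT ?filter_pred0 ?cats0 /= map_id.
split; split.
- by exists k.
- exists cs; split.
  + move=> _ /mapP[x + ->]; rewrite mem_filter => /andP[_ xF]; apply/jordan_chainE.
    exists (usubmx x.1); rewrite size_map size_iota; split; first exact: (allP posF).
      by apply: eq_map => j; rewrite uE.
    by rewrite -uE /bv H2 //; apply/colP => i; rewrite !mxE.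
  + by rewrite basisEdim spq dimvf dim_matrix mulr1 -(leq_add2r (size (flatten ds))) szF leq_add2l.
  rewrite -map_comp (eq_map (g := fun x : string K (q + p) => x.2.2)); last first.
    by move=> x /=; rewrite size_map size_iota.
  by have := typ true; under eq_filter do rewrite eqb_id.
- by exists k.
exists ds; split.
+ move=> _ /mapP[x + ->]; rewrite mem_filter => /andP[_ xF]; apply/jordan_chainE.
  exists (dsubmx x.1); rewrite size_map size_iota; split; first exact: (allP posF).
    by apply: eq_map => j; rewrite dE.
  by rewrite -dE /bv H2 //; apply/colP => i; rewrite !mxE.
+ by rewrite basisEdim spp dimvf dim_matrix mulr1 -(leq_add2l (size (flatten cs))) szF leq_add2r.
rewrite -map_comp (eq_map (g := fun x : string K (q + p) => x.2.2)); last first.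
  by move=> x /=; rewrite size_map size_iota.
by have := typ false; under eq_filter do rewrite eqbF_neg.
Qed.

End Embeddings.

(** * Counting along strings *)

Section Counting.
Implicit Types (T : seq (bool * nat)) (s t : bool * nat) (r : seq bool).
Local Open Scope nat_scope.

(* Number of signs b in an alternating row whose last sign and length are given by t. *)
Definition sign_count (b : bool) t : nat := if t.1 == b then uphalf t.2 else half t.2.

Lemma count_iter k b c : \sum_(0 <= j < k) (iter j negb b == c) = sign_count c (b, k).
Proof.
rewrite /sign_count /=; elim: k => [|k IH]; first by rewrite big_geq //; case: eqP.
have -> : \sum_(0 <= j < k.+1) (iter j negb b == c) =
    \sum_(0 <= j < k) (iter j negb b == c) + (iter k negb b == c) by rewrite big_nat_recr.
have -> : iter k negb b = odd k (+) b by elim: (k) => //= n ->; rewrite addNb.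
rewrite IH {IH}; case: b; case: c; case ok : (odd k); rewrite /=; lia.
Qed.

Lemma sign_count_row b r : alternating r -> count_mem b r = sign_count b (rowtype r).
Proof.
move=> /rowtypeK; move: (rowtype r) => [c k] <-.
rewrite /row_of count_rev count_map -count_iter -sum1_count big_mkcond /index_iota subn0.
by apply: eq_bigr => j _ /=; case: eqP.
Qed.

Definition square_types T : seq (bool * nat) :=
  flatten [seq [:: (t.1, uphalf t.2); (~~ t.1, half t.2)] | t <- T].

Lemma square_types_perm T : perm_eq (square_types T)
  ([seq (true, sign_count true t) | t <- T] ++ [seq (false, sign_count false t) | t <- T]).
Proof.
apply/permP => a; rewrite count_cat /square_types; elim: T => //= t T ->.
by case: t => -[] k; rewrite /sign_count /=; lia.
Qed.

(** The dimension of the centralizer in gl_n of a nilpotent matrix with Jordan type [l]. *)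
Definition min_sum (l : seq nat) : nat := \sum_(a <- l) \sum_(b <- l) minn a b.

Lemma min_sum_perm l l' : perm_eq l l' -> min_sum l = min_sum l'.
Proof. by move=> ll'; rewrite /min_sum (perm_big _ ll'); apply: eq_bigr => a _; exact: perm_big. Qed.

Lemma min_sum_filter l : min_sum [seq k <- l | 0 < k] = min_sum l.
Proof.
have H F : F 0 = 0 -> \sum_(a <- l | 0 < a) F a = \sum_(a <- l) F a.
  by move=> F0; rewrite big_mkcond; apply: eq_bigr => -[].
rewrite /min_sum big_filter -[RHS]H; last by rewrite big1 // => b _; rewrite min0n.
by apply: eq_bigr => a _; rewrite big_filter; apply: H; rewrite minn0.
Qed.

(** The condition on j keeps only the last min (s.2, t.2) positions of t; the second term counts the
    positions left out. *)
Lemma hom_count s t : \sum_(0 <= j < t.2) ((iter j negb t.1 == s.1) && (t.2 <= j + s.2)) +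
  sign_count s.1 (t.1, t.2 - s.2) = sign_count s.1 t.
Proof.
rewrite [t in RHS]surjective_pairing -!count_iter.
have S F : \sum_(0 <= j < t.2) F j =
    \sum_(0 <= j < t.2 - s.2) F j + \sum_(t.2 - s.2 <= j < t.2) F j.
  by rewrite (big_cat_nat (n := t.2 - s.2)) ?leq_subr.
rewrite !S; set Z := \sum_(0 <= j < _) _.
have -> : Z = 0.
  rewrite /Z big1_seq // => j /=; rewrite mem_index_iota /= => jt.
  have -> : (t.2 <= j + s.2) = false by lia.
  by rewrite andbF.
rewrite add0n addnC; congr (_ + _); rewrite !big_seq; apply: eq_bigr => j.
by rewrite mem_index_iota leq_subLR addnC => /andP[-> _]; rewrite andbT.
Qed.

(** One count depends on parities and end degrees. Writing a and b for the numbers of + and -, the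
    sum of the two equals min (s.2, t.2) + (a_s - b_s) (a_t - b_t), stated here without
    subtraction. *)
Lemma hom_count_sym s t :
  let h s t := \sum_(0 <= j < t.2) ((iter j negb t.1 == s.1) && (t.2 <= j + s.2)) in
  h s t + h t s + (sign_count true s * sign_count false t + sign_count false s * sign_count true t)
  = minn s.2 t.2 + (sign_count true s * sign_count true t + sign_count false s * sign_count false t).
Proof.
move=> h; have := hom_count s t; have := hom_count t s; rewrite -/(h s t) -/(h t s).
case: s t => [b k] [c l]; rewrite /sign_count /=.
rewrite -(odd_double_half k) -(odd_double_half l); move: k./2 l./2 => k' l'.
case: (odd k); case: (odd l); case: b; case: c; rewrite /=; nia.
Qed.

(** Summed over all pairs of strings: twice the dimension of the centralizer is the sum of minima
    plus (q - p)^2. *)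
Lemma cent_count_negb T (qq pp : nat) : \sum_(t <- T) sign_count true t = qq ->
  \sum_(t <- T) sign_count false t = pp ->
  2 * cent_count negb T + 2 * (qq * pp) = min_sum (map snd T) + (qq * qq + pp * pp).
Proof.
move=> <- <-; rewrite /cent_count /min_sum big_map.
have -> : \sum_(t <- T) \sum_(b <- map snd T) minn t.2 b = \sum_(s <- T) \sum_(t <- T) minn s.2 t.2.
  by apply: eq_bigr => s _; rewrite big_map.
have prod (f g : bool * nat -> nat) :
    (\sum_(t <- T) f t) * (\sum_(t <- T) g t) = \sum_(s <- T) \sum_(t <- T) f s * g t.
  by rewrite big_distrl; apply: eq_bigr => s _; rewrite big_distrr.
rewrite !mul2n -!addnn {2}[\sum_(s <- T) _]exchange_big.
rewrite [X in _ + (_ + X)]mulnC !prod -!big_split; apply: eq_bigr => s _.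
by rewrite -!big_split; apply: eq_bigr => t _; exact: hom_count_sym.
Qed.

Lemma cent_count_id nu la : cent_count id (Mtype nu la) = min_sum nu + min_sum la.
Proof.
have h b c k l : \sum_(0 <= j < l) ((iter j id c == b) && (l <= j + k)) = (b == c) * minn k l.
  have it j : iter j id c = c by elim: j => //= j ->.
  have -> : \sum_(0 <= j < l) ((iter j id c == b) && (l <= j + k)) =
      \sum_(0 <= j < l) (if b == c then (l - k <= j : nat) else 0).
    by apply: eq_bigr => j _; rewrite it eq_sym leq_subLR addnC; case: eqP.
  case: eqP => _; last by rewrite big1 // mul0n.
  rewrite mul1n (big_cat_nat (n := l - k)) ?leq_subr //= [X in X + _]big1_seq ?add0n; last first.
    by move=> j /=; rewrite mem_index_iota /= => jl; rewrite leqNgt jl.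
  rewrite (eq_big_seq (fun=> 1)); last by move=> j; rewrite mem_index_iota => /andP[->].
  by rewrite sum_nat_const_nat muln1; lia.
rewrite /cent_count /Mtype big_cat /= !big_map; congr (_ + _); apply: eq_bigr => k _;
  rewrite big_cat /= !big_map.
  under eq_bigr do rewrite h mul1n.
  by under [X in _ + X]eq_bigr do rewrite h mul0n; rewrite big1_eq addn0.
under eq_bigr do rewrite h mul0n.
by under [X in _ + X]eq_bigr do rewrite h mul1n; rewrite big1_eq add0n.
Qed.

Lemma min_sign_count s t :
  minn (sign_count true s) (sign_count true t) + minn (sign_count false s) (sign_count false t)
    + [&& s.2 == t.2, odd s.2 & s.1 != t.1] = minn s.2 t.2.
Proof.
case: s t => [b k] [c l]; rewrite /sign_count /=.
rewrite -(odd_double_half k) -(odd_double_half l); move: k./2 l./2 => k' l'.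
by case: (odd k); case: (odd l); case: b; case: c; rewrite /=; lia.
Qed.

Lemma sorted_nth (nu : seq nat) i j : sorted geq nu -> i <= j -> nth 0 nu j <= nth 0 nu i.
Proof.
move=> snu ij; have [jn|jn] := ltnP j (size nu); last by rewrite nth_default.
have geq_tr : transitive geq by move=> a b c ab bc; exact: leq_trans bc ab.
by apply: (sorted_leq_nth geq_tr leqnn 0 snu) => //; rewrite inE; exact: leq_ltn_trans jn.
Qed.

Lemma sum_nth (nu : seq nat) (F : nat -> nat) m : F 0 = 0 -> size nu <= m ->
  \sum_(a <- nu) F a = \sum_(0 <= i < m) F (nth 0 nu i).
Proof.
move=> F0 nm; rewrite (big_cat_nat (n := size nu)) //= (big_nth 0) [X in _ = _ + X]big1_seq ?addn0 //.
by move=> i /=; rewrite mem_index_iota => /andP[ni _]; rewrite nth_default.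
Qed.

Lemma min_sum_nth nu m : size nu <= m ->
  min_sum nu = \sum_(0 <= i < m) \sum_(0 <= j < m) minn (nth 0 nu i) (nth 0 nu j).
Proof.
move=> nm; rewrite /min_sum (sum_nth (m := m)) //; last by rewrite big1 // => b _; rewrite min0n.
by apply: eq_bigr => i _; rewrite (sum_nth (m := m)) // minn0.
Qed.

(** Both sequences decrease, so for each pair of indices the larger index gives the minimum in [nu],
    in [la] and in their sum. *)
Lemma min_sum_part_add nu la : sorted geq nu -> sorted geq la ->
  min_sum (part_add nu la) = min_sum nu + min_sum la.
Proof.
move=> snu sla; set m := maxn (size nu) (size la).
rewrite (@min_sum_nth nu m) ?leq_maxl // (@min_sum_nth la m) ?leq_maxr //.
rewrite /part_add -/m (@min_sum_nth _ m) ?size_mkseq // -big_split /= !big_seq.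
apply: eq_bigr => i; rewrite mem_index_iota /= => im; rewrite -big_split /= !big_seq.
apply: eq_bigr => j; rewrite mem_index_iota /= => jm; rewrite !nth_mkseq //.
have [ij|/ltnW ij] := leqP i j.
  by have := sorted_nth snu ij; have := sorted_nth sla ij; lia.
by have := sorted_nth snu ij; have := sorted_nth sla ij; lia.
Qed.

Lemma nth_filter_sorted (a : seq nat) i : sorted geq a ->
  nth 0 [seq k <- a | 0 < k] i = nth 0 a i.
Proof.
elim: a i => [//|x a IH] i sx; have sa : sorted geq a by exact: path_sorted sx.
case: x sx => [|x] sx /=; last by case: i => //= i; exact: IH.
have a0 : forall j, nth 0 a j = 0.
  by move=> j; apply/eqP; rewrite -leqn0; exact: (@sorted_nth (0 :: a) 0 j.+1 sx).
have -> : [seq k <- a | 0 < k] = [::].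
  apply/eqP; rewrite -size_eq0 size_filter -leqn0 leqNgt -has_count; apply/hasPn => k ka.
  by rewrite -(nth_index 0 ka) a0.
by case: i => //= i; rewrite a0 nth_nil.
Qed.

End Counting.

(** * Signed Young diagrams *)

Section SignedDiagrams.
Variables q p : nat.
Implicit Types L U : SYD q p.

Definition types L : seq (bool * nat) := [seq rowtype r | r <- syd_rows L].

Lemma syd_rowsP L : [/\ sorted geq (sh L), all alternating (syd_rows L), 0%N \notin sh L,
  count_mem true (flatten (syd_rows L)) = q & count_mem false (flatten (syd_rows L)) = p].
Proof.
by have /and4P[/and3P[? ? _] ? /eqP ? /eqP ?] := fillingP (repr L); split.
Qed.

Lemma types_rows L : syd_rows L = map row_of (types L).
Proof.
have [_ /allP alt _ _ _] := syd_rowsP L.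
by rewrite -map_comp -[LHS]map_id; apply/eq_in_map => r rL /=; rewrite rowtypeK ?alt.
Qed.

Lemma types_pos L : postype (types L).
Proof.
have [_ _ nil0 _ _] := syd_rowsP L; rewrite /postype all_map; apply/allP => r rL /=.
by rewrite lt0n; apply: contraNneq nil0 => r0; apply/mapP; exists r.
Qed.

Lemma sh_types L : sh L = map snd (types L).
Proof. by rewrite /types -map_comp. Qed.

Lemma count_row b L : [seq count_mem b r | r <- syd_rows L] = [seq sign_count b t | t <- types L].
Proof.
have [_ /allP alt _ _ _] := syd_rowsP L; rewrite /types -map_comp.
by apply/eq_in_map => r rL; rewrite sign_count_row ?alt.
Qed.

Lemma sum_sign_count b L : (\sum_(t <- types L) sign_count b t = if b then q else p)%N.
Proof.
have [_ _ _ cq cp] := syd_rowsP L.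
transitivity (count_mem b (flatten (syd_rows L))); last by case: b.
by rewrite count_flatten count_row sumnE big_map.
Qed.

Lemma syd_eq L U : perm_eq (types L) (types U) -> L = U.
Proof.
move=> /(perm_map row_of); rewrite -!types_rows => LU.
by rewrite -[L]reprK -[U]reprK; apply/eqmodP.
Qed.

Lemma syd_of_types (T : seq (bool * nat)) : postype T ->
  (\sum_(t <- T) sign_count true t = q)%N -> (\sum_(t <- T) sign_count false t = p)%N ->
  exists U, perm_eq (types U) T.
Proof.
move=> pT Tq Tp; pose rs := sort (relpre size geq) (map row_of T).
have alt_row t : alternating (row_of t).
  rewrite /row_of -traject_iota /alternating rev_sorted.
  rewrite (eq_sorted (e' := fun a b : bool => b == ~~ a)); last by move=> [] [].
  case: t => b [|k] //=; apply/path_traject; rewrite size_traject //.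
have rowtype_row t : t \in T -> rowtype (row_of t) = t.
  move=> /(allP pT); case: t => b [|k] // _; rewrite /rowtype /row_of size_rev size_map size_iota /=.
  by rewrite rev_cons last_rcons.
have prs : perm_eq rs (map row_of T) by rewrite perm_sort.
have cnt b : count_mem b (flatten rs) = (\sum_(t <- T) sign_count b t)%N.
  rewrite count_flatten (perm_sumn (perm_map _ prs)) -map_comp sumnE big_map !big_seq.
  by apply: eq_bigr => t tT /=; rewrite sign_count_row // rowtype_row.
have fP : is_filling q p rs.
  apply/and4P; split.
  - apply/and3P; split.
    + rewrite /rs -sort_map; apply: sort_sorted => a b; exact: leq_total.
    + apply/negP => /mapP[r]; rewrite (perm_mem prs) => /mapP[t tT ->].
      rewrite /row_of size_rev size_map size_iota => E.
      by have := allP pT t tT; rewrite -E.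
    + rewrite -/(shape rs) -size_flatten.
      have -> : size (flatten rs) = (count_mem true (flatten rs) + count_mem false (flatten rs))%N.
        rewrite -(count_predC (pred1 true)); congr (_ + _)%N; apply: eq_count => -[] //.
      by rewrite !cnt Tq Tp.
  - by apply/allP => r; rewrite (perm_mem prs) => /mapP[t _ ->].
  - by rewrite cnt Tq.
  - by rewrite cnt Tp.
pose f := Filling fP; exists (\pi_(SYD q p)%qT f).
have : perm_eq (syd_rows (\pi_(SYD q p)%qT f)) rs.
  by have /eqmodP : (repr (\pi_(SYD q p) f) = f %[mod (SYD q p)])%qT by rewrite reprK.
move=> /perm_trans /(_ prs) /(perm_map rowtype); rewrite -/(types _) -map_comp.
by rewrite (_ : map (rowtype \o row_of) T = T) // -[RHS]map_id; apply/eq_in_map.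
Qed.

(** A diagram is determined by its types, a list of at most q + p pairs with lengths at most q + p.
    Finiteness is what lets an irreducible set in a fibre closure be placed in one orbit closure. *)
Lemma syd_finite : exists l : seq (SYD q p), forall L, L \in l.
Proof.
set n := (q + p)%N.
pose TT (b : n.-bseq (bool * 'I_n.+1)%type) : seq (bool * nat) := [seq (x.1, val x.2) | x <- b].
pose f (b : n.-bseq (bool * 'I_n.+1)%type) : option (SYD q p) :=
  if pselect (exists U, perm_eq (types U) (TT b)) is left e then Some (projT1 (cid e)) else None.
exists (pmap f (enum {: n.-bseq (bool * 'I_n.+1)%type})) => L; rewrite mem_pmap; apply/mapP.
have sumL : sumn (map snd (types L)) = n.
  by rewrite -sh_types; have /and4P[/and3P[_ _ /eqP]] := fillingP (repr L).
have szL : (size (types L) <= n)%N.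
  rewrite -sumL; elim: (types L) (types_pos L) => //= t T IH /andP[t0 /IH H].
  by rewrite -add1n leq_add.
have leL t : t \in types L -> (t.2 <= n)%N.
  by rewrite -sumL sumnE big_map => tT; rewrite (big_rem t tT) /= leq_addr.
pose b := insub_bseq n [seq (t.1, inord t.2 : 'I_n.+1) | t <- types L].
have TTb : TT b = types L.
  have bE : bseqval b = [seq (t.1, inord t.2 : 'I_n.+1) | t <- types L].
    by rewrite /b /insub_bseq /insubd insubT // size_map.
  rewrite /TT bE -map_comp -[RHS]map_id.
  by apply/eq_in_map => t /leL tn; rewrite /= inordK // -surjective_pairing.
exists b; first by rewrite mem_enum.
rewrite /f; case: pselect => [e|[]]; last by exists L; rewrite TTb.
by case: cid => U /= HU; congr Some; apply: syd_eq; rewrite perm_sym -TTb.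
Qed.

Lemma perm_sign_part b L : perm_eq (sign_part b L) [seq k <- [seq sign_count b t | t <- types L] | (0 < k)%N].
Proof. by rewrite /sign_part count_row perm_sort. Qed.

Lemma sign_part_sorted b L : sorted geq (sign_part b L).
Proof. by apply: sort_sorted => x y; exact: leq_total. Qed.

Lemma sign_part_pos b L : 0%N \notin sign_part b L.
Proof. by rewrite (perm_mem (perm_sign_part b L)) mem_filter. Qed.

Lemma sumn_sign_part b L : sumn (sign_part b L) = if b then q else p.
Proof.
rewrite (perm_sumn (perm_sign_part b L)) sumnE big_filter big_map big_mkcond -(sum_sign_count b L).
by apply: eq_bigr => t _; case: posnP => [->|].
Qed.

Lemma min_sum_sign_part b L :
  min_sum (sign_part b L) = min_sum [seq sign_count b t | t <- types L].
Proof. by rewrite (min_sum_perm (perm_sign_part b L)) min_sum_filter. Qed.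

Definition positive_part (T : seq (bool * nat)) := [seq t <- T | (0 < t.2)%N].

(** Squaring separates the + and - boxes of each row; rows left without boxes of a sign must be
    dropped, as in [sign_part]. *)
Lemma square_types_Mtype L :
  perm_eq (positive_part (square_types (types L))) (Mtype (syd_plus L) (syd_minus L)).
Proof.
apply: perm_trans (perm_filter _ (square_types_perm _)) _.
have F b : [seq t <- [seq (b, sign_count b t) | t <- types L] | (0 < t.2)%N] =
    [seq (b, k) | k <- [seq k <- [seq sign_count b t | t <- types L] | (0 < k)%N]].
  by elim: (types L) => //= t T ->; case: ifP.
rewrite filter_cat !F /Mtype.
by apply: perm_cat; apply: perm_map; rewrite perm_sym; exact: perm_sign_part.
Qed.

Lemma Mtype_inj nu la nu' la' : sorted geq nu -> sorted geq la -> sorted geq nu' -> sorted geq la' ->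
  perm_eq (Mtype nu la) (Mtype nu' la') -> (nu, la) = (nu', la').
Proof.
move=> snu sla snu' sla' H.
have sub b l l' : [seq t.2 | t <- Mtype l l' & t.1 == b] = if b then l else l'.
  rewrite /Mtype filter_cat !filter_map map_cat -!map_comp /=.
  by case: b; rewrite /= ?filter_predT ?filter_pred0 ?cats0 /= map_id.
have tr : transitive geq by move=> a b c ab bc; exact: leq_trans bc ab.
have anti : antisymmetric geq by move=> a b; rewrite andbC => /anti_leq.
have E b := perm_map snd (perm_filter (fun t => t.1 == b) H).
congr (_, _); apply: (sorted_eq tr anti) => //.
  by have := E true; rewrite !sub.
by have := E false; rewrite !sub.
Qed.

Lemma admissible_min_sum L : admissible L ->
  min_sum (sh L) = (min_sum (syd_plus L) + min_sum (syd_minus L))%N.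
Proof. by move=> ->; apply: min_sum_part_add; exact: sign_part_sorted. Qed.

Definition crossing L : Prop := exists2 m, (true, m.*2.+1) \in types L & (false, m.*2.+1) \in types L.

Lemma min_sum_cross L : (min_sum (syd_plus L) + min_sum (syd_minus L) +
   \sum_(s <- types L) \sum_(t <- types L) [&& s.2 == t.2, odd s.2 & s.1 != t.1] = min_sum (sh L))%N.
Proof.
rewrite /syd_plus /syd_minus !min_sum_sign_part sh_types /min_sum !big_map -!big_split.
apply: eq_bigr => s _; rewrite !big_map -!big_split; apply: eq_bigr => t _.
exact: min_sign_count.
Qed.

Lemma min_sum_le L : (min_sum (syd_plus L) + min_sum (syd_minus L) <= min_sum (sh L))%N.
Proof. by rewrite -min_sum_cross leq_addr. Qed.

Lemma crossing_or L : crossing L \/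
  forall s t, s \in types L -> t \in types L -> [&& s.2 == t.2, odd s.2 & s.1 != t.1] = false.
Proof.
have [H|nH] := pselect (exists s t, [/\ s \in types L, t \in types L &
    [&& s.2 == t.2, odd s.2 & s.1 != t.1]]); [left|right].
  case: H => -[b k] [[c l] [sL tL /= /and3P[/eqP kl ok bc]]]; move: sL tL bc; rewrite -{l}kl.
  have -> : k = k./2.*2.+1 by rewrite -[LHS]odd_double_half ok.
  by case: b; case: c => // sL tL _; exists k./2.
by move=> s t sL tL; apply/negP => H; apply: nH; exists s, t.
Qed.

(** Without a crossing, a row at least as long as another has at least as many boxes of each sign.
    Hence the sign counts are already decreasing in row order, and the parts of the two partitions
    add up row by row. *)
Lemma not_crossing_admissible L : ~ crossing L -> admissible L.
Proof.
move=> nc; have [//|H] := crossing_or L.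
have mono b s t : s \in types L -> t \in types L -> geq s.2 t.2 ->
    geq (sign_count b s) (sign_count b t).
  move=> sL tL; have := H s t sL tL; case: s t {sL tL} => [c k] [d l] /=.
  rewrite /sign_count /= -(odd_double_half k) -(odd_double_half l); move: k./2 l./2 => k' l'.
  by case: (odd k); case: (odd l); case: b; case: c; case: d; rewrite /=; lia.
have srt b : sorted geq [seq sign_count b t | t <- types L].
  have [+ _ _ _ _] := syd_rowsP L; rewrite sh_types; move: (mono b); move: (types L) => T mT.
  rewrite !sorted_map; apply: (sub_in_sorted (P := mem T)); last by apply/allP.
  by move=> s t sT tT; exact: mT.
have partE b : sign_part b L = [seq k <- [seq sign_count b t | t <- types L] | (0 < k)%N].
  have tr : transitive geq by move=> x y z xy yz; exact: leq_trans yz xy.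
  by rewrite /sign_part count_row (sorted_sort tr) //; exact: sorted_filter.
have nthE b i : nth 0 (sign_part b L) i = nth 0 [seq sign_count b t | t <- types L] i.
  by rewrite partE nth_filter_sorted.
(* A row beyond both partitions would have no box of either sign, but rows are nonempty. *)
have szE : maxn (size (syd_plus L)) (size (syd_minus L)) = size (types L).
  apply/eqP; rewrite eqn_leq; apply/andP; split.
    have szp b : (size (sign_part b L) <= size (types L))%N.
      by rewrite partE size_filter -(size_map (sign_count b) (types L)); exact: count_size.
    by rewrite geq_max; apply/andP; split; exact: szp.
  rewrite leqNgt gtn_max; apply/negP => /andP[h1 h2].
  set M := maxn (size (syd_plus L)) (size (syd_minus L)).
  have ML : (M < size (types L))%N by rewrite gtn_max h1.
  have := allP (types_pos L) _ (mem_nth (true, 0%N) ML).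
  have e b : sign_count b (nth (true, 0%N) (types L) M) = 0%N.
    rewrite -(nth_map _ 0%N) // -nthE nth_default //.
    by case: b; [exact: leq_maxl | exact: leq_maxr].
  have := e true; have := e false.
  by case: (nth _ _ M) => -[] k; rewrite /sign_count /=; lia.
rewrite /admissible /part_add szE sh_types; apply: (eq_from_nth (x0 := 0%N)).
  by rewrite size_mkseq size_map.
move=> i; rewrite size_map => iL; rewrite nth_mkseq // /syd_plus /syd_minus !nthE.
rewrite !(nth_map (true, 0%N)) //; case: (nth _ _ i) => -[] k; rewrite /sign_count /=; lia.
Qed.

End SignedDiagrams.

(** * Orbits in the fibres of the moment map *)

Section MomentFibre.
Variables (K : fieldType) (q p : nat).
Hypothesis Kinf : infinite_field K.
Implicit Types L U : SYD q p.
Notation emb0_lfun := (emb0_lfun K q p).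
Notation emb1_lfun := (emb1_lfun K q p).
Let emb1_lfunP := @emb1_lfunP K q p.
Let emb0_lfunP := @emb0_lfunP K q p.
Let emb1_lfun_inj := @emb1_lfun_inj K q p.
Let emb0_lfun_inj := @emb0_lfun_inj K q p.
Let idK : involutive (@id bool). Proof. by []. Qed.

Lemma nilp_orbit_stratum L : nilp_orbit K L = stratum emb1_lfun (types L).
Proof. exact: nilp_orbitE. Qed.

Lemma rank_gproj c : \rank (gproj K q p c) = if c then q else p.
Proof.
by case: c; rewrite /gproj /= rank_diag_block_mx mxrank0 mxrank1 ?addn0.
Qed.

Lemma rk_count0 T c : rk_count negb T 0 c = (\sum_(t <- T) sign_count c t)%N.
Proof. by apply: eq_bigr => -[b k] _; rewrite subn0 count_iter. Qed.

Lemma nilp_orbit_nonempty L : stratum emb1_lfun (types L) !=set0.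
Proof.
apply: (stratum_nonempty negbK emb1_lfunP); apply/allP => b _ /=; apply/eqP.
rewrite count_cat !count_nseq count_flatten -map_comp sumnE big_map.
transitivity (if b then q else p); last by case: b => /=; rewrite ?mul1n ?mul0n ?addn0.
rewrite -(sum_sign_count b L); apply: eq_bigr => -[c k] _ /=.
rewrite count_map -count_iter -sum1_count big_mkcond /index_iota subn0.
by apply: eq_bigr => j _ /=; case: eqP.
Qed.

Lemma nilp_orbit_dim L :
  zariski_dim (nilp_orbit K L) = (q * q + p * p - cent_count negb (types L))%N.
Proof.
rewrite nilp_orbit_stratum -(dim_degree0_mx K); apply: zariski_dimE.
exact: (stratum_is_dim emb1_lfun_inj emb1_lfunP Kinf (types_pos L) (nilp_orbit_nonempty L)).
Qed.

Lemma nilp_orbit_irreducible L : irreducible (nilp_orbit K L).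
Proof.
rewrite nilp_orbit_stratum.
exact: (stratum_irreducible emb1_lfun_inj emb1_lfunP Kinf (types_pos L) (nilp_orbit_nonempty L)).
Qed.

Lemma nilp_orbit_closure_inj L U :
  zariski_closure (nilp_orbit K L) = zariski_closure (nilp_orbit K U) -> L = U.
Proof.
rewrite !nilp_orbit_stratum => E; apply: syd_eq.
apply: (stratum_closure_inj negbK emb1_lfunP (types_pos L) (types_pos U) _ _ E);
  exact: nilp_orbit_nonempty.
Qed.

Lemma muH_stratum T z : stratum emb1_lfun T z -> stratum emb0_lfun (positive_part (square_types T)) (muH K q p z).
Proof.
move=> [F sF pF]; rewrite emb1_lfunE in sF.
have hz : homogeneous (gproj K q p) negb (emb1 z) by apply/emb1_lfunP; rewrite -emb1_lfunE memv_img ?memvf.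
have := filter_strings (square_strings hz sF); rewrite -muH_square -emb0_lfunE => sF'.
eexists; first exact: sF'.
match goal with |- context [filter _ ?s] => set S := s end.
have -> : map snd [seq x <- S | (0 < x.2.2)%N] = positive_part (map snd S).
  by rewrite /positive_part filter_map.
apply: perm_filter; rewrite /S /square_types.
apply: perm_trans (perm_flatten (perm_map _ pF)).
by rewrite map_flatten -!map_comp; exact: perm_refl.
Qed.

Lemma muH_nilp_orbit L z : nilp_orbit K L z ->
  M_class K q p (syd_plus L) (syd_minus L) (muH K q p z).
Proof.
rewrite nilp_orbit_stratum M_classE ?sign_part_pos // => /muH_stratum.
by rewrite (stratum_perm _ (square_types_Mtype L)).
Qed.

Lemma Mtype_pos L : postype (Mtype (syd_plus L) (syd_minus L)).
Proof.
rewrite /postype -(perm_all _ (square_types_Mtype L)); apply/allP => t.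
by rewrite mem_filter => /andP[].
Qed.

Lemma M_class_nonempty L : stratum emb0_lfun (Mtype (syd_plus L) (syd_minus L)) !=set0.
Proof.
have [z] := nilp_orbit_nonempty L; rewrite -nilp_orbit_stratum => /muH_nilp_orbit.
by rewrite M_classE ?sign_part_pos // => H; exists (muH K q p z).
Qed.

Lemma M_class_dim L : zariski_dim (M_class K q p (syd_plus L) (syd_minus L)) =
  (q * q + p * p - cent_count id (Mtype (syd_plus L) (syd_minus L)))%N.
Proof.
rewrite M_classE ?sign_part_pos // -(dim_degree0_mx K); apply: zariski_dimE.
exact: (stratum_is_dim emb0_lfun_inj emb0_lfunP Kinf (Mtype_pos L) (M_class_nonempty L)).
Qed.

Lemma M_class_inj L U z : M_class K q p (syd_plus L) (syd_minus L) z ->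
  M_class K q p (syd_plus U) (syd_minus U) z ->
  (syd_plus L, syd_minus L) = (syd_plus U, syd_minus U).
Proof.
rewrite !M_classE ?sign_part_pos // => Lz Uz.
apply: Mtype_inj; rewrite ?sign_part_sorted //.
exact: (stratum_uniq idK emb0_lfunP (Mtype_pos L) (Mtype_pos U) Lz Uz).
Qed.

(** The odd operator is nilpotent because its square is, so it has a string decomposition, whose
    types form a diagram; that diagram has the right sign parts since Jordan types are unique. *)
Lemma moment_fibre L z : M_class K q p (syd_plus L) (syd_minus L) (muH K q p z) ->
  exists2 U, nilp_orbit K U z & (syd_plus U, syd_minus U) = (syd_plus L, syd_minus L).
Proof.
move=> Hz; have hz : homogeneous (gproj K q p) negb (emb1 z) by apply/emb1_lfunP; rewrite -emb1_lfunE memv_img ?memvf.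
have nz : exists k, emb1 z ^+ k = 0.
  move: Hz; rewrite M_classE ?sign_part_pos // => -[F]; rewrite emb0_lfunE muH_square.
  by move=> /strings_nilpotent[k] Nk _; exists (2 * k)%N; rewrite exprM.
have EE := @gprojM K q p; have E1 := @gprojD K q p.
have [F sF pF] := strings_exist EE E1 negbK hz nz.
(* The rank formula with k = 0 counts the vectors of degree c. *)
have cnt c : (\sum_(t <- map snd F) sign_count c t = if c then q else p)%N.
  by rewrite -rk_count0 -(rank_strings EE _ _ hz sF) mul1mx rank_gproj.
have pT : postype (map snd F) by rewrite /postype all_map.
have [U HU] := syd_of_types pT (cnt true) (cnt false).
have Uz : nilp_orbit K U z.
  by rewrite nilp_orbit_stratum; exists F; rewrite ?emb1_lfunE // perm_sym.
by exists U => //; exact: M_class_inj (muH_nilp_orbit Uz) Hz.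
Qed.

(** The defect in condition (2) is thus the defect in the inequality between the sums of minima. *)
Lemma nilp_orbit_dim_min_sum L :
  (2 * zariski_dim (nilp_orbit K L) + min_sum (sh L) =
   2 * (sumn (syd_plus L) * sumn (syd_minus L))
    + zariski_dim (M_class K q p (syd_plus L) (syd_minus L))
    + (min_sum (syd_plus L) + min_sum (syd_minus L)))%N.
Proof.
rewrite nilp_orbit_dim M_class_dim /syd_plus /syd_minus !sumn_sign_part /=.
have h1 := cent_count_negb (sum_sign_count true L) (sum_sign_count false L).
rewrite -sh_types /= in h1.
have h2 : (cent_count negb (types L) <= q * q + p * p)%N.
  rewrite -(dim_degree0_mx K).
  exact: (cent_count_le emb1_lfunP (types_pos L) (nilp_orbit_nonempty L)).
have h3 : (cent_count id (Mtype (syd_plus L) (syd_minus L)) <= q * q + p * p)%N.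
  rewrite -(dim_degree0_mx K).
  exact: (cent_count_le emb0_lfunP (Mtype_pos L) (M_class_nonempty L)).
have h4 := cent_count_id (syd_plus L) (syd_minus L).
move: h1 h2 h3 h4; rewrite /syd_plus /syd_minus.
move: (cent_count _ _) (cent_count _ _) (min_sum _) (min_sum _) (min_sum _) => a b c d e.
by move: (q * p)%N (q * q)%N (p * p)%N => x y w; lia.
Qed.

Lemma nilp_orbit_dim_lt L U : syd_le K L U -> L <> U ->
  (zariski_dim (nilp_orbit K L) < zariski_dim (nilp_orbit K U))%N.
Proof.
move=> LU nLU; rewrite !nilp_orbit_dim -(dim_degree0_mx K).
have LU' : nilp_orbit K L `<=` zariski_closure (nilp_orbit K U).
  exact: subset_trans (@sub_zariski_closure _ _ _) LU.
have nUL : ~ nilp_orbit K U `<=` zariski_closure (nilp_orbit K L).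
  move=> UL; apply: nLU; apply: nilp_orbit_closure_inj; apply/seteqP; split=> //.
  by apply: zariski_closure_sub UL; exact: zariski_closed_closure.
rewrite !nilp_orbit_stratum in LU' nUL.
by apply: (stratum_dim_lt emb1_lfun_inj emb1_lfunP Kinf) LU' nUL; rewrite ?types_pos //;
  exact: nilp_orbit_nonempty.
Qed.

(** The last clause says that both diagrams have the same + and - parts, in the form that
    [muH_stratum] delivers. *)
Lemma crossing_degeneration L : crossing L ->
  exists U, [/\ U <> L, syd_le K L U &
    perm_eq (positive_part (square_types (types U))) (positive_part (square_types (types L)))].
Proof.
move=> [m m1 m2].
have pL : perm_eq (types L) ((true, m.*2.+1) :: (false, m.*2.+1) ::
    rem (false, m.*2.+1) (rem (true, m.*2.+1) (types L))).
  apply: perm_trans (perm_to_rem m1) _; rewrite perm_cons; apply: perm_to_rem.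
  by move: m2; rewrite (perm_mem (perm_to_rem m1)) inE.
move: (rem _ _) pL => T0 pL.
(* For m = 0 the shortened row is empty and has to be removed. *)
pose T := positive_part ((true, m.*2.+2) :: (false, m.*2) :: T0).
have posT : postype T by apply/allP => t; rewrite mem_filter => /andP[].
have sumT (f : bool * nat -> nat) : (forall b, f (b, 0%N) = 0%N) ->
    (\sum_(t <- T) f t = f (true, m.*2.+2) + (f (false, m.*2) + \sum_(t <- T0) f t))%N.
  move=> f0; rewrite /T /positive_part big_filter big_mkcond !big_cons -!big_mkcond /=.
  congr (_ + (_ + _))%N.
    by case: (m) => // ; rewrite f0.
  rewrite big_mkcond; apply: eq_bigr => -[b [|k]] _ //; by rewrite f0.
have cnt b : (\sum_(t <- T) sign_count b t = if b then q else p)%N.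
  rewrite sumT; last by move=> c; rewrite /sign_count /=; case: eqP.
  rewrite -(sum_sign_count b L) (perm_big _ pL) !big_cons /=.
  by case: b; rewrite /sign_count /=; lia.
have [U pU] := syd_of_types posT (cnt true) (cnt false).
exists U; split.
(* The sum of the squares of the row lengths distinguishes the diagrams: (2m+2)^2 + (2m)^2 exceeds 2
   (2m+1)^2 by 2. *)
- move=> UL; have := sumT (fun t => t.2 * t.2)%N (fun=> erefl).
  rewrite -(perm_big _ pU) UL (perm_big _ pL) !big_cons /=.
  by move: (\sum_(_ <- _) _)%N => S; nia.
- apply: zariski_closure_sub; first exact: zariski_closed_closure.
  rewrite !nilp_orbit_stratum (stratum_perm _ pU) => z [F0]; rewrite emb1_lfunE => sF0.
  move=> /perm_trans /(_ pL); rewrite perm_sym => /perm_map_lift[[//|x [//|x' F]]] pF0.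
  move=> [Ex Ex' TF]; have hz : homogeneous (gproj K q p) negb (emb1 z).
    by apply/emb1_lfunP; rewrite -emb1_lfunE memv_img ?memvf.
  have {sF0 pF0} sF : strings (gproj K q p) (emb1 z) [:: x, x' & F].
    by apply: perm_strings sF0; rewrite perm_sym.
  have pF : positive F.
    have : postype [:: (true, m.*2.+1), (false, m.*2.+1) & T0].
      by rewrite /postype -(perm_all _ pL); exact: types_pos.
    by rewrite /postype TF /= all_map.
  case: x x' Ex Ex' sF => [h xt] [h' xt'] /= <- <- sF.
  have [D [/emb1_lfunP/memv_imgP[e _ ->] HD]] := strings_deform (@gprojM K q p) hz sF pF.
  rewrite zariski_closureE => f pf fU.
  (* For t <> 0 the point z + t e lies in the orbit of U, so f restricted to this line vanishes off
     0, hence identically. *)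
  have [r fr] := polyfun_line z e pf.
  suff r0 : r = 0 by have := fr 0; rewrite scale0r addr0 r0 horner0.
  apply/eqP/negPn/negP => r0.
  have [|t] := @Kinf ('X * r); first by rewrite mulf_neq0 ?polyX_eq0.
  rewrite hornerM hornerX mulf_eq0 negb_or -fr => /andP[t0] /eqP; apply; apply: fU.
  have [G sG TG] := HD t t0; exists [seq y <- G | (0 < y.2.2)%N].
    by rewrite linearD linearZ /= {1}emb1_lfunE; exact: filter_strings.
  rewrite (_ : map snd _ = T) //.
  transitivity (positive_part (map snd G)); first by rewrite /positive_part filter_map.
  by rewrite TG /T TF.
have sqE S : positive_part (square_types (positive_part S)) = positive_part (square_types S).
  have sqC x S' : square_types (x :: S') =
    [:: (x.1, uphalf x.2); (~~ x.1, half x.2)] ++ square_types S' by [].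
  have posC S1 S2 : positive_part (S1 ++ S2) = positive_part S1 ++ positive_part S2.
    exact: filter_cat.
  elim: S => [//|[b [|k]] S IH]; first by rewrite sqC posC -IH.
  have -> : positive_part ((b, k.+1) :: S) = (b, k.+1) :: positive_part S by [].
  by rewrite !sqC !posC IH.
have sqP S S' : perm_eq S S' ->
    perm_eq (positive_part (square_types S)) (positive_part (square_types S')).
  by move=> SS'; apply/perm_filter/perm_flatten/perm_map.
apply: perm_trans (sqP _ _ pU) _; rewrite sqE.
rewrite perm_sym; apply: perm_trans (sqP _ _ pL) _.
(* Both pairs of rows have squares with parts m+1 and m of each sign. *)
apply: perm_filter; apply/permP => a /=; rewrite uphalf_double.
by move: (count a (flatten _)) => c; rewrite /= !doubleK; lia.
Qed.

End MomentFibre.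

Lemma numField_infinite (F : numFieldType) : infinite_field F.
Proof.
move=> r r0; apply: contrapT => H.
pose s := [seq n%:R : F | n <- iota 0 (size r)].
have us : uniq s by rewrite map_inj_uniq ?iota_uniq // => a b /eqP; rewrite Num.Theory.eqr_nat => /eqP.
have rs : all (root r) s.
  by apply/allP => t _; apply/negPn/negP => rt; apply: H; exists t.
by have := max_poly_roots r0 rs us; rewrite size_map size_iota ltnn.
Qed.

Theorem theorem4p13 (R : realType) (p q : nat) (hp : (0 < p)%N) (hq : (0 < q)%N)
    (L : SYD q p) :
  [<-> admissible L;
       (2 * zariski_dim (nilp_orbit R[i] L)
         = 2 * (sumn (syd_plus L) * sumn (syd_minus L))
           + zariski_dim (M_class R[i] q p (syd_plus L) (syd_minus L)))%N;
       syd_maximal R[i]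
         [set U : SYD q p |
            (syd_plus U, syd_minus U) = (syd_plus L, syd_minus L)] L;
       irreducible_component
         (zariski_closure (nilp_orbit R[i] L))
         (zariski_closure
            (muH R[i] q p @^-1` M_class R[i] q p (syd_plus L) (syd_minus L)))].
Proof.
have Kinf : infinite_field R[i] := @numField_infinite R[i].
have fibre U : (syd_plus U, syd_minus U) = (syd_plus L, syd_minus L) ->
    nilp_orbit R[i] U `<=` muH R[i] q p @^-1` M_class R[i] q p (syd_plus L) (syd_minus L).
  by move=> [<- <-] z /muH_nilp_orbit.
tfae.
- move=> /admissible_min_sum E.
  by have := nilp_orbit_dim_min_sum Kinf L; rewrite E => /addIn.
(* For U in the same fibre, [min_sum_le] bounds the dimension of its orbit by that of L, whereas a
   strictly larger closure would have larger dimension. *)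
- move=> dimL; split=> // U UL LU; apply: contrapT => nUL.
  have := nilp_orbit_dim_lt Kinf LU (nesym nUL).
  have := nilp_orbit_dim_min_sum Kinf U; have := min_sum_le U.
  case: UL => -> ->; rewrite -dimL; lia.
- move=> [_ max]; split.
  + by apply: irreducible_closure; exact: nilp_orbit_irreducible.
  + by apply: zariski_closureS; exact: fibre.
  move=> A irrA LA AX; have [l ll] := syd_finite q p.
  pose r := [seq U <- l | `[< (syd_plus U, syd_minus U) = (syd_plus L, syd_minus L) >]].
  have cl (U : SYD q p) : zariski_closed (zariski_closure (nilp_orbit R[i] U)).
    exact: zariski_closed_closure.
  (* The fibre closure is covered by the finitely many closures of its orbits; A lies in one of
     them, which maximality identifies with that of L. *)
  have [v Av|U] := irreducible_cover (r := r) irrA cl.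
    apply: (zariski_closure_sub (zariski_closed_cover r cl) _ (AX v Av)) => z /moment_fibre[U Uz UL].
    exists U; last exact: sub_zariski_closure.
    by rewrite mem_filter ll andbT; exact/asboolP.
  rewrite mem_filter => /andP[/asboolP UL _] AU.
  have UL' : U = L by apply: max UL _; exact: subset_trans LA AU.
  by apply/seteqP; split=> //; rewrite -{1}UL'.
(* A crossing would give an orbit in the same fibre whose closure is irreducible and strictly
   contains that of L. *)
- move=> [irrL _ maxL]; apply: not_crossing_admissible => /(crossing_degeneration Kinf).
  move=> [U [UL LU sqU]]; apply: UL; apply: (@nilp_orbit_closure_inj R[i] q p).
  apply: maxL => //; first by apply: irreducible_closure; exact: nilp_orbit_irreducible.
  apply: zariski_closureS => z; rewrite nilp_orbit_stratum => /muH_stratum.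
  rewrite /preimage /= M_classE ?sign_part_pos // (stratum_perm _ sqU).
  by rewrite (stratum_perm _ (square_types_Mtype L)).
Qed.
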